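(* Let $K$ be a field, let $\mathcal{Q}$ be a bipartite quiver with $d$ vertices and arrows $h_1,\dots,h_r$, and let $\mathbf{m}=(m_\gamma)_{\gamma}$, $\mathbf{u}=(u_\gamma)_\gamma$ be tuples of nonnegative integers indexed by the vertices. Let $I_{\mathcal{Q},\mathbf{m},\mathbf{u}}\subseteq K[X]$ be the bipartite determinantal ideal, i.e. the ideal generated by $\bigcup_{\gamma}D_{u_\gamma+1}(A_\gamma)$. Then this set of natural generators $\bigcup_{\gamma}D_{u_\gamma+1}(A_\gamma)$ is a Gröbner basis of $I_{\mathcal{Q},\mathbf{m},\mathbf{u}}$ with respect to any lexicographic monomial order on $K[X]$ that is consistent with $A_\gamma$ for every vertex $\gamma$.
   Context: A bipartite quiver is a quiver whose vertex set is a disjoint union $V_{\rm source}\sqcup V_{\rm sink}$ such that every arrow $h$ has source ${\rm s}(h)\in V_{\rm source}$ and target ${\rm t}(h)\in V_{\rm sink}$. For each arrow $h_k$ let $X^{(k)}=[x^{(k)}_{ij}]$ be an $m_{{\rm t}(h_k)}\times m_{{\rm s}(h_k)}$ matrix of independent variables (all variables $x^{(k)}_{ij}$, over all $k,i,j$, are distinct), and let $K[X]$ be the polynomial ring in all of them. For a sink $\alpha$, let $r_1<\dots<r_s$ be the indices of all arrows with target $\alpha$ and set $A_\alpha=[X^{(r_1)}|X^{(r_2)}|\cdots|X^{(r_s)}]$ (horizontal concatenation). For a source $\beta$, let $r'_1<\dots<r'_t$ be the indices of all arrows with source $\beta$ and let $A_\beta$ be the vertical stacking of $X^{(r'_1)},\dots,X^{(r'_t)}$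 (in this order, top to bottom). For a matrix $C$ and positive integer $u$, $D_u(C)$ denotes the set of all $u\times u$ minors of $C$. A monomial order $>$ is consistent with a matrix of variables $C=(c_{ij})$ if $c_{ij}>c_{ij'}$ whenever $j'>j$ and $c_{ij}>c_{i'j}$ whenever $i'>i$ (variables decrease from left to right and from top to bottom). *)

(* Defs.v *)
From HB Require Import structures.
From mathcomp Require Import all_boot all_order all_algebra.
From mathcomp Require Import mpoly.
Set Implicit Arguments. Unset Strict Implicit. Unset Printing Implicit Defensive.
Import GRing.Theory.
Local Open Scope ring_scope.

(* A bipartite quiver: vertices 'I_d, arrows 'I_r with source map [s] and
   target map [t]; [srcV] is the set V_source (V_sink is its complement).
   [m] is the dimension vector.  The variables of K[X] are the triples
   (k, i, j) with k : 'I_r, i < m (t k), j < m (s k), i.e. the finType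
   [qvar t s m] below; K[X] is {mpoly K[#|qvar t s m|]} with the variable
   x^(k)_{ij} being 'X_(enum_rank (k,i,j)). *)

Definition bipartite_quiver (d r : nat) (srcV : pred 'I_d)
  (s t : 'I_r -> 'I_d) : Prop :=
  forall k, srcV (s k) /\ ~~ srcV (t k).

Section QuiverVars.
Variables (d r : nat) (s t : 'I_r -> 'I_d) (m : 'I_d -> nat).

Definition qvar : finType :=
  {k : 'I_r & ('I_(m (t k)) * 'I_(m (s k)))%type}.

Definition qvar_of (k i j : nat) : option qvar :=
  match insub k with
  | Some k' =>
      match (insub i : option 'I_(m (t k'))), (insub j : option 'I_(m (s k'))) with
      | Some i', Some j' => Some (Tagged (fun k0 : 'I_r => ('I_(m (t k0)) * 'I_(m (s k0)))%type) (i', j'))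
      | _, _ => None
      end
  | None => None
  end.

(* For a sink alpha: the columns of A_alpha = [X^(r_1) | ... | X^(r_s)],
   listed as pairs (k, j) (arrow index, column index of X^(k)), in order. *)
Definition sink_cols (a : 'I_d) : seq (nat * nat) :=
  flatten [seq [seq (val k, j) | j <- iota 0 (m (s k))] | k <- enum 'I_r & t k == a].

(* For a source beta: the rows of A_beta (vertical stacking of X^(r'_1), ...,
   X^(r'_t)), listed as pairs (k, i), in order (top to bottom). *)
Definition source_rows (b : 'I_d) : seq (nat * nat) :=
  flatten [seq [seq (val k, i) | i <- iota 0 (m (t k))] | k <- enum 'I_r & s k == b].

(* Matrices of variables (entries are variables; option only for totality,
   every entry is in fact Some). *)
Definition A_sink (a : 'I_d) : 'M[option qvar]_(m a, size (sink_cols a)) :=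
  \matrix_(i, c) let kj := nth (0, 0)%N (sink_cols a) c in qvar_of kj.1 i kj.2.

Definition A_source (b : 'I_d) : 'M[option qvar]_(size (source_rows b), m b) :=
  \matrix_(c, j) let ki := nth (0, 0)%N (source_rows b) c in qvar_of ki.1 ki.2 j.

End QuiverVars.

Section Poly.
Variables (K : fieldType) (V : finType).

Definition PolyV := {mpoly K[#|V|]}.

Definition varX (v : V) : PolyV := 'X_(enum_rank v).

Definition polymx (p q : nat) (A : 'M[option V]_(p, q)) : 'M[PolyV]_(p, q) :=
  map_mx (fun o => oapp varX 0 o) A.

Definition strict_incr (u p : nat) (f : 'I_u -> 'I_p) : Prop :=
  forall a b : 'I_u, (a < b)%N -> (f a < f b)%N.

Definition minors (u p q : nat) (C : 'M[PolyV]_(p, q)) (g : PolyV) : Prop :=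
  exists (f : 'I_u -> 'I_p) (h : 'I_u -> 'I_q),
    strict_incr f /\ strict_incr h /\ g = \det (\matrix_(a, b) C (f a) (h b)).

Definition in_ideal (G : PolyV -> Prop) (f : PolyV) : Prop :=
  exists sq : seq (PolyV * PolyV),
    (forall x, x \in sq -> G x.2) /\ f = \sum_(x <- sq) x.1 * x.2.

(* Lexicographic monomial order determined by an ordering of the variables:
   [rk] injective, variable v is larger than w iff rk v < rk w. *)
Definition lex_gt (rk : V -> nat) (m1 m2 : 'X_{1..#|V|}) : Prop :=
  exists v : V, (m2 (enum_rank v) < m1 (enum_rank v))%N /\
    forall w : V, (rk w < rk v)%N -> m1 (enum_rank w) = m2 (enum_rank w).

Definition is_lex_order (rk : V -> nat) : Prop := injective rk.

Definition lead_mon (rk : V -> nat) (f : PolyV) (mon : 'X_{1..#|V|}) : Prop :=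
  mon \in msupp f /\ forall m' : 'X_{1..#|V|}, m' \in msupp f -> m' <> mon -> lex_gt rk mon m'.

Definition mon_divides (m1 m2 : 'X_{1..#|V|}) : Prop :=
  forall i : 'I_#|V|, (m1 i <= m2 i)%N.

Definition groebner_basis (rk : V -> nat) (G : PolyV -> Prop) : Prop :=
  forall f : PolyV, in_ideal G f -> f != 0 ->
    forall mf, lead_mon rk f mf ->
      exists g mg, G g /\ lead_mon rk g mg /\ mon_divides mg mf.

Definition consistent (rk : V -> nat) (p q : nat) (A : 'M[option V]_(p, q)) : Prop :=
  (forall (i : 'I_p) (j j' : 'I_q) v v', (j < j')%N ->
     A i j = Some v -> A i j' = Some v' ->
     lex_gt rk U_(enum_rank v) U_(enum_rank v')) /\
  (forall (i i' : 'I_p) (j : 'I_q) v v', (i < i')%N ->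
     A i j = Some v -> A i' j = Some v' ->
     lex_gt rk U_(enum_rank v) U_(enum_rank v')).

End Poly.

(* Main.v *)
(* Variables are deleted one at a time, from the largest to the smallest.  Call
   a chain in a matrix a sequence of entries strictly increasing in both
   indices; consistency makes the leading monomial of a minor the product of
   its diagonal, which is a chain.  A state is a set [L] of remaining variables
   together with a set [S] of deleted ones, and its ideal is generated by the
   minors with diagonal in [L] such that the diagonal extends, by a chain of [S]
   before it, to a chain longer than the bound of the matrix.  Initially
   [S = set0] and [L] is everything.

   Let [y] be the largest variable of [L].  A generator involving [y] is
   [y q + r], where [q] and [r] do not involve [y].  Let [N] be
   the state [(S, L - y)]; adding the [q] to it gives the state [(S + y, L - y)],
   so both are Groebner bases by induction.  The generators [y q + r] together with [N]
   then form a Groebner basis as soon as every syzygy [sum b q] in [(N)]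
   satisfies [sum b r] in [(N)].  Put [e = sum b r].  A block determinant
   identity gives [q r' - q' r] in [(N)], hence [q e] in [(N)] for all [q], and
   [e] is in [(N)] if each monomial outside in([N]) stays outside in([N]) after
   multiplication by the leading monomial of some [q].

   Monomials outside in([N]) are supported on the faces of a simplicial complex,
   and the last condition says that no facet [F] of it can be enlarged by [y].
   If some facet [F] can, then every [y q + r] already lies in [(N)]: walk down
   from [y] row by row, each time to the first column where [F] has an entry.
   A skipped entry cannot be added to [F] because of a long chain in the matrix
   of the other kind, and this limits the number of columns of each block which
   a nonzero minor modulo [(N)] can use; by Laplace expansion [y q + r] is in
   [(N)], for otherwise the walk produces a chain which is too long. *)
Require Import Defs.
From HB Require Import structures.
From mathcomp Require Import all_boot all_order all_fingroup all_algebra.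
From mathcomp Require Import mpoly.
From mathcomp Require Import zify.
From Stdlib Require Import Classical_Prop.
Set Implicit Arguments. Unset Strict Implicit. Unset Printing Implicit Defensive.
Import GRing.Theory.

(** * Longest increasing subsequences in 0/1 matrices *)

Section Lis.
Implicit Type w : nat -> nat -> bool.

(* The largest size of a set of 1s of [w] in its first [i] rows and [j] columns
   that is strictly increasing in both coordinates. *)
Fixpoint lis w (i : nat) : nat -> nat :=
  if i is i'.+1 then
    fix row (j : nat) : nat :=
      if j is j'.+1 then
        if w i' j' then (lis w i' j').+1 else maxn (lis w i' j) (row j')
      else 0
  else fun=> 0.

Arguments lis : simpl never.

Lemma lis_0 w i : lis w i 0 = 0.
Proof. by case: i. Qed.

(** A 1 in the corner can always be used: it may replace the last entry of any chain, so no maximum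
    is taken in that case. *)
Lemma lisS w i j : lis w i.+1 j.+1 =
  if w i j then (lis w i j).+1 else maxn (lis w i j.+1) (lis w i.+1 j).
Proof. by []. Qed.

(** Monotonicity and the diagonal bound support each other: when the new corner is a 1, comparing
    with a neighbouring cell needs that a diagonal step gains at most one. Hence the simultaneous
    induction on [i + j]. *)
Lemma lis_step w i j :
  [/\ lis w i j <= lis w i.+1 j, lis w i j <= lis w i j.+1
    & lis w i.+1 j.+1 <= (lis w i j).+1].
Proof.
have [n] := ubnP (i + j); elim: n i j => // n IH i j ltn.
have D1 : lis w i j.+1 <= (lis w i j).+1.
  case: i ltn => [//|i] ltn.
  have [h _ h2] := IH i j ltac:(lia).
  by apply: leq_trans h2 _; rewrite ltnS.
have D2 : lis w i.+1 j <= (lis w i j).+1.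
  case: j ltn D1 => [|j] ltn _; first by rewrite lis_0.
  have [_ h h2] := IH i j ltac:(lia).
  by apply: leq_trans h2 _; rewrite ltnS.
have C : lis w i.+1 j.+1 <= (lis w i j).+1.
  by rewrite lisS; case: ifP => // _; rewrite geq_max D1 D2.
split=> //.
- case: j ltn {D1 D2 C} => [|j] ltn; first by rewrite lis_0.
  rewrite lisS; case: ifP => _; last by rewrite leq_maxl.
  case: i ltn => [//|i] ltn.
  have [h _ h2] := IH i j ltac:(lia).
  by apply: leq_trans h2 _; rewrite ltnS.
- case: i ltn {D1 D2 C} => [//|i] ltn.
  rewrite lisS; case: ifP => _; last by rewrite leq_maxr.
  case: j ltn => [|j] ltn; first by rewrite lis_0.
  have [_ h h2] := IH i j ltac:(lia).
  by apply: leq_trans h2 _; rewrite ltnS.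
Qed.

Lemma leq_lis w i j i' j' : i <= i' -> j <= j' -> lis w i j <= lis w i' j'.
Proof.
move=> lei lej; apply: (@leq_trans (lis w i' j)).
  elim: i' lei => [|i' IH]; first by rewrite leqn0 => /eqP->.
  rewrite leq_eqVlt => /predU1P[->//|]; rewrite ltnS => /IH h.
  by apply: leq_trans h _; have [] := lis_step w i' j.
elim: j' lej => [|j' IH]; first by rewrite leqn0 => /eqP->.
rewrite leq_eqVlt => /predU1P[->//|]; rewrite ltnS => /IH h.
by apply: leq_trans h _; have [] := lis_step w i' j'.
Qed.

Lemma lis_le_row w i j : lis w i j <= i.
Proof.
elim: i j => [//|i IH]; elim=> [//|j IHj]; rewrite lisS.
by case: ifP => _; rewrite ?ltnS // geq_max IHj (leq_trans (IH _)).
Qed.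

Lemma leq_lis_sub w w' i j :
  (forall i' j', i' < i -> j' < j -> w i' j' -> w' i' j') ->
  lis w i j <= lis w' i j.
Proof.
elim: i j => [//|i IH]; elim=> [//|j IHj] sub; rewrite 2!lisS.
have h1 : lis w i j <= lis w' i j.
  by apply: IH => i' j' h h'; apply: sub; lia.
have h2 : lis w i j.+1 <= lis w' i j.+1.
  by apply: IH => i' j' h h'; apply: sub; lia.
have h3 : lis w i.+1 j <= lis w' i.+1 j.
  by apply: IHj => i' j' h h'; apply: sub; lia.
case: ifP => [wij|_]; first by rewrite (sub _ _ _ _ wij) // ltnS.
case: ifP => _; last by rewrite geq_max !leq_max h2 h3 orbT.
rewrite geq_max; have [g1 g2 g3] := lis_step w' i j.
apply/andP; split.
  by apply: leq_trans h2 _; apply: leq_trans g3; have [] := lis_step w' i j.+1.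
by apply: leq_trans h3 _; apply: leq_trans g3; have [] := lis_step w' i.+1 j.
Qed.

Lemma eq_lis w w' i j :
  (forall i' j', i' < i -> j' < j -> w i' j' = w' i' j') ->
  lis w i j = lis w' i j.
Proof.
move=> eqw; apply/eqP; rewrite eqn_leq !leq_lis_sub // => i' j' h h';
by rewrite eqw.
Qed.

Definition wshift w a b : nat -> nat -> bool := fun i j => w (a + i) (b + j).

(** A chain in the first [a] rows and [b] columns can be followed by any chain of the remaining
    quadrant. *)
Lemma lis_superadd w a b i j :
  lis w a b + lis (wshift w a b) i j <= lis w (a + i) (b + j).
Proof.
elim: i j => [|i IH] j; first by rewrite !addn0 leq_lis ?leq_addr.
elim: j => [|j IHj]; first by rewrite lis_0 !addn0 leq_lis ?leq_addr.
rewrite [X in _ + X]lisS !addnS lisS [X in if X then _ else _]/wshift.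
have h1 := IH j; have h2 := IH j.+1; rewrite addnS in h2.
rewrite addnS in IHj.
case: ifP => _; first by rewrite addnS ltnS.
by rewrite addn_maxr geq_max !leq_max h2 IHj orbT.
Qed.

Definition wadd w a b : nat -> nat -> bool :=
  fun i j => ((i == a) && (j == b)) || w i j.

(** A chain through the new entry splits into a part strictly before it, the entry itself and a part
    strictly after it; any other chain lies in [w]. *)
Lemma lis_wadd w a b i j : a < i -> b < j ->
  lis (wadd w a b) i j <=
  maxn (lis w i j)
   (lis w a b + 1 + lis (wshift w a.+1 b.+1) (i - a.+1) (j - b.+1)).
Proof.
have out i' j' : (i' <= a) || (j' <= b) -> lis (wadd w a b) i' j' = lis w i' j'.
  move=> h; apply: eq_lis => i2 j2 h1 h2; rewrite /wadd.
  by have -> : (i2 == a) && (j2 == b) = false by lia.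
elim: i j => [//|i IH]; elim=> [//|j IHj] lta ltb.
rewrite lisS [X in if X then _ else _]/wadd.
set F := lis (wshift _ _ _).
have mF i1 j1 i2 j2 : i1 <= i2 -> j1 <= j2 -> F i1 j1 <= F i2 j2 by apply: leq_lis.
case: (altP andP) => [[/eqP ei /eqP ej]|ne] /=.
  by subst i j; rewrite out ?leqnn // leq_max addn1 leq_addr orbT.
case wij: (w i j).
  have [/andP[a1 b1]|n1] := boolP ((a < i) && (b < j)); last first.
    rewrite out ?lisS ?wij ?leq_maxl //.
    by rewrite negb_and -!leqNgt in n1.
  have h := IH j a1 b1.
  have ->: i.+1 - a.+1 = (i - a.+1).+1 by lia.
  have ->: j.+1 - b.+1 = (j - b.+1).+1 by lia.
  rewrite lisS wij /F lisS.
  have ->: wshift w a.+1 b.+1 (i - a.+1) (j - b.+1) = w i j.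
    by rewrite /wshift !subnKC.
  by rewrite wij addnS maxnSS ltnS.
have [h1 h2 _] := lis_step w i j.
have [g1 _ _] := lis_step w i j.+1.
have [_ g2 _] := lis_step w i.+1 j.
rewrite geq_max; apply/andP; split.
  have [a1|a1] := ltnP a i; last first.
    by rewrite out ?a1 // (leq_trans g1) // leq_maxl.
  apply: leq_trans (IH j.+1 a1 ltb) _.
  by rewrite geq_max !leq_max g1 /= leq_add2l mF ?orbT //; lia.
have [b1|b1] := ltnP b j; last first.
  by rewrite out ?b1 ?orbT // (leq_trans g2) // leq_maxl.
apply: leq_trans (IHj lta b1) _.
by rewrite geq_max !leq_max g2 /= leq_add2l mF ?orbT //; lia.
Qed.

End Lis.

(** * Chains in grids *)

Lemma lis_le_nonempty_rows w i j r :
  (forall i' j', r <= i' -> ~~ w i' j') -> lis w i j <= r.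
Proof.
move=> h; elim: i j => [//|i IH]; elim=> [|j IHj]; first by rewrite lis_0.
rewrite lisS; case: ifP => [wij|_]; last by rewrite geq_max IH.
have [lt|le] := ltnP i r; last by have := h _ j le; rewrite wij.
by apply: leq_trans lt; rewrite ltnS lis_le_row.
Qed.

Section Grid.
Variables (V : finType) (I : eqType).

(* One of the two families of matrices.  [vx] is the vertex of the matrix
   containing a variable, [sh] the index along the side common to all the blocks
   of that matrix, and [lg] the index along the concatenated side.  The matrices
   of the sources are thus transposed, which makes both families alike. *)
Record grid := Grid { vx : V -> I; sh : V -> nat; lg : V -> nat }.

Section OneSide.
Variable c : grid.
Local Notation vx := (vx c).
Local Notation sh := (sh c).
Local Notation lg := (lg c).
Implicit Types (E S : {set V}) (a : I) (v w y z : V) (ds : seq V).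

Definition clt v w := [&& vx v == vx w, sh v < sh w & lg v < lg w].

Definition occ E a (i l : nat) : bool :=
  [exists v in E, [&& vx v == a, sh v == i & lg v == l]].

(* [ext E a i l], [pre E v], [suf E v] and [full E a] are the largest lengths of
   a chain of [E] in the first [i] rows and [l] columns of the matrix [a],
   strictly before [v], strictly after [v], and in the whole matrix. *)
Definition ext E a := lis (occ E a).

Definition pre E v := ext E (vx v) (sh v) (lg v).

(** A strict bound for all indices, so that [bnd] rows and columns cover every matrix. *)
Definition bnd : nat := (\max_(v : V) maxn (sh v) (lg v)).+1.

Definition tail E a i l := lis (wshift (occ E a) i l) (bnd - i) (bnd - l).

Definition full E a := ext E a bnd bnd.

Definition suf E v := tail E (vx v) (sh v).+1 (lg v).+1.

Lemma clt_trans : transitive clt.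
Proof.
move=> w v z /and3P[/eqP e1 h1 h2] /and3P[/eqP e2 h3 h4].
by rewrite /clt e1 e2 eqxx (ltn_trans h1) ?(ltn_trans h2).
Qed.

Lemma sh_bnd v : sh v < bnd.
Proof. by rewrite ltnS (leq_trans _ (leq_bigmax v)) // leq_maxl. Qed.

Lemma lg_bnd v : lg v < bnd.
Proof. by rewrite ltnS (leq_trans _ (leq_bigmax v)) // leq_maxr. Qed.

Lemma occ_sub E S a i l : E \subset S -> occ E a i l -> occ S a i l.
Proof.
move=> /subsetP sub /existsP[v /andP[/sub vS h]].
by apply/existsP; exists v; rewrite vS.
Qed.

Lemma ext_sub E S a i l : E \subset S -> ext E a i l <= ext S a i l.
Proof. by move=> sub; apply: leq_lis_sub => i' j' _ _; apply: occ_sub. Qed.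

Lemma tail_sub E S a i l : E \subset S -> tail E a i l <= tail S a i l.
Proof. by move=> sub; apply: leq_lis_sub => i' j' _ _; apply: occ_sub. Qed.

Lemma full_sub E S a : E \subset S -> full E a <= full S a.
Proof. exact: ext_sub. Qed.

Lemma eq_ext E S a i l :
  (forall v, vx v = a -> sh v < i -> lg v < l -> (v \in E) = (v \in S)) ->
  ext E a i l = ext S a i l.
Proof.
move=> h; apply: eq_lis => i' l' hi hl.
apply: eq_existsb => v; have [e1|] := eqVneq (vx v) a; last by rewrite !andbF.
have [e2|] := eqVneq (sh v) i'; last by rewrite !andbF.
have [e3|] := eqVneq (lg v) l'; last by rewrite !andbF.
by rewrite h // ?e2 ?e3.
Qed.

Lemma ext_tail E a i l : i <= bnd -> l <= bnd -> ext E a i l + tail E a i l <= full E a.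
Proof. by move=> hi hl; rewrite (leq_trans (lis_superadd _ _ _ _ _)) // !subnKC. Qed.

Hypothesis inj : forall v w, vx v = vx w -> sh v = sh w -> lg v = lg w -> v = w.

Lemma occ_at E v : occ E (vx v) (sh v) (lg v) = (v \in E).
Proof.
apply/existsP/idP => [[w /andP[wE /and3P[/eqP h1 /eqP h2 /eqP h3]]]|vE].
  by rewrite -(inj h1 h2 h3).
by exists v; rewrite vE !eqxx.
Qed.

Lemma ext_cell E v : ext E (vx v) (sh v).+1 (lg v).+1 =
  if v \in E then (pre E v).+1
  else maxn (ext E (vx v) (sh v) (lg v).+1) (ext E (vx v) (sh v).+1 (lg v)).
Proof. by rewrite -occ_at. Qed.

(** Each step of the chain raises [pre] by at least one, because the entry left behind belongs to
    [E] and lies strictly before the next one. *)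
Lemma chain_pre E v ds : path clt v ds -> {subset belast v ds <= E} ->
  pre E v + size ds <= pre E (last v ds).
Proof.
elim: ds v => [|w ds IH] v /=; first by rewrite addn0.
move=> /andP[/and3P[/eqP e h1 h2] pa] sub.
apply: leq_trans (IH w pa _); last by move=> z hz; apply: sub; rewrite inE hz orbT.
rewrite addnS -addSn leq_add2r.
have <- : ext E (vx v) (sh v).+1 (lg v).+1 = (pre E v).+1.
  by rewrite ext_cell sub ?mem_head.
by rewrite /pre -e leq_lis.
Qed.

Lemma chain_full E v ds : path clt v ds -> {subset v :: ds <= E} ->
  pre E v + size (v :: ds) <= full E (vx v).
Proof.
move=> pa sub.
have hb : {subset belast v ds <= E}.
  by move=> z hz; apply: sub; rewrite mem_belast.
have lE : last v ds \in E by apply: sub; rewrite mem_last.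
have el : vx (last v ds) = vx v.
  elim: ds v pa {sub hb lE} => //= w ds IH v /andP[/and3P[/eqP-> _ _]]; exact: IH.
rewrite /= addnS (@leq_trans (pre E (last v ds)).+1) //; first by rewrite ltnS chain_pre.
have := ext_cell E (last v ds); rewrite lE => <-.
by rewrite el /full leq_lis // ?sh_bnd ?lg_bnd.
Qed.

(** Reading the recursion of [lis] backwards produces a longest chain. *)
Lemma chain_ex E a i0 l0 i l : exists ds,
  [/\ size ds = lis (wshift (occ E a) i0 l0) i l, sorted clt ds &
   forall v, v \in ds -> [/\ v \in E, vx v = a, i0 <= sh v < i0 + i & l0 <= lg v < l0 + l]].
Proof.
elim: i l => [|i IH]; first by exists nil.
elim=> [|l IHl]; first by exists nil; rewrite lis_0.
rewrite lisS /wshift; case: ifP => [|_].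
  move=> /existsP[v /andP[vE /and3P[/eqP e1 /eqP e2 /eqP e3]]].
  have [ds [h1 h2 h3]] := IH l; exists (rcons ds v); split.
  - by rewrite size_rcons h1.
  - case: ds h2 h3 {h1} => [//|w ds] /= h2 h3; rewrite rcons_path h2 /=.
    have [_ g1 g2 g3] := h3 _ (mem_last w ds).
    rewrite /clt g1 e1 eqxx /= e2 e3.
    by case/andP: g2 => _ ->; case/andP: g3.
  - move=> w; rewrite mem_rcons inE => /orP[/eqP->|/h3[g0 g1 g2 g3]].
      by split=> //; lia.
    by split=> //; lia.
rewrite /maxn; case: ifP => _.
  have [ds [h1 h2 h3]] := IHl; exists ds; split=> // w /h3[g0 g1 g2 g3].
  by split=> //; lia.
have [ds [h1 h2 h3]] := IH l.+1; exists ds; split=> // w /h3[g0 g1 g2 g3].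
by split=> //; lia.
Qed.

(** Since [i] and [l] may exceed [bnd], monotonicity is not enough; a longest chain is compared with
    the whole matrix instead. *)
Lemma ext_le_full E a i l : ext E a i l <= full E a.
Proof.
have [ds [e so h]] := chain_ex E a 0 0 i l.
have -> : ext E a i l = size ds by [].
case: ds so h {e} => [//|v ds] so h; have [_ <- _ _] := h v (mem_head _ _).
apply: leq_trans (chain_full so _); first exact: leq_addl.
by move=> w /h[].
Qed.

Lemma occ_add E z a i l : occ (z |: E) a i l =
  ((vx z == a) && ((i == sh z) && (l == lg z))) || occ E a i l.
Proof.
apply/existsP/orP => [[v /andP[]]|[/and3P[/eqP e1 /eqP e2 /eqP e3]|]].
- rewrite in_setU1 => /orP[/eqP->|vE] h; last by right; apply/existsP; exists v; rewrite vE.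
  by left; case/and3P: h => -> /eqP-> /eqP->; rewrite !eqxx.
- by exists z; rewrite setU11 e1 e2 e3 !eqxx.
- by move=> /existsP[v /andP[vE h]]; exists v; rewrite in_setU1 vE orbT.
Qed.

Lemma full_add E z a : full (z |: E) a <=
  maxn (full E a) (if vx z == a then pre E z + 1 + suf E z else 0).
Proof.
case: eqP => [<-|ne]; last first.
  rewrite leq_max; apply/orP; left; apply: leq_lis_sub => i l _ _.
  by rewrite occ_add; case: eqP.
apply: leq_trans (lis_wadd _ (sh_bnd z) (lg_bnd z)).
by apply: leq_lis_sub => i l _ _; rewrite occ_add eqxx.
Qed.

Variable u : I -> nat.
Definition rank_ok E := forall a, full E a <= u a.

(** Only a chain through the new entry [z] can break a bound. *)
Lemma not_rank_ok_add E z : rank_ok E -> ~ rank_ok (z |: E) ->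
  u (vx z) < pre E z + 1 + suf E z.
Proof.
move=> ok nok; rewrite ltnNge; apply/negP => le; apply: nok => a.
apply: leq_trans (full_add _ _ _) _; rewrite geq_max ok /=.
by case: eqP => // <-.
Qed.

Lemma rank_ok_sub E S : E \subset S -> rank_ok S -> rank_ok E.
Proof. by move=> sub ok a; apply: leq_trans (ok a); apply: full_sub. Qed.

Lemma tail_le_rows E a i l r : (forall v, vx v = a -> sh v < r) -> tail E a i l <= r - i.
Proof.
move=> h; apply: lis_le_nonempty_rows => i' j' le; apply/negP.
by move=> /existsP[v /andP[_ /and3P[/eqP /h + /eqP e _]]]; rewrite e; lia.
Qed.

End OneSide.
End Grid.

(** * Two families of matrices made of the same blocks *)

Section Board.
Variables (V : finType) (I A : eqType) (ar : V -> A).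

(** [ar] names the block of an entry, and [sh c], [sh c'] give its position there. [half_blk] and
    [half_next] put each block on consecutive columns of [c], numbered inside the block by [sh c'];
    the other fields make positions unique and the matrices rectangular without gaps. *)
Record compat (c c' : grid V I) : Prop := Compat {
  half_inj : forall v w, vx c v = vx c w -> sh c v = sh c w -> lg c v = lg c w -> v = w;
  half_rect : forall v w, vx c v = vx c w ->
    exists z, [/\ vx c z = vx c w, sh c z = sh c v & lg c z = lg c w];
  half_col : forall v w, vx c v = vx c w -> lg c v = lg c w ->
    ar v = ar w /\ sh c' v = sh c' w;
  half_blk : forall v w, ar v = ar w ->
    vx c v = vx c w /\ lg c v + sh c' w = lg c w + sh c' v;
  half_next : forall v w, vx c v = vx c w -> lg c w = (lg c v).+1 ->
    ar w = ar v \/ sh c' w = 0;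
  half_down : forall v i, i <= sh c v ->
    exists w, [/\ ar w = ar v, sh c w = i & sh c' w = sh c' v];
  half_downl : forall v l, l <= lg c v -> exists w, vx c w = vx c v /\ lg c w = l
}.

Lemma block_origin c c' v : compat c c' -> compat c' c -> exists o,
  forall w, ar w = ar v -> lg c w = o + sh c' w.
Proof.
move=> h h'; have [w0 [e0 s0 _]] := half_down h' (leq0n (sh c' v)).
exists (lg c w0) => w ew; rewrite -e0 in ew.
by have [_] := half_blk h ew; rewrite s0 addn0.
Qed.

Section BlockLemma.
Variables (c c' : grid V I).
Hypotheses (h : compat c c') (h' : compat c' c).
Variable E : {set V}.

(* Both [ext] obey the same local rule inside a block, but one of them starts
   from 0 on the first row of the block and the other one on its first column. *)
Lemma block_slopes_aux v :
  ext c E (vx c v) (sh c v) (lg c v).+1 + ext c' E (vx c' v) (sh c' v) (lg c' v)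
   <= ext c E (vx c v) (sh c v) (lg c v) + ext c' E (vx c' v) (sh c' v).+1 (lg c' v)
  /\
  ext c' E (vx c' v) (sh c' v) (lg c' v).+1 + ext c E (vx c v) (sh c v) (lg c v)
   <= ext c' E (vx c' v) (sh c' v) (lg c' v) + ext c E (vx c v) (sh c v).+1 (lg c v).
Proof.
have [k] := ubnP (sh c v + sh c' v); elim: k v => // k IH v lt.
split.
  case es : (sh c v) => [|i].
    by rewrite !add0n leq_lis.
  have [|w [ew sw s'w]] := half_down h (i := i) (v := v); first by rewrite es.
  have [|IH1 IH2] := IH w; first by rewrite sw s'w; lia.
  have cw := ext_cell (half_inj h) E w; have c'w := ext_cell (half_inj h') E w.
  have [ea el] := half_blk h (esym ew).
  have [eb el'] := half_blk h' (esym ew).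
  rewrite /pre ea eb in cw c'w *.
  have {}el : lg c v = lg c w by lia.
  have {}el' : lg c' v = (lg c' w).+1 by lia.
  rewrite -s'w el el' sw in IH1 IH2 cw c'w *.
  move: IH1 IH2 cw c'w; case: (w \in E); lia.
case es : (sh c' v) => [|i].
  by rewrite !add0n leq_lis.
have [|w [ew sw s'w]] := half_down h' (i := i) (v := v); first by rewrite es.
have [|IH1 IH2] := IH w; first by rewrite sw s'w; lia.
have cw := ext_cell (half_inj h) E w; have c'w := ext_cell (half_inj h') E w.
have [ea el] := half_blk h (esym ew).
have [eb el'] := half_blk h' (esym ew).
rewrite /pre ea eb in cw c'w *.
have {}el : lg c v = (lg c w).+1 by lia.
have {}el' : lg c' v = lg c' w by lia.
rewrite -s'w el el' sw in IH1 IH2 cw c'w *.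
move: IH1 IH2 cw c'w; case: (w \in E); lia.
Qed.

(** An inequality of slopes, written without subtraction: across the column of [v], [ext c] gains at
    most as much as [ext c']. *)
Lemma block_slopes v :
  ext c E (vx c v) (sh c v) (lg c v).+1 + ext c' E (vx c' v) (sh c' v) (lg c' v)
   <= ext c E (vx c v) (sh c v) (lg c v) + ext c' E (vx c' v) (sh c' v).+1 (lg c' v).
Proof. by have [] := block_slopes_aux v. Qed.

End BlockLemma.

(** * The walk from the deleted variable through a facet *)

Section Scan.
Variables (c c' : grid V I) (u : I -> nat).
Hypotheses (h : compat c c') (h' : compat c' c).
Variables (E : {set V}) (y : V).
Local Notation a := (vx c y).
Local Notation s0 := (sh c y).
Local Notation l0 := (lg c y).
Local Notation d := (pre c E y).
Hypothesis ynE : y \notin E.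
Hypothesis OKy : rank_ok c u (y |: E).
Hypothesis OKE : rank_ok c' u E.
Hypothesis active : ext c E a s0.+1 l0.+1 = d.
Hypothesis maximal : forall z, vx c z = a -> sh c y < sh c z -> lg c y < lg c z ->
  z \notin E -> ~ (rank_ok c u (z |: E) /\ rank_ok c' u (z |: E)).
Variable p : nat.
Hypothesis dp : u a < d + p.+1.
Hypothesis rows : forall i, i < p -> exists2 w, vx c w = a & sh c w = s0 + i.+1.

(* The walk from [y] has met [i] entries of [E] in the columns before [l]. *)
Definition scan_inv i l :=
  ext c E a (s0 + i.+1) l <= d + i /\ d + i.+1 <= ext c (y |: E) a (s0 + i.+1) l.

(** Otherwise [y |: E] would contain a chain of length [d + p.+1], beyond the bound of the
    matrix. *)
Lemma scan_inv_lt i l : scan_inv i l -> i < p.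
Proof.
move=> [_ le]; have := ext_le_full (half_inj h) (y |: E) a (s0 + i.+1) l.
by have := OKy a; move: dp le; lia.
Qed.

(** If [z] is in [E], the walk moves down one row. If not, maximality of [E] yields a long chain in
    the other family, which shows that the skipped column does not lengthen the chains of [E] here;
    the walk then continues in the same row. *)
Lemma scan_step i z : vx c z = a -> sh c z = s0 + i.+1 -> l0 < lg c z ->
  scan_inv i (lg c z) ->
  (z \in E /\ scan_inv i.+1 (lg c z).+1) \/
  [/\ scan_inv i (lg c z).+1, u (vx c' z) < pre c' E z + 1 + suf c' E z &
      ext c' E (vx c' z) (sh c' z).+1 (lg c' z) <= pre c' E z].
Proof.
move=> ea es lt [inv1 inv2].
have [zE|zE] := boolP (z \in E).
  left; split=> //.
  have e1 := ext_cell (half_inj h) E z.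
  have e2 := ext_cell (half_inj h) (y |: E) z.
  rewrite in_setU1 zE orbT in e2; rewrite zE in e1.
  rewrite /pre ea es in e1 e2.
  by split; rewrite (addnS s0 i.+1) ?e1 ?e2 -?addnS; lia.
right.
have pz : pre c E z <= d + i by rewrite /pre ea es.
(* In [c] the entry [z] does no harm: a chain ending in [z] has length at most [d + i + 1], which
   [y |: E] already reaches before the column of [z]. So the obstruction to adding [z] is in
   [c']. *)
have cb : ~ rank_ok c' u (z |: E).
  move=> ok'; apply: (maximal ea _ lt zE); first by rewrite es; lia.
  split=> //; apply: NNPP => nok.
  have := not_rank_ok_add (rank_ok_sub (subsetUr _ _) OKy) nok.
  rewrite /suf ea => g.
  have t := ext_tail (y |: E) a (sh_bnd c z) (lg_bnd c z).
  have g1 : tail c E a (sh c z).+1 (lg c z).+1 <= tail c (y |: E) a (sh c z).+1 (lg c z).+1.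
    by apply: tail_sub; apply: subsetUr.
  have g2 : ext c (y |: E) a (s0 + i.+1) (lg c z) <=
            ext c (y |: E) a (sh c z).+1 (lg c z).+1 by rewrite es leq_lis.
  have := OKy a; lia.
have blk := not_rank_ok_add OKE cb.
(* A longer chain of [E] in this corner could replace the part of the long chain up to and including
   [z], and would violate the bound of [c']. *)
have flat : ext c' E (vx c' z) (sh c' z).+1 (lg c' z) <= pre c' E z.
  rewrite leqNgt; apply/negP => gt.
  have t := ext_tail E (vx c' z) (sh_bnd c' z) (lg_bnd c' z).
  have g2 : ext c' E (vx c' z) (sh c' z).+1 (lg c' z) <=
            ext c' E (vx c' z) (sh c' z).+1 (lg c' z).+1 by rewrite leq_lis.
  have := OKE (vx c' z); rewrite /suf in blk; lia.
split=> //; split.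
  (* As [ext c'] does not grow across this column, neither does [ext c]. *)
  have := block_slopes h h' E z; rewrite -/(pre c' E z) ea es; lia.
by apply: leq_trans inv2 _; rewrite leq_lis.
Qed.

Lemma block_dim v0 : exists M,
  (forall w, vx c' w = vx c' v0 -> sh c' w < M) /\
  (forall j, j < M -> exists w, ar w = ar v0 /\ sh c' w = j).
Proof.
case: (@arg_maxnP _ v0 (fun w => vx c' w == vx c' v0) (sh c') (eqxx _)) => w /eqP ew wmax.
exists (sh c' w).+1; split=> [w1 /eqP/wmax//|j]; rewrite ltnS => lej.
have [z [e1 e2 e3]] := half_rect h' ew.
have [ez _] := half_col h' e1 e3.
have [|w1 [f1 f2 _]] := half_down h' (v := z) (i := j); first by rewrite e2.
by exists w1; rewrite f1.
Qed.

Lemma mix_block v i : vx c v = a -> i < p -> exists z,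
  [/\ ar z = ar v, vx c z = a, sh c z = s0 + i.+1 & lg c z = lg c v].
Proof.
move=> ev /rows[w ew sw]; have [|z [e1 e2 e3]] := half_rect h (v := w) (w := v).
  by rewrite ew ev.
by have [ez _] := half_col h e1 e3; exists z; rewrite ez e1 e2 e3 sw ev.
Qed.

Section Run.
Variables (v0 : V) (o1 o2 M : nat).
Local Notation b := (vx c' v0).
Hypothesis v0a : vx c v0 = a.
Hypothesis ho1 : forall w, ar w = ar v0 -> lg c w = o1 + sh c' w.
Hypothesis ho2 : forall w, ar w = ar v0 -> lg c' w = o2 + sh c w.
Hypothesis ltM : forall w, vx c' w = b -> sh c' w < M.
Hypothesis exM : forall j, j < M -> exists w, ar w = ar v0 /\ sh c' w = j.
Variables (delta j0 i0 : nat).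

(** Here [nu] counts the entries met in the block. Each skipped column gives
    [u b <= delta + nu + (M - j)] by means of the long chain of [c'], and each entry met preserves
    this bound. So at the end either no column was skipped or at least [u b - delta] entries were
    met. *)
Lemma block_run r j nu : j + r = M -> l0 < o1 + j ->
  scan_inv (i0 + nu) (o1 + j) ->
  ext c' E b j (o2 + (s0 + (i0 + nu).+1)) <= delta + nu ->
  j0 + nu = j \/ u b <= delta + nu + (M - j) ->
  exists nu', scan_inv (i0 + nu') (o1 + M) /\ (j0 + nu' = M \/ u b <= delta + nu').
Proof.
elim: r j nu => [|r IH] j nu ej lt inv hd hB.
  exists nu; rewrite addn0 in ej; subst j; split=> //.
  by case: hB => [|]; [left | rewrite subnn addn0; right].
have [|w [ew sw]] := exM (j := j); first by lia.
have lw := ho1 ew; rewrite sw in lw.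
have wa : vx c w = a by have [-> _] := half_blk h ew.
have [z [ez za sz lz]] := mix_block wa (scan_inv_lt inv).
have ez0 : ar z = ar v0 by rewrite ez.
have s'z : sh c' z = j by have := ho1 ez0; rewrite lz lw; lia.
have l'z : lg c' z = o2 + (s0 + (i0 + nu).+1) by rewrite (ho2 ez0) sz.
have bz : vx c' z = b by have [-> _] := half_blk h' ez0.
have pz : pre c' E z <= delta + nu by rewrite /pre bz s'z l'z.
have [||[zE inv']|[inv' blk flat]] := scan_step za sz.
- by rewrite lz lw.
- by rewrite lz lw.
- apply: (IH j.+1 nu.+1); rewrite ?addnS.
  + by lia.
  + by lia.
  + by move: inv'; rewrite lz lw.
  + have := ext_cell (half_inj h') E z; rewrite zE bz s'z l'z -!addnS => ->.
    by rewrite !addnS ltnS.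
  + by case: hB => hB; [left | right]; lia.
apply: (IH j.+1 nu); rewrite ?addnS.
- by lia.
- by lia.
- by move: inv'; rewrite lz lw.
- by move: flat; rewrite bz s'z l'z !addnS => flat; apply: leq_trans flat pz.
(* The skipped entry is in row [j] of a matrix with [M] rows, so at most [M - j.+1] entries follow
   it in a chain. *)
right; have t : suf c' E z <= M - j.+1.
  rewrite /suf -s'z; apply: tail_le_rows => w1; rewrite bz; exact: ltM.
by move: blk; rewrite bz; lia.
Qed.

End Run.

Variable ds : seq V.
Hypothesis size_ds : size ds = p.
Hypothesis ds_a : forall w, w \in ds -> vx c w = a /\ l0 < lg c w.
Hypothesis ds_uniq : uniq (map (lg c) ds).

Let cnt l := count (fun w => lg c w < l) ds.
Let blk v0 := count (fun w => ar w == ar v0) ds.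
(** The value of [delta] in [block_run]: the block of [y] is entered past [y], where [E] may already
    have chains, any other block at its first column, where it has none. *)
Let dlt v0 := if ar v0 == ar y then ext c' E (vx c' y) (sh c' y).+1 (lg c' y).+1 else 0.

(** The columns of [ds] are distinct, and inside one block a column is determined by its index
    [sh c']. *)
Lemma blk_bound v0 j0 M : (forall w, vx c' w = vx c' v0 -> sh c' w < M) ->
  (forall w, w \in ds -> ar w = ar v0 -> j0 <= sh c' w) -> blk v0 <= M - j0.
Proof.
move=> ltM gej; rewrite /blk -size_filter -(size_map (sh c')) -[M - j0](size_iota j0).
apply: uniq_leq_size.
  rewrite map_inj_in_uniq ?filter_uniq //; first exact: map_uniq ds_uniq.
  move=> w1 w2; rewrite !mem_filter => /andP[/eqP e1 d1] /andP[/eqP e2 d2] e.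
  apply: contraTeq ds_uniq => ne; apply/negP => un.
  have [o ho] := block_origin v0 h h'.
  have el : lg c w1 = lg c w2 by rewrite !ho // e.
  move/negP: ne; apply; apply/eqP.
  rewrite -(nth_index w1 d1) -(nth_index w1 d2); congr (nth w1 ds _).
  apply/eqP; rewrite -(nth_uniq 0 _ _ un) ?size_map ?index_mem //.
  by rewrite !(nth_map w1) ?index_mem // !nth_index // el.
move=> j /mapP[w]; rewrite mem_filter => /andP[/eqP e1 d1] ->.
rewrite mem_iota; have := gej w d1 e1.
by have := ltM w; have [-> _] := half_blk h' e1 => /(_ erefl); lia.
Qed.

Lemma in_block v0 o1 M w : vx c v0 = a -> vx c w = a ->
  (forall w, ar w = ar v0 -> lg c w = o1 + sh c' w) ->
  (forall w, vx c' w = vx c' v0 -> sh c' w < M) ->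
  (forall j, j < M -> exists w, ar w = ar v0 /\ sh c' w = j) ->
  (ar w == ar v0) = (o1 <= lg c w < o1 + M).
Proof.
move=> v0a wa ho1 ltM exM; apply/eqP/idP => [e|/andP[le lt]].
  have := ltM w; have [-> _] := half_blk h' e => /(_ erefl).
  by rewrite (ho1 _ e); lia.
have [|w1 [e1 s1]] := exM (lg c w - o1); first by lia.
have lw1 : lg c w1 = lg c w by rewrite ho1 // s1 subnKC.
have [ew1 _] := half_blk h e1.
by have [|<- _] := half_col h _ lw1; rewrite ?ew1 ?v0a ?wa.
Qed.

(* Some block contains too many columns of [ds] for the bound of its matrix of
   the other kind. *)
Definition overflow := exists v0, [/\ vx c v0 = a, 0 < blk v0 &
  u (vx c' v0) < dlt v0 + blk v0].

(** The second hypothesis puts [l] on a block boundary. The walk goes on block by block while it has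
    met at least as many entries as there were columns of [ds]. It meets fewer than [p] entries, so
    some block has more columns of [ds] than entries met, and this block overflows. *)
Lemma scan_rest i l : l0 < l ->
  (forall w, vx c w = a -> lg c w = l -> sh c' w = 0) ->
  scan_inv i l -> cnt l <= i -> overflow.
Proof.
have [k] := ubnP (bnd c - l); elim: k l i => // k IH l i ltk ltl bdry inv lecnt.
have [/existsP[v /andP[/eqP va /eqP vl]]|] :=
  boolP [exists v, (vx c v == a) && (lg c v == l)]; last first.
  (* No column is left, so all [p] columns of [ds] have been counted, against [cnt l <= i < p]. *)
  rewrite negb_exists => /forallP nol.
  have ec : cnt l = p.
    rewrite -size_ds; apply/eqP; rewrite -all_count; apply/allP => w dw.
    have [wa _] := ds_a dw; rewrite ltnNge; apply/negP => /(half_downl h)[w1 [e1 e2]].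
    by have := nol w1; rewrite e1 e2 wa !eqxx.
  by have := scan_inv_lt inv; rewrite ltnNge -ec lecnt.
have [o1 ho1] := block_origin v h h'.
have [o2 ho2] := block_origin v h' h.
have [M [ltM exM]] := block_dim v.
have eo1 : o1 = l by rewrite -vl ho1 // (bdry v) // addn0.
subst o1.
have [||||nu [inv' hB]] := @block_run v l o2 M va ho1 ho2 ltM exM 0 0 i M 0 0 (add0n _).
- by rewrite addn0.
- by rewrite !addn0.
- by [].
- by left.
have cntM : cnt (l + M) = cnt l + blk v.
  have := count_predUI (fun w => lg c w < l) (fun w => ar w == ar v) ds.
  rewrite -/(cnt l) -/(blk v); set cu := count (predU _ _) _.
  have -> : cu = cnt (l + M).
    by apply: eq_in_count => w /ds_a[wa _] /=; rewrite (in_block va wa ho1 ltM exM); lia.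
  rewrite [X in _ + X](_ : _ = 0) ?addn0 // -(count_pred0 ds).
  by apply: eq_in_count => w /ds_a[wa _] /=; rewrite (in_block va wa ho1 ltM exM); lia.
have M0 : 0 < M by rewrite (leq_trans _ (ltM v erefl)).
have [le|gt] := leqP (blk v) nu.
  apply: (IH (l + M) (i + nu)) => //; last by rewrite cntM leq_add.
  - by have := lg_bnd c v; lia.
  - by lia.
  move=> w wa lw; have [w1 [e1 s1]] : exists w1, ar w1 = ar v /\ sh c' w1 = M.-1.
    by apply: exM; lia.
  have w1a : vx c w1 = a by have [-> _] := half_blk h e1.
  have [|| ew|//] := half_next h (v := w1) (w := w); rewrite ?w1a ?wa //.
    by rewrite lw ho1 // s1; lia.
  have := in_block va wa ho1 ltM exM; rewrite ew e1 eqxx lw; lia.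
(* As the block has only [M] columns, having more columns of [ds] than entries met means that a
   column was skipped, so the other alternative of [block_run] holds. *)
have leM : blk v <= M - 0 by apply: blk_bound.
exists v; split=> //; first by lia.
by case: hB => hB; lia.
Qed.

(** The walk starts just behind the column of [y], where [active] gives the upper half of the
    invariant and [y] itself the lower half. *)
Lemma scan : overflow.
Proof.
have [o1 ho1] := block_origin y h h'.
have [o2 ho2] := block_origin y h' h.
have [M [ltM exM]] := block_dim y.
have inv0 : scan_inv (0 + 0) (o1 + (sh c' y).+1).
  rewrite addnS -ho1 //; split; rewrite !addn0 !addn1 ?active //.
  have := ext_cell (half_inj h) (y |: E) y; rewrite setU11 => ->.
  by rewrite ltnS; apply: ext_sub; apply: subsetUr.
set dl := ext c' E (vx c' y) (sh c' y).+1 (lg c' y).+1.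
have [||||nu [inv' hB]] := @block_run y o1 o2 M erefl ho1 ho2 ltM exM dl (sh c' y).+1 0
  (M - (sh c' y).+1) (sh c' y).+1 0 _ _ inv0.
- by rewrite subnKC // ltM.
- by rewrite addnS -ho1.
- by rewrite !addn0 addn1 addnS -ho2.
- by left; rewrite addn0.
rewrite add0n in inv'.
have cntM : cnt (o1 + M) = blk y.
  apply: eq_in_count => w /ds_a[wa gt] /=.
  rewrite (in_block erefl wa ho1 ltM exM).
  by have := ho1 y erefl; lia.
have ltMy := ltM y erefl.
have [le|gt] := leqP (blk y) nu.
  apply: (scan_rest (l := o1 + M) (i := nu)) => //; last by rewrite cntM.
    by rewrite (ho1 y) //; lia.
  move=> w wa lw; have [w1 [e1 s1]] : exists w1, ar w1 = ar y /\ sh c' w1 = M.-1.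
    by apply: exM; lia.
  have w1a : vx c w1 = a by have [-> _] := half_blk h e1.
  have [|| ew|//] := half_next h (v := w1) (w := w); rewrite ?w1a ?wa //.
    by rewrite lw ho1 // s1; lia.
  have := in_block erefl wa ho1 ltM exM; rewrite ew e1 eqxx lw; lia.
have leM : blk y <= M - (sh c' y).+1.
  apply: blk_bound => // w dw ew; have [_ +] := ds_a dw.
  by rewrite !ho1 //; lia.
exists y; split=> //; first by lia.
rewrite /dlt eqxx -/dl; case: hB => hB; lia.
Qed.

End Scan.
End Board.

(** * Lexicographic orders, leading monomials and ideals *)

Local Open Scope ring_scope.

Section Lex.
Variables (V : finType) (rk : V -> nat).
Hypothesis rk_inj : injective rk.
Implicit Types m : 'X_{1..#|V|}.
Local Notation "m ` v" := (fun_of_multinom m (enum_rank v)) (at level 1, v at level 0, format "m ` v").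
Local Notation "m1 >> m2" := (lex_gt rk m1 m2) (at level 70).

Lemma mnm_varP m1 m2 : (forall v, m1`v = m2`v) -> m1 = m2.
Proof. by move=> h; apply/mnmP => i; rewrite -(enum_valK i). Qed.

Lemma lex_trans m2 m1 m3 : m1 >> m2 -> m2 >> m3 -> m1 >> m3.
Proof.
move=> [v [h1 h2]] [w [h3 h4]].
have [lt|lt|/rk_inj e] := ltngtP (rk v) (rk w).
- exists v; split=> [|z hz]; first by rewrite -h4.
  by rewrite h2 // h4 // (ltn_trans hz).
- exists w; split=> [|z hz]; first by rewrite h2.
  by rewrite h2 ?h4 // (ltn_trans hz).
- subst w; exists v; split=> [|z hz]; first by apply: ltn_trans h1.
  by rewrite h2 ?h4.
Qed.

Lemma lex_irr m : ~ m >> m.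
Proof. by case=> v []; rewrite ltnn. Qed.

Lemma lex_total m1 m2 : m1 <> m2 -> m1 >> m2 \/ m2 >> m1.
Proof.
move=> ne; have [v0 hv0] : exists v, m1`v != m2`v.
  apply/existsP; apply: contra_notT ne; rewrite negb_exists => /forallP h.
  by apply: mnm_varP => v; apply/eqP; move/negPn: (h v).
case: (@arg_minnP _ v0 (fun v => m1`v != m2`v) rk hv0) => v hv vmin.
have eqw w : (rk w < rk v)%N -> m1`w = m2`w.
  by move=> lt; apply/eqP; apply: contraLR lt => /vmin; rewrite -leqNgt.
have [lt|lt|e] := ltngtP (m1`v) (m2`v); last by rewrite e eqxx in hv.
- by right; exists v; split=> // w /eqw.
- by left; exists v.
Qed.

Lemma lex_addl m m1 m2 : m1 >> m2 -> (m + m1)%MM >> (m + m2)%MM.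
Proof.
move=> [v [h1 h2]]; exists v; split=> [|w hw]; rewrite !mnmDE.
  by rewrite ltn_add2l.
by rewrite h2.
Qed.

(** The order is well founded because there are finitely many variables; they are treated from the
    smallest to the largest, each by induction on its exponent. *)
Lemma lex_ind (P : 'X_{1..#|V|} -> Prop) :
  (forall m, (forall m', m >> m' -> P m') -> P m) -> forall m, P m.
Proof.
move=> prog.
(* The first difference has to be at a variable of rank below [n]: this is the whole order for large
   [n], and empty for [n = 0]. *)
pose gtn (n : nat) m m' := exists v : V,
  [/\ (rk v < n)%N, (m'`v < m`v)%N &
   forall w, (rk w < rk v)%N -> m`w = m'`w].
have wf (n : nat) : forall m, (forall m', gtn n m m' -> P m') -> P m.
  have [N hN] : exists N, forall v, (rk v < N)%N.
    exists (\max_v rk v)%N.+1; move=> v; rewrite ltnS; apply: (leq_bigmax v).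
  have [le|/ltnW le] := leqP N n.
    move=> m hm; apply: prog => m' [v [h1 h2]]; apply: hm; exists v; split=> //.
    exact: leq_trans (hN v) le.
  rewrite -(subKn le); elim: (N - n)%N => [|k IH] m hm.
    rewrite subn0 in hm; apply: prog => m' [v [h1 h2]]; apply: hm.
    by exists v; split.
  have [leNk|ltkN] := leqP N k.
    have e : (N - k = N - k.+1)%N by lia.
    by apply: IH; rewrite e.
  have eNk : (N - k = (N - k.+1).+1)%N by lia.
  have [v0 /eqP hv0|nov0] := pickP (fun v => rk v == (N - k.+1)%N); last first.
    apply: IH => m' [v [h0 h1 h2]]; apply: hm; exists v; split=> //.
    by rewrite eNk ltnS leq_eqVlt nov0 in h0.
  have [c] := ubnP (m`v0); elim: c m hm => // c IHc m hm ltc.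
  apply: IH => m' [v [h0 h1 h2]].
  rewrite eNk ltnS leq_eqVlt -hv0 in h0; case/orP: h0 => [/eqP/rk_inj e|h0].
    subst v; apply: IHc; last by apply: leq_trans h1 _.
    move=> m2 [v [g0 g1 g2]]; apply: hm; exists v; split=> //.
      by rewrite h2 ?hv0.
    by move=> w hw; rewrite -g2 // h2 // hv0 (ltn_trans hw).
  by apply: hm; exists v; split=> //; rewrite -hv0.
by move=> m; apply: (wf 0) => m' [v []].
Qed.

Variable K : fieldType.
Local Notation P := {mpoly K[#|V|]}.
Implicit Types f g : P.

Lemma lead_uniq f m m' : lead_mon rk f m -> lead_mon rk f m' -> m = m'.
Proof.
move=> [h1 h2] [h3 h4]; apply: NNPP => ne.
apply: (@lex_irr m); apply: (@lex_trans m'); first by apply: h2 => // /esym.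
exact: h4.
Qed.

Lemma lead_neq0 f m : lead_mon rk f m -> f != 0.
Proof. by move=> [h _]; apply: contraTneq h => ->; rewrite msupp0. Qed.

Lemma lead_ex f : f != 0 -> exists m, lead_mon rk f m.
Proof.
rewrite -msupp_eq0 /lead_mon; elim: (msupp f : seq _) => //= m s IH _.
have [->|/IH[m' [h1 h2]]] := eqVneq s nil.
  by exists m; split=> [|m']; rewrite inE // => /eqP.
have [e|ne] := eqVneq m m'.
  exists m'; split=> [|m2]; first by rewrite inE h1 orbT.
  by rewrite inE => /orP[/eqP->|/h2 //] /eqP; rewrite e eqxx.
have [gt|gt] := lex_total (elimN eqP ne).
  exists m; split=> [|m2]; first by rewrite inE eqxx.
  rewrite inE => /orP[/eqP->//|h3] _.
  have [->//|/eqP ne2] := eqVneq m2 m'.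
  by apply: lex_trans gt _; apply: h2.
exists m'; split=> [|m2]; first by rewrite inE h1 orbT.
by rewrite inE => /orP[/eqP->|/h2] //.
Qed.

Lemma lead_le f m m' : lead_mon rk f m -> m' \in msupp f -> m' = m \/ m >> m'.
Proof.
move=> [h1 h2] h3; have [->|/eqP ne] := eqVneq m' m; first by left.
by right; apply: h2.
Qed.

(** Every pair of terms other than the two leading ones multiplies to a smaller monomial, so the
    leading coefficients alone contribute to [m + m']. *)
Lemma lead_mul f g m m' : lead_mon rk f m -> lead_mon rk g m' ->
  lead_mon rk (f * g) (m + m')%MM.
Proof.
move=> lf lg.
have gt2 m1 m2 : m1 \in msupp f -> m2 \in msupp g -> (m1, m2) <> (m, m') ->
    (m + m')%MM >> (m1 + m2)%MM.
  move=> h1 h2 ne.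
  case: (lead_le lf h1) => [e1|g1]; case: (lead_le lg h2) => [e2|g2].
  - by subst; case: ne.
  - by subst; apply: lex_addl.
  - by subst; rewrite ![(_ + m')%MM]addmC; apply: lex_addl.
  - apply: (@lex_trans (m + m2)%MM); first exact: lex_addl.
    by rewrite ![(_ + m2)%MM]addmC; apply: lex_addl.
have [[fm _] [gm _]] := (lf, lg).
split; last first.
  move=> m2 /msuppM_le /allpairsP[[a b] /= [ha hb ->]] ne.
  by apply: gt2 => // -[ea eb]; subst.
rewrite mcoeff_msupp.
have -> : (f * g)@_(m + m') = f@_m * g@_m'.
  rewrite {1}(mpolyE f) mulr_suml raddf_sum /= (bigD1_seq m) //= ?msupp_uniq //.
  rewrite [X in _ + X]big1_seq ?addr0 => [|m1 /andP[ne1 h1]]; last first.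
    rewrite {1}(mpolyE g) mulr_sumr raddf_sum /= big1_seq // => m2 /andP[_ h2].
    rewrite -scalerAl -scalerAr -mpolyXD !mcoeffZ mcoeffX.
    case: eqP => [e|]; last by rewrite !mulr0.
    have : (m + m')%MM >> (m1 + m2)%MM.
      by apply: gt2 => // -[e1 _]; rewrite e1 eqxx in ne1.
    by rewrite e => /lex_irr.
  rewrite {1}(mpolyE g) mulr_sumr raddf_sum /= (bigD1_seq m') //= ?msupp_uniq //.
  rewrite [X in _ + X]big1_seq ?addr0 => [|m2 /andP[ne2 h2]]; last first.
    rewrite -scalerAl -scalerAr -mpolyXD !mcoeffZ mcoeffX.
    case: eqP => [e|]; last by rewrite !mulr0.
    have : (m + m')%MM >> (m + m2)%MM.
      by apply: gt2 => // -[e1]; rewrite e1 eqxx in ne2.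
    by rewrite e => /lex_irr.
  by rewrite -scalerAl -scalerAr -mpolyXD !mcoeffZ mcoeffX eqxx mulr1.
by rewrite mulf_neq0 // -mcoeff_msupp.
Qed.

Lemma lead1 : lead_mon rk (1 : P) 0%MM.
Proof. by split=> [|m']; rewrite msupp1 inE // => /eqP. Qed.

End Lex.

Section Ideal.
Variables (V : finType) (K : fieldType).
Local Notation P := {mpoly K[#|V|]}.
Implicit Types (G H : P -> Prop) (f g : P).

Lemma in_ideal0 G : in_ideal G 0.
Proof. by exists nil; rewrite big_nil. Qed.

Lemma in_idealD G f g : in_ideal G f -> in_ideal G g -> in_ideal G (f + g).
Proof.
move=> [s1 [h1 ->]] [s2 [h2 ->]]; exists (s1 ++ s2); rewrite big_cat; split=> //.
by move=> x; rewrite mem_cat => /orP[/h1|/h2].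
Qed.

Lemma in_idealM G a f : in_ideal G f -> in_ideal G (a * f).
Proof.
move=> [s1 [h1 ->]]; exists [seq (a * x.1, x.2) | x <- s1]; split.
  by move=> x /mapP[y /h1 ? ->].
by rewrite big_map mulr_sumr; apply: eq_bigr => x _; rewrite mulrA.
Qed.

Lemma in_idealN G f : in_ideal G f -> in_ideal G (- f).
Proof. by rewrite -mulN1r; apply: in_idealM. Qed.

Lemma in_idealB G f g : in_ideal G f -> in_ideal G g -> in_ideal G (f - g).
Proof. by move=> h1 h2; apply: in_idealD => //; apply: in_idealN. Qed.

Lemma in_ideal_gen G g : G g -> in_ideal G g.
Proof.
by move=> Gg; exists [:: (1, g)]; split=> [x|]; rewrite ?big_seq1 ?mul1r // inE => /eqP->.
Qed.

Lemma in_ideal_sum G (I : Type) (r : seq I) (Q : pred I) (F : I -> P) :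
  (forall i, Q i -> in_ideal G (F i)) -> in_ideal G (\sum_(i <- r | Q i) F i).
Proof.
by move=> h; elim/big_rec: _ => [|i x Qi]; [apply: in_ideal0 | apply/in_idealD/h].
Qed.

Lemma in_ideal_sub G H f :
  (forall g, G g -> in_ideal H g) -> in_ideal G f -> in_ideal H f.
Proof.
move=> h [s [hs ->]]; rewrite big_seq_cond; apply: in_ideal_sum => x.
by rewrite andbT => /hs/h; apply: in_idealM.
Qed.

End Ideal.

(** * Polynomials as polynomials in one of the variables *)

Section Split.
Variables (V : finType) (K : fieldType).
Local Notation n := #|V|.
Local Notation P := {mpoly K[n]}.
Local Notation "m ` v" := (fun_of_multinom m (enum_rank v)) (at level 1, v at level 0, format "m ` v").
Local Notation "''U_' v" := (U_(enum_rank v))%MM (at level 8, v at level 2, format "''U_' v").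
Implicit Types (f g : P) (y v w : V) (m : 'X_{1..n}).

Definition ysplit_var y (i : 'I_n) : {poly P} :=
  if i == enum_rank y then 'X else ('X_i)%:P.

(* [f] as a polynomial in [y]; its coefficients are kept in the same ring. *)
Definition ysplit y : P -> {poly P} :=
  mmap (polyC \o @mpolyC n K) (ysplit_var y).

HB.instance Definition _ y := GRing.RMorphism.on (ysplit y).

(** As an equality between the values of two ring morphisms, independence of [y] passes to sums,
    products and determinants. *)
Definition yfree y f := ysplit y f = f%:P.

Definition mzero y m : 'X_{1..n} :=
  [multinom (if i == enum_rank y then 0%N else m i) | i < n].

Lemma mzeroE y m i : mzero y m i = if i == enum_rank y then 0%N else m i.
Proof. exact: mnmE. Qed.

Lemma ysplitX y m : ysplit y 'X_[m] = 'X^(m`y) * ('X_[mzero y m])%:P.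
Proof.
have -> : 'X_[mzero y m] = \prod_(i < n | i != enum_rank y) 'X_i ^+ m i :> P.
  rewrite [LHS]mpolyXE_id (bigD1 (enum_rank y)) //= mzeroE eqxx expr0 mul1r.
  by apply: eq_bigr => i /negbTE ne; rewrite mzeroE ne.
rewrite /ysplit mmapX /mmap1 (bigD1 (enum_rank y)) //= /ysplit_var eqxx.
congr (_ * _); rewrite rmorph_prod; apply: eq_bigr => i /negbTE ->.
by rewrite rmorphXn.
Qed.

Lemma mcoeff_ysplit y f k m :
  ((ysplit y f)`_k)@_m = if m`y == 0%N then f@_(m + 'U_y *+ k)%MM else 0.
Proof.
rewrite [in LHS](mpolyE f) raddf_sum coef_sum raddf_sum /=.
transitivity (\sum_(m1 <- msupp f)
   f@_m1 * ((m`y == 0%N) && (m1 == (m + 'U_y *+ k)%MM))%:R); last first.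
  case: eqP => _; last by rewrite big1 // => i _; rewrite mulr0.
  rewrite {3}(mpolyE f) raddf_sum /=; apply: eq_bigr => m1 _.
  by rewrite mcoeffZ mcoeffX.
apply: eq_bigr => m1 _.
rewrite /ysplit mmapZ -/(ysplit y _) ysplitX /= coefCM coefXnM coefC subn_eq0.
rewrite mcoeffCM; congr (_ * _).
have -> : (m`y == 0%N) && (m1 == (m + 'U_y *+ k)%MM) = (m1`y == k) && (mzero y m1 == m).
  apply/idP/idP.
    move=> /andP[/eqP e0 /eqP->]; rewrite mnmDE mulmnE mnm1E eqxx e0 mul1n eqxx /=.
    apply/eqP/mnmP => i; rewrite mzeroE mnmDE mulmnE mnm1E.
    by case: eqP => [->|/eqP ne]; rewrite ?e0 // eq_sym (negbTE ne) addn0.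
  move=> /andP[/eqP<- /eqP<-]; rewrite mzeroE eqxx /=.
  apply/eqP/mnmP => i; rewrite mnmDE mulmnE mnm1E mzeroE.
  by case: eqP => [->|/eqP ne]; rewrite ?eqxx ?mul1n // eq_sym (negbTE ne) addn0.
have [lt|gt|e] /= := ltngtP (m1`y) k; rewrite ?mcoeff0 ?mcoeffX //.
Qed.

Lemma yfreeP y f : yfree y f <-> (forall m, m \in msupp f -> m`y = 0%N).
Proof.
split=> [h m|h].
  rewrite mcoeff_msupp.
  have := mcoeff_ysplit y f 0 m.
  rewrite h coefC eqxx mulm0n addm0; case: eqP => [->//|_ ->].
  by rewrite eqxx.
apply/polyP => k; apply/mpolyP => m; rewrite mcoeff_ysplit coefC.
case: k => [|k] /=.
  case: eqP => [_|ne]; first by rewrite mulm0n addm0.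
  by apply/esym/memN_msupp_eq0/negP => /h.
rewrite mcoeff0; case: eqP => // _; apply: memN_msupp_eq0; apply/negP => /h.
by rewrite mnmDE mulmnE mnm1E eqxx mul1n addnS.
Qed.

Lemma yfree_coef y f k : yfree y ((ysplit y f)`_k).
Proof.
apply/yfreeP => m; rewrite mcoeff_msupp mcoeff_ysplit.
by have [->|_] := eqVneq (m`y) 0%N; rewrite ?eqxx.
Qed.

Lemma yfreeD y f g : yfree y f -> yfree y g -> yfree y (f + g).
Proof. by rewrite /yfree => h1 h2; rewrite !rmorphD /= h1 h2. Qed.
Lemma yfreeM y f g : yfree y f -> yfree y g -> yfree y (f * g).
Proof. by rewrite /yfree => h1 h2; rewrite !rmorphM /= h1 h2. Qed.
Lemma yfreeN y f : yfree y f -> yfree y (- f).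
Proof. by rewrite /yfree => h1; rewrite !rmorphN /= h1. Qed.
Lemma yfreeB y f g : yfree y f -> yfree y g -> yfree y (f - g).
Proof. by move=> h1 h2; apply: yfreeD => //; apply: yfreeN. Qed.
Lemma yfree0 y : yfree y 0. Proof. by rewrite /yfree !rmorph0. Qed.
Lemma yfree1 y : yfree y 1. Proof. by rewrite /yfree !rmorph1. Qed.

Lemma yfree_sum y (I : Type) (r : seq I) (Q : pred I) (F : I -> P) :
  (forall i, Q i -> yfree y (F i)) -> yfree y (\sum_(i <- r | Q i) F i).
Proof.
by move=> h; elim/big_rec: _ => [|i x Qi]; [apply: yfree0 | apply/yfreeD/h].
Qed.

Lemma yfree_monom y m c : m`y = 0%N -> yfree y (c *: 'X_[m]).
Proof.
move=> h; apply/yfreeP => m' hm'.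
have [c0|cn] := eqVneq c 0; first by rewrite c0 scale0r msupp0 in hm'.
by move: hm'; rewrite (perm_mem (msuppZ _ cn)) msuppX inE => /eqP->.
Qed.

Lemma yfreeX y v : y != v -> yfree y (varX K v).
Proof.
move=> ne; apply/yfreeP => m; rewrite msuppX inE => /eqP->.
by rewrite mnm1E (inj_eq enum_rank_inj) eq_sym (negbTE ne).
Qed.

Lemma yfree_det y k (A : 'M[P]_k) :
  (forall i j, yfree y (A i j)) -> yfree y (\det A).
Proof.
move=> h; rewrite /yfree -!det_map_mx; congr (\det _).
by apply/matrixP => i j; rewrite !mxE; apply: h.
Qed.

Lemma ysplit_varX y : ysplit y (varX K y) = 'X.
Proof. by rewrite /ysplit mmapX mmap1U /ysplit_var eqxx. Qed.

Lemma ysplit_drop_coef y f D :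
  ysplit y (f - varX K y ^+ D * (ysplit y f)`_D) =
  ysplit y f - 'X^D * ((ysplit y f)`_D)%:P.
Proof.
apply: etrans (rmorphB _ _ _) _; congr (_ - _).
apply: etrans (rmorphM _ _ _) _; congr (_ * _); last exact: yfree_coef.
by apply: etrans (rmorphXn _ _ _) _; rewrite /= ysplit_varX.
Qed.

Lemma coef_ysplitD y f g k :
  (ysplit y (f + g))`_k = (ysplit y f)`_k + (ysplit y g)`_k.
Proof. by rewrite rmorphD coefD. Qed.

Lemma coef_ysplit_sum y (I : Type) (r : seq I) (F : I -> P) k :
  (ysplit y (\sum_(i <- r) F i))`_k = \sum_(i <- r) (ysplit y (F i))`_k.
Proof. by rewrite rmorph_sum coef_sum. Qed.

Lemma ysplitM_free y f g k : yfree y g ->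
  (ysplit y (f * g))`_k = (ysplit y f)`_k * g.
Proof. by rewrite rmorphM /= => ->; rewrite coefMC. Qed.

Lemma ysplitXM y f k :
  (ysplit y (varX K y * f))`_k.+1 = (ysplit y f)`_k.
Proof.
rewrite rmorphM /= ysplitX mnm1E eqxx.
have -> : mzero y 'U_y = 0%MM.
  apply/mnmP => i; rewrite mzeroE mnm1E mnm0E eq_sym.
  by case: eqP => // /eqP /negbTE ->.
by rewrite mpolyX0 mulr1 expr1 coefXM.
Qed.

(** Generators free of [y] act as constants, so the coefficients in [y] of an element of the ideal
    stay in the ideal. *)
Lemma ysplit_ideal y (G : P -> Prop) f k : (forall g, G g -> yfree y g) ->
  in_ideal G f -> in_ideal G ((ysplit y f)`_k).
Proof.
move=> hG [s [hs ->]]; rewrite rmorph_sum /= coef_sum big_seq_cond.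
apply: in_ideal_sum => x; rewrite andbT => /hs Gx.
by rewrite ysplitM_free; [apply/in_idealM/in_ideal_gen | apply: hG].
Qed.

End Split.

(** * Gröbner bases by elimination of the largest variable *)

Section LeadSplit.
Variables (V : finType) (K : fieldType).
Local Notation n := #|V|.
Local Notation P := {mpoly K[n]}.
Local Notation "m ` v" := (fun_of_multinom m (enum_rank v)) (at level 1, v at level 0, format "m ` v").
Local Notation "''U_' v" := (U_(enum_rank v))%MM (at level 8, v at level 2, format "''U_' v").
Implicit Types (f g q r : P) (y v w : V) (m : 'X_{1..n}).

Lemma mnm1v v w : ('U_v)`w = (v == w).
Proof. by rewrite mnm1E (inj_eq enum_rank_inj). Qed.

Lemma lead_varX rk v : lead_mon rk (varX K v) 'U_v.
Proof. by split=> [|m']; rewrite msuppX inE // => /eqP. Qed.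

(** All variables of [q] and [r] are smaller than [y], so any monomial with [y] beats the terms of
    [r]. *)
Lemma lead_head rk y q r mq : injective rk ->
  (forall w, (rk w <= rk y)%N -> yfree w q /\ yfree w r) ->
  lead_mon rk q mq -> lead_mon rk (varX K y * q + r) ('U_y + mq)%MM.
Proof.
move=> rki fr lq; have [l1 l2] := lead_mul rki (lead_varX rk y) lq.
have r0 w m : (rk w <= rk y)%N -> m \in msupp r -> m`w = 0%N.
  by move=> le; have [_ /yfreeP h] := fr w le; apply: h.
have q0 w : (rk w <= rk y)%N -> mq`w = 0%N.
  by move=> le; have [/yfreeP h _] := fr w le; apply: h; case: lq.
have gt m : m \in msupp r -> lex_gt rk ('U_y + mq)%MM m.
  move=> hm; exists y; split=> [|w lt]; first by rewrite (r0 y) // mnmDE mnm1v eqxx.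
  have ne : (y == w) = false by apply: contraTF lt => /eqP->; rewrite ltnn.
  by rewrite mnmDE mnm1v ne q0 ?r0 // ltnW.
split.
  rewrite mcoeff_msupp mcoeffD [r@__]memN_msupp_eq0 ?addr0 -?mcoeff_msupp //.
  by apply/negP => /gt /lex_irr.
move=> m /msuppD_le; rewrite mem_cat => /orP[h|/gt//]; exact: l2.
Qed.

(** Moving [y] within the order does not affect the comparison of monomials without [y]. *)
Lemma lex_transfer rk rk2 y m1 m2 :
  (forall v w, v != y -> w != y -> (rk v < rk w)%N = (rk2 v < rk2 w)%N) ->
  m1`y = 0%N -> m2`y = 0%N -> lex_gt rk m1 m2 -> lex_gt rk2 m1 m2.
Proof.
move=> agree e1 e2 [v [h1 h2]]; exists v; split=> // w lt.
have ny : v != y by apply: contraTneq h1 => ->; rewrite e1 e2.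
have [->|nw] := eqVneq w y; first by rewrite e1 e2.
by apply: h2; rewrite agree.
Qed.

Lemma lead_transfer rk rk2 y f m :
  (forall v w, v != y -> w != y -> (rk v < rk w)%N = (rk2 v < rk2 w)%N) ->
  yfree y f -> lead_mon rk f m -> lead_mon rk2 f m.
Proof.
move=> agree /yfreeP f0 [h1 h2]; split=> // m' h3 ne.
by apply: (lex_transfer agree _ _ (h2 _ h3 ne)); apply: f0.
Qed.

(** With [y] the largest variable, degrees in [y] are compared first, so the leading monomial sits
    in the top coefficient in [y]. *)
Lemma lead_cof rk y f mf : injective rk ->
  (forall w, w != y -> (rk y < rk w)%N) -> lead_mon rk f mf ->
  (forall k, (mf`y < k)%N -> (ysplit y f)`_k = 0) /\
  exists2 m, mf = (m + 'U_y *+ mf`y)%MM &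
    lead_mon rk ((ysplit y f)`_(mf`y)) m.
Proof.
move=> rki ymin [h1 h2].
have le_mf m : m \in msupp f -> (m`y <= mf`y)%N.
  move=> hm; have [->//|/eqP ne] := eqVneq m mf.
  have [v [g1 g2]] := h2 _ hm ne.
  have [e|nv] := eqVneq v y; first by subst v; apply: ltnW.
  by rewrite g2 // ymin.
split=> [k lt|].
  apply/mpolyP => m; rewrite mcoeff_ysplit mcoeff0.
  case: eqP => // e0; apply: memN_msupp_eq0; apply: contraL lt => /le_mf.
  by rewrite mnmDE mulmnE mnm1v eqxx mul1n e0 -leqNgt.
have em : mf = (mzero y mf + 'U_y *+ mf`y)%MM.
  apply/mnmP => i; rewrite mnmDE mulmnE mnm1E mzeroE eq_sym.
  by case: eqP => [->|_]; rewrite ?mul1n // addn0.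
exists (mzero y mf) => //; split.
  by rewrite mcoeff_msupp mcoeff_ysplit mzeroE eqxx /= -em -mcoeff_msupp.
move=> m; rewrite mcoeff_msupp mcoeff_ysplit; case: (m`y =P 0%N) => [e0|]; last first.
  by move=> _; rewrite eqxx.
rewrite -mcoeff_msupp => hm ne.
have [|v [g1 g2]] := h2 _ hm.
  rewrite {2}em => /mnmP e; apply: ne; apply/mnmP => i; have := e i.
  by rewrite !mnmDE => /addIn.
have sub w : (mf`w = (mzero y mf)`w + ('U_y *+ mf`y)%MM`w)%N.
  by rewrite {1}em mnmDE.
exists v; split.
  by move: g1; rewrite (sub v) mnmDE ltn_add2r.
by move=> w /g2; rewrite (sub w) mnmDE => /addIn.
Qed.

Lemma divides_add (m1 m2 m3 : 'X_{1..n}) : mon_divides m1 m2 -> mon_divides m1 (m2 + m3)%MM.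
Proof. by move=> h i; rewrite mnmDE (leq_trans (h i)) ?leq_addr. Qed.

End LeadSplit.

Section GVD.
Variables (V : finType) (K : fieldType).
Local Notation n := #|V|.
Local Notation P := {mpoly K[n]}.
Local Notation "m ` v" := (fun_of_multinom m (enum_rank v)) (at level 1, v at level 0, format "m ` v").
Local Notation "''U_' v" := (U_(enum_rank v))%MM (at level 8, v at level 2, format "''U_' v").
Variables (rk rk2 : V -> nat) (y : V).
Hypotheses (rk_inj : injective rk) (rk2_inj : injective rk2).
Hypothesis ymin : forall w, w != y -> (rk y < rk w)%N.
Hypothesis agree : forall v w, v != y -> w != y -> (rk v < rk w)%N = (rk2 v < rk2 w)%N.
Variables (GI GN GC : P -> Prop) (F : P -> P -> Prop).
Hypothesis GN_free : forall g, GN g -> yfree y g.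
Hypothesis F_free : forall q r, F q r -> yfree y q /\ yfree y r.
Hypothesis GI_sub : forall g, GI g ->
  GN g \/ exists q r, F q r /\ g = varX K y * q + r.
Hypothesis GN_GI : forall g, GN g -> GI g.
Hypothesis F_GI : forall q r, F q r -> GI (varX K y * q + r).
Hypothesis GC_sub : forall g, GC g -> GN g \/ exists r, F g r.
Hypothesis GN_GC : forall g, GN g -> GC g.
Hypothesis F_GC : forall q r, F q r -> GC q.
Hypothesis gbC : groebner_basis rk2 GC.
Hypothesis gbN : groebner_basis rk2 GN.
Hypothesis cross : forall q r q' r', F q r -> F q' r' ->
  in_ideal GN (q * r' - q' * r).

Definition reducible_by (G : P -> Prop) (m : 'X_{1..n}) : Prop :=
  exists g mg, [/\ G g, lead_mon rk2 g mg & mon_divides mg m].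

(* The second case says that the monomials outside in(GN) stay outside after
   multiplication by the leading monomial of some [q]. *)
Hypothesis colon :
  (forall q r, F q r -> in_ideal GN (varX K y * q + r)) \/
  (forall m, m`y = 0%N -> ~ reducible_by GN m ->
     exists q r mq, [/\ F q r, lead_mon rk2 q mq & ~ reducible_by GN (m + mq)%MM]).

Let agree2 v w : v != y -> w != y -> (rk2 v < rk2 w)%N = (rk v < rk w)%N.
Proof. by move=> h1 h2; rewrite agree. Qed.

(** Division of [e] by [GN]: a reducible leading monomial is removed by subtracting a multiple of a
    generator. An irreducible one would stay irreducible in the product with some [q], although
    [q * e] is in the ideal. *)
Lemma colon_ideal e :
  (forall m, m`y = 0%N -> ~ reducible_by GN m ->
     exists q r mq, [/\ F q r, lead_mon rk2 q mq & ~ reducible_by GN (m + mq)%MM]) ->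
  yfree y e -> (forall q r, F q r -> in_ideal GN (q * e)) -> in_ideal GN e.
Proof.
move=> col; have [->|] := eqVneq e 0; first by move=> *; apply: in_ideal0.
move=> /(lead_ex rk2_inj)[m lm]; elim/(lex_ind rk2_inj): m e lm => m IH e lm fe he.
have m0 : m`y = 0%N by have /yfreeP := fe; apply; case: lm.
have [[g [mg [Gg lg dv]]]|nr] := classic (reducible_by GN m); last first.
  have [q [r [mq [Fqr lq nr2]]]] := col m m0 nr; case: nr2.
  have lqe := lead_mul rk2_inj lm lq; rewrite mulrC in lqe.
  have [g [mg [h1 [h2 h3]]]] := gbN (he q r Fqr) (lead_neq0 lqe) lqe.
  by exists g, mg.
have gc : g@_mg != 0 by case: lg; rewrite mcoeff_msupp.
pose c := e@_m / g@_mg; pose e' := e - (c *: 'X_[(m - mg)%MM]) * g.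
have dm : (m - mg + mg)%MM = m by apply: submK; apply/mnm_lepP.
suff He' : in_ideal GN e'.
  have -> : e = e' + (c *: 'X_[(m - mg)%MM]) * g by rewrite /e' subrK.
  by apply: in_idealD => //; apply/in_idealM/in_ideal_gen.
have le_t : lead_mon rk2 ((c *: 'X_[(m - mg)%MM]) * g) m.
  rewrite -[X in lead_mon _ _ X]dm; apply: lead_mul => //.
  have cn : c != 0 by rewrite mulf_neq0 ?invr_eq0 // -mcoeff_msupp; case: lm.
  split=> [|m']; first by rewrite (perm_mem (msuppZ _ cn)) msuppX inE.
  by rewrite (perm_mem (msuppZ _ cn)) msuppX inE => /eqP.
have fe' : yfree y e'.
  apply: yfreeB => //; apply: yfreeM; last exact: GN_free.
  by apply: yfree_monom; rewrite mnmBE m0.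
have ide q r : F q r -> in_ideal GN (q * e').
  move=> Fqr; rewrite mulrBr; apply: in_idealB; first exact: he Fqr.
  by rewrite mulrA; apply/in_idealM/in_ideal_gen.
have [e0|/(lead_ex rk2_inj)[m' lm']] := eqVneq e' 0.
  by rewrite e0; apply: in_ideal0.
apply: (IH m' _ e' lm' fe' ide).
have ne : m' <> m.
  move=> em; case: lm' => + _; rewrite em mcoeff_msupp /e' mcoeffB.
  have -> : (c *: 'X_[(m - mg)%MM] * g)@_m = c * g@_mg.
    by rewrite -scalerAl mcoeffZ [_ * g]mulrC -[X in _@_X]dm mcoeffMX.
  by rewrite /c mulfVK // subrr eqxx.
case: lm' => + _ => /msuppB_le; rewrite mem_cat => /orP[h|h].
  by case: lm => _; apply.
by case: le_t => _; apply.
Qed.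

Lemma lift_syzygy (s : seq (P * (P * P))) :
  (forall x, x \in s -> yfree y x.1 /\ F x.2.1 x.2.2) ->
  in_ideal GN (\sum_(x <- s) x.1 * x.2.1) ->
  in_ideal GN (\sum_(x <- s) x.1 * (varX K y * x.2.1 + x.2.2)).
Proof.
move=> hs hq; case: colon => [h|col].
  rewrite big_seq_cond; apply: in_ideal_sum => x; rewrite andbT => /hs[_ Fx].
  by apply/in_idealM/h.
rewrite (eq_bigr (fun x => varX K y * (x.1 * x.2.1) + x.1 * x.2.2)); last first.
  by move=> x _; rewrite mulrDr mulrCA.
rewrite big_split /= -mulr_sumr; apply: in_idealD; first exact: in_idealM.
apply: colon_ideal => // [|q r Fqr].
  rewrite big_seq_cond; apply: yfree_sum => x; rewrite andbT => /hs[f1 Fx].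
  by apply: yfreeM => //; have [] := F_free Fx.
(* The cross relations exchange [q * r'] for [q' * r], which leaves the given syzygy multiplied by
   [r]. *)
have -> : q * (\sum_(x <- s) x.1 * x.2.2) =
   \sum_(x <- s) x.1 * (q * x.2.2 - x.2.1 * r) + r * \sum_(x <- s) x.1 * x.2.1.
  rewrite !mulr_sumr -big_split /=; apply: eq_bigr => x _.
  by rewrite mulrBr (mulrCA q) [r * _]mulrC -mulrA subrK.
apply: in_idealD; last exact: in_idealM.
rewrite big_seq_cond; apply: in_ideal_sum => x; rewrite andbT => /hs[_ Fx].
by apply: in_idealM; apply: cross.
Qed.

Lemma in_ideal_GI f : in_ideal GI f ->
  exists (s : seq (P * (P * P))) nn,
   [/\ (forall x, x \in s -> F x.2.1 x.2.2), in_ideal GN nn &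
    f = \sum_(x <- s) x.1 * (varX K y * x.2.1 + x.2.2) + nn].
Proof.
move=> [s [hs ->]]; elim: s hs => [|[a g] s IH] hs.
  by exists nil, 0; split=> //; [apply: in_ideal0 | rewrite !big_nil addr0].
rewrite big_cons /=; have [|s' [nn [h1 h2 ->]]] := IH _.
  by move=> x hx; apply: hs; rewrite inE hx orbT.
have := hs (a, g) (mem_head _ _); rewrite /= => /GI_sub[Gg|[q [r [Fqr eg]]]].
  exists s', (a * g + nn); split=> //; last by rewrite addrCA.
  by apply: in_idealD => //; apply/in_idealM/in_ideal_gen.
exists ((a, (q, r)) :: s'), nn; split=> //; last by rewrite big_cons /= -addrA eg.
by move=> x; rewrite inE => /orP[/eqP->|/h1].
Qed.

(** If the terms of top degree in [y] do not cancel, the leading coefficient lies in the ideal of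
    [GC]; a leading monomial of some [q] dividing it becomes, multiplied by [y], that of [y q + r].
    If they cancel, the resulting syzygy of the [q] is lifted. *)
Theorem gvd_groebner : groebner_basis rk GI.
Proof.
move=> f /in_ideal_GI[s [nn [hs hn ef]]] f0 mf lf.
have [D hD] : exists D, forall x, x \in s -> (size (ysplit y x.1) <= D)%N.
  exists (\max_(x <- s) size (ysplit y x.1))%N => x hx.
  exact: (@leq_bigmax_seq _ s xpredT (fun x => size (ysplit y x.1)) x hx isT).
have [top [m emf lm]] := lead_cof rk_inj ymin lf.
have lm2 : lead_mon rk2 ((ysplit y f)`_(mf`y)) m.
  by apply: (lead_transfer agree _ lm); apply: yfree_coef.
have fin_N : in_ideal GN ((ysplit y f)`_(mf`y)) ->
    exists g mg, GI g /\ lead_mon rk g mg /\ mon_divides mg mf.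
  move=> hN; have [g [mg [h1 [h2 h3]]]] := gbN hN (lead_neq0 lm2) lm2.
  exists g, mg; split; first exact: GN_GI.
  split; last by rewrite emf; apply: divides_add.
  by apply: (lead_transfer agree2 _ h2); apply: GN_free.
(* [D] bounds the degree in [y] of the cofactors; as long as the leading
   coefficient in [y] cancels, lifting this syzygy lowers [D]. *)
elim: D s nn hs hn ef hD => [|D IH] s nn hs hn ef hD.
  apply: fin_N; rewrite ef big_seq_cond big1 ?add0r.
    by apply: ysplit_ideal.
  move=> x; rewrite andbT => hx; have := hD x hx; rewrite leqn0 size_poly_eq0.
  move=> /eqP e0; suff -> : x.1 = 0 by rewrite mul0r.
  apply/mpolyP => m1; rewrite mcoeff0.
  have := mcoeff_ysplit y x.1 (m1`y) (mzero y m1).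
  rewrite e0 coef0 mcoeff0 mzeroE eqxx /= => ->; congr (x.1)@__.
  apply/mnmP => i; rewrite mnmDE mulmnE mnm1E mzeroE eq_sym.
  by case: eqP => [->|_]; rewrite ?mul1n // addn0.
have cofE k : (ysplit y f)`_k.+1 = \sum_(x <- s)
   ((ysplit y x.1)`_k * x.2.1 + (ysplit y x.1)`_k.+1 * x.2.2) + (ysplit y nn)`_k.+1.
  rewrite ef; apply: etrans (coef_ysplitD _ _ _ _) _; congr (_ + _).
  apply: etrans (coef_ysplit_sum _ _ _ _) _.
  apply: eq_big_seq => x /hs Fx.
  have [fq fr] := F_free Fx.
  have -> : x.1 * (varX K y * x.2.1 + x.2.2) = varX K y * (x.1 * x.2.1) + x.1 * x.2.2.
    by rewrite mulrDr mulrCA.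
  apply: etrans (coef_ysplitD _ _ _ _) _; congr (_ + _).
    by apply: etrans (ysplitXM _ _ _) _; apply: ysplitM_free.
  exact: ysplitM_free.
have cofD x k : x \in s -> (D < k)%N -> (ysplit y x.1)`_k = 0.
  by move=> hx lt; rewrite nth_default // (leq_trans (hD x hx)).
(* The cofactors have degree at most [D] in [y], so the sum over [s] has degree at most [D.+1]. A
   higher degree of [f] comes from [nn] alone, a lower one from cancellation. *)
have [lt|gt|e] := ltngtP (mf`y) D.+1; last first.
- have hC : in_ideal GC ((ysplit y f)`_(mf`y)).
    rewrite e cofE; apply: in_idealD; last first.
      by apply: (@in_ideal_sub _ _ GN) => [g /GN_GC|]; [exact: in_ideal_gen | exact: ysplit_ideal].
    rewrite big_seq_cond; apply: in_ideal_sum => x; rewrite andbT => hx.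
    rewrite (cofD x D.+1 hx (ltnSn D)) mul0r addr0; apply/in_idealM/in_ideal_gen.
    exact: F_GC (hs x hx).
  have [g [mg [h1 [h2 h3]]]] := gbC hC (lead_neq0 lm2) lm2.
  have [Gg|[r Fgr]] := GC_sub h1.
    exists g, mg; split; first exact: GN_GI.
    split; last by rewrite emf; apply: divides_add.
    by apply: (lead_transfer agree2 _ h2); apply: GN_free.
  have [fg fr] := F_free Fgr.
  exists (varX K y * g + r), ('U_y + mg)%MM; split; first exact: F_GI.
  split.
    apply: lead_head => // [w le|]; last by apply: (lead_transfer agree2 fg h2).
    have [->//|ne] := eqVneq w y.
    by move: le; rewrite leqNgt ymin.
  move=> i; rewrite emf e !mnmDE mulmnE addnC leq_add //.
  by rewrite mulnS leq_addr.
- apply: fin_N; case: (mf`y) gt => // k gt.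
  rewrite cofE big_seq_cond big1 ?add0r; first exact: ysplit_ideal.
  by move=> x; rewrite andbT => hx; rewrite (cofD x k hx gt) (cofD x k.+1 hx (ltnW gt)) !mul0r addr0.
pose s1 := [seq ((ysplit y x.1)`_D, x.2) | x <- s].
have hs1 x : x \in s1 -> yfree y x.1 /\ F x.2.1 x.2.2.
  move=> /mapP[z hz ->] /=; split; first exact: yfree_coef.
  exact: hs hz.
have hN : in_ideal GN (\sum_(x <- s1) x.1 * x.2.1).
  have e0 := top D.+1 lt; rewrite cofE in e0.
  have -> : \sum_(x <- s1) x.1 * x.2.1 = - (ysplit y nn)`_D.+1.
    apply/eqP; rewrite -addr_eq0 -[X in _ == X]e0 big_map; apply/eqP.
    congr (_ + _); apply: eq_big_seq => x hx /=.
    by rewrite (cofD x D.+1 hx (ltnSn D)) mul0r addr0.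
  by apply/in_idealN/ysplit_ideal.
have hlift := lift_syzygy hs1 hN.
(* The terms of degree [D] are removed from the cofactors and, by the lifted syzygy, absorbed in
   [nn]. *)
pose s2 := [seq (x.1 - varX K y ^+ D * (ysplit y x.1)`_D, x.2) | x <- s].
apply: (IH s2 (nn + varX K y ^+ D *
   \sum_(x <- s1) x.1 * (varX K y * x.2.1 + x.2.2))).
- by move=> x /mapP[z hz ->]; exact: hs hz.
- by apply: in_idealD => //; apply: in_idealM.
- rewrite ef addrCA addrC; congr (_ + _); rewrite !big_map mulr_sumr -big_split /=.
  by apply: eq_bigr => x _; rewrite mulrBl -mulrA subrK.
move=> x /mapP[z hz ->] /=; apply/leq_sizeP => k leDk.
rewrite ysplit_drop_coef.
rewrite coefB coefXnM coefC ltnNge leDk /= subn_eq0.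
have [lt2|le2] := ltnP D k; first by rewrite subr0 cofD.
by have -> : k = D by [apply/eqP; rewrite eqn_leq le2]; rewrite subrr.
Qed.

End GVD.

(** * Minors *)

(** The Schur complement formula with denominators cleared by the adjugate. *)
Lemma det_schur (R : idomainType) n (a : 'M[R]_1) (b : 'M_(1, n)) (c : 'M_(n, 1))
    (D : 'M_n) : \det D != 0 ->
  \det (block_mx a b c D) = a 0 0 * \det D - (b *m \adj D *m c) 0 0.
Proof.
move=> D0; apply: (mulIf D0).
(* Right multiplication by [B] clears the lower left block and multiplies the determinant by the
   factor [\det D] introduced above. *)
pose B := block_mx (\det D)%:M 0 (- (\adj D *m c)) 1%:M : 'M_(1 + n).
have dB : \det B = \det D by rewrite det_lblock det1 mulr1 det_scalar1.
rewrite -[X in _ * X = _]dB -det_mulmx mulmx_block !mulmx1 !mulmx0 !add0r.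
rewrite !mulmxN !mulmxA mul_mx_adj !mul_mx_scalar mul_scalar_mx subrr det_ublock.
by rewrite det_mx11 !mxE [\det D * a 0 0]mulrC.
Qed.

Section Cross.
Variables (V : finType) (K : fieldType).
Local Notation P := {mpoly K[#|V|]}.
Variable G : P -> Prop.

(* By [det_schur], the hypotheses are about the determinants of
   [[b' j, b], [W j, D]] and [[c i, W i], [c', D']], and the conclusion is about
   [q r' - q' r] for [[y, b], [c, D]] and [[y, b'], [c', D']]. *)
Lemma schur_cross p p' (b : 'rV[P]_p) (c : 'cV_p) (D : 'M_p)
    (b' : 'rV_p') (c' : 'cV_p') (D' : 'M_p') (W : 'M_(p, p')) :
  (forall j, in_ideal G (\det D * b' 0 j - (b *m \adj D *m W) 0 j)) ->
  (forall i, in_ideal G (\det D' * c i 0 - (W *m \adj D' *m c') i 0)) ->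
  in_ideal G (\det D * (b' *m \adj D' *m c') 0 0 - \det D' * (b *m \adj D *m c) 0 0).
Proof.
move=> hu hv.
pose U := \det D *: b' - b *m \adj D *m W.
pose T := \det D' *: c - W *m \adj D' *m c'.
have -> : \det D * (b' *m \adj D' *m c') 0 0 - \det D' * (b *m \adj D *m c) 0 0
   = (U *m (\adj D' *m c')) 0 0 - ((b *m \adj D) *m T) 0 0.
  have e : \det D *: (b' *m \adj D' *m c') - \det D' *: (b *m \adj D *m c) =
      U *m (\adj D' *m c') - (b *m \adj D) *m T.
    rewrite /U /T mulmxBl mulmxBr -!scalemxAl -!scalemxAr !mulmxA.
    by rewrite opprB addrA subrK.
  by move: (congr1 (fun M : 'M_1 => M 0 0) e); rewrite !mxE.
apply: in_idealB; rewrite mxE; apply: in_ideal_sum => k _.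
  by rewrite mulrC; apply: in_idealM; rewrite !mxE; have := hu k; rewrite !mxE.
by apply: in_idealM; rewrite !mxE; have := hv k; rewrite !mxE.
Qed.

End Cross.

Section Pminor.
Variables (R : comRingType) (T : eqType) (x0 : T).
Implicit Types (g : T -> T -> R) (rs cs : seq T).

(** Rows and columns are named by elements of [T], later by entries lying in them; [g] gives the
    entry common to a row and a column. *)
Definition pminor g n rs cs : R :=
  \det (\matrix_(i < n, j < n) g (nth x0 rs i) (nth x0 cs j)).

Lemma pminor_tr g n rs cs : pminor g n rs cs = pminor (fun x y => g y x) n cs rs.
Proof.
rewrite /pminor -det_tr; congr (\det _).
by apply/matrixP => i j; rewrite !mxE.
Qed.

Lemma eq_pminor g g' n rs cs rs' cs' :
  (forall i j, (i < n)%N -> (j < n)%N ->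
     g (nth x0 rs i) (nth x0 cs j) = g' (nth x0 rs' i) (nth x0 cs' j)) ->
  pminor g n rs cs = pminor g' n rs' cs'.
Proof.
by move=> h; congr (\det _); apply/matrixP => i j; rewrite !mxE h.
Qed.

Lemma pminor_perm_rows g n rs rs' cs : size rs = n -> perm_eq rs rs' ->
  exists b : bool, pminor g n rs cs = (-1) ^+ b * pminor g n rs' cs.
Proof.
move=> /eqP sz pe; have /eqP sz' : size rs' = n by rewrite -(perm_size pe) (eqP sz).
have /tuple_permP[p ep] : perm_eq (Tuple sz) (Tuple sz') by [].
exists (p : bool); rewrite /pminor.
rewrite -det_perm -det_mulmx -row_permE; congr (\det _).
apply/matrixP => i j; rewrite !mxE.
have -> : nth x0 rs i = nth x0 rs' (p i); last by [].
have := congr1 (fun s => nth x0 s i) ep; rewrite /= => ->.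
by rewrite -[LHS](tnth_nth x0 [tuple tnth (Tuple sz') (p i) | i < n]) tnth_mktuple (tnth_nth x0).
Qed.

Lemma pminor_perm_cols g n rs cs cs' : size cs = n -> perm_eq cs cs' ->
  exists b : bool, pminor g n rs cs = (-1) ^+ b * pminor g n rs cs'.
Proof. by move=> sz pe; rewrite !(pminor_tr g); apply: pminor_perm_rows. Qed.

Lemma pminor_rows_eq0 g n rs cs i j : (i < j < n)%N ->
  (forall k, (k < n)%N -> g (nth x0 rs i) (nth x0 cs k) = g (nth x0 rs j) (nth x0 cs k)) ->
  pminor g n rs cs = 0.
Proof.
move=> /andP[ij jn] h.
apply: (@determinant_alternate _ _ _ (Ordinal (ltn_trans ij jn)) (Ordinal jn)).
  by rewrite -val_eqE /= neq_ltn ij.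
by move=> k; rewrite !mxE /= h.
Qed.

Definition del i rs := take i rs ++ drop i.+1 rs.

Lemma subseq_del i rs : subseq (del i rs) rs.
Proof.
rewrite -{2}(cat_take_drop i rs) cat_subseq //.
by rewrite -add1n -drop_drop drop_subseq.
Qed.

Lemma nth_del i rs j : (i < size rs)%N -> nth x0 (del i rs) j = nth x0 rs (bump i j).
Proof.
move=> lt; rewrite nth_cat size_take lt /bump.
case: (ltnP j i) => h; first by rewrite nth_take.
by rewrite nth_drop; congr nth; lia.
Qed.

Lemma size_del i rs : (i < size rs)%N -> size (del i rs) = (size rs).-1.
Proof. by move=> lt; rewrite size_cat size_take size_drop lt; lia. Qed.

Lemma pminor_expand_col g n rs x cs : size rs = n.+1 ->
  pminor g n.+1 rs (x :: cs) =
  \sum_(i < n.+1) (-1) ^+ i * g (nth x0 rs i) x * pminor g n (del i rs) cs.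
Proof.
move=> sz; rewrite /pminor (expand_det_col _ 0); apply: eq_bigr => i _.
rewrite !mxE /= /cofactor addn0 mulrCA mulrA; congr (_ * \det _).
apply/matrixP => k l; rewrite !mxE /= nth_del ?sz //.
Qed.

End Pminor.

Section PminorIdeal.
Variables (V : finType) (K : fieldType) (x0 : V).
Local Notation P := {mpoly K[#|V|]}.
Variables (G : P -> Prop) (g : V -> V -> P).

(** Expanding along the columns of [cs2] one after another leaves combinations of minors on the
    columns of [cs1]. *)
Lemma laplace_ideal n rs cs1 cs2 : size rs = n -> (size cs1 + size cs2)%N = n ->
  (forall rs1, subseq rs1 rs -> size rs1 = size cs1 ->
     in_ideal G (pminor x0 g (size cs1) rs1 cs1)) ->
  in_ideal G (pminor x0 g n rs (cs2 ++ cs1)).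
Proof.
elim: cs2 n rs => [|x cs2 IH] n rs sz e h.
  by rewrite addn0 in e; rewrite -e; apply: h; rewrite ?sz.
case: n sz e => [|n] sz e; first by rewrite /= addnS in e.
rewrite cat_cons pminor_expand_col //; apply: in_ideal_sum => i _.
apply/in_idealM/IH => [||rs1 sub]; first by rewrite size_del ?sz.
  by move: e; rewrite /= addnS => -[].
by apply: h; apply: subseq_trans sub _; apply: subseq_del.
Qed.

Lemma perm_rows_ideal n rs rs' cs : size rs = n -> perm_eq rs rs' ->
  in_ideal G (pminor x0 g n rs' cs) -> in_ideal G (pminor x0 g n rs cs).
Proof.
by move=> sz pe h; have [b ->] := pminor_perm_rows x0 g cs sz pe; apply: in_idealM.
Qed.

Lemma perm_cols_ideal n rs cs cs' : size cs = n -> perm_eq cs cs' ->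
  in_ideal G (pminor x0 g n rs cs') -> in_ideal G (pminor x0 g n rs cs).
Proof.
by move=> sz pe h; have [b ->] := pminor_perm_cols x0 g rs sz pe; apply: in_idealM.
Qed.

Definition prow z (cs : seq V) n : 'rV[P]_n := \row_j g z (nth x0 cs j).
Definition pcol (rs : seq V) z n : 'cV[P]_n := \col_i g (nth x0 rs i) z.
Definition pmat (rs cs : seq V) m n : 'M[P]_(m, n) :=
  \matrix_(i, j) g (nth x0 rs i) (nth x0 cs j).

Lemma pminor_schur n y z rs cs : pminor x0 g n rs cs != 0 ->
  pminor x0 g n.+1 (y :: rs) (z :: cs) =
  g y z * pminor x0 g n rs cs
  - (prow y cs n *m \adj (pmat rs cs n n) *m pcol rs z n) 0 0.
Proof.
move=> D0; have -> : g y z = ((g y z)%:M : 'M[P]_1) 0 0 by rewrite mxE eqxx mulr1n.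
rewrite -det_schur //; congr (\det _).
apply/matrixP => i j; rewrite -[i]/(i : 'I_(1 + n)) -[j]/(j : 'I_(1 + n)).
rewrite -(splitK (i : 'I_(1 + n))) -(splitK (j : 'I_(1 + n))).
case: (split _) => i'; case: (split _) => j' /=.
- by apply/esym; apply: etrans (block_mxEul _ _ _ _ _ _) _; rewrite !mxE !ord1 eqxx mulr1n.
- by apply/esym; apply: etrans (block_mxEur _ _ _ _ _ _) _; rewrite !mxE !ord1.
- by apply/esym; apply: etrans (block_mxEdl _ _ _ _ _ _) _; rewrite !mxE !ord1.
- by apply/esym; apply: etrans (block_mxEdr _ _ _ _ _ _) _; rewrite !mxE.
Qed.

End PminorIdeal.

(** * Minors of a grid and their leading monomials *)

Section GridMinor.
Variables (V : finType) (K : fieldType) (I : eqType) (c : grid V I) (x0 : V).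
Local Notation P := {mpoly K[#|V|]}.
Local Notation vx := (vx c).
Local Notation sh := (sh c).
Local Notation lg := (lg c).
Implicit Types (v w y z : V) (rs cs ds : seq V) (S L : {set V}).
Hypothesis inj : forall v w, vx v = vx w -> sh v = sh w -> lg v = lg w -> v = w.
Hypothesis rect : forall v w, vx v = vx w ->
  exists z, [/\ vx z = vx w, sh z = sh v & lg z = lg w].

(* The entry in the row of [v] and the column of [w]; junk when [v] and [w] are
   in different matrices. *)
Definition mix v w : V :=
  odflt v [pick z | [&& vx z == vx w, sh z == sh v & lg z == lg w]].

Lemma mixP v w : vx v = vx w ->
  [/\ vx (mix v w) = vx w, sh (mix v w) = sh v & lg (mix v w) = lg w].
Proof.
move=> e; rewrite /mix; case: pickP => [z /and3P[/eqP ? /eqP ? /eqP ?] //|no].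
by have [z [h1 h2 h3]] := rect e; have := no z; rewrite h1 h2 h3 !eqxx.
Qed.

Lemma mix_eq v w z : vx v = vx w -> vx z = vx w -> sh z = sh v -> lg z = lg w -> mix v w = z.
Proof. by move=> e h1 h2 h3; have [? ? ?] := mixP e; apply: inj; congruence. Qed.

Lemma mix_id v : mix v v = v.
Proof. exact: mix_eq. Qed.

Definition mvar v w : P := varX K (mix v w).

Definition chain_minor ds : P := pminor x0 mvar (size ds) ds ds.

Variable u : I -> nat.

(** Only the head of the diagonal is required to be in [L]: in the states considered, [L] contains
    with a variable all smaller ones. *)
Definition state_gen1 S L (g : P) : Prop := exists v ds,
  [/\ path (clt c) v ds, v \in L, (u (vx v) < pre c S v + size (v :: ds))%N
    & g = chain_minor (v :: ds)].

(** Sorting rows and columns changes at most the sign, and a repetition makes the minor zero.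
    Otherwise the diagonal is a chain that continues any chain of [S] in the corner before [(i, l)].
    A minor of size 0 is 1, and then [S] alone breaks the bound. *)
Lemma minor_in S L (G : P -> Prop) a i l n rs cs :
  (forall g, state_gen1 S L g -> in_ideal G g) ->
  (~ rank_ok c u S -> in_ideal G 1) ->
  size rs = n -> size cs = n ->
  (forall r, r \in rs -> vx r = a /\ (i <= sh r)%N) ->
  (forall x, x \in cs -> vx x = a /\ (l <= lg x)%N) ->
  (forall r x, r \in rs -> x \in cs -> mix r x \in L) ->
  (u a < ext c S a i l + n)%N ->
  in_ideal G (pminor x0 mvar n rs cs).
Proof.
move=> hG h1 szr szc hr hc hL lt.
case: n szr szc lt => [|n] szr szc lt.
  rewrite /pminor det_mx00; apply: h1 => ok; have := ok a.
  by have := ext_le_full inj S a i l; move: lt; rewrite addn0; lia.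
have nr k : (k < n.+1)%N -> nth x0 rs k \in rs by move=> lk; rewrite mem_nth ?szr.
have nc k : (k < n.+1)%N -> nth x0 cs k \in cs by move=> lk; rewrite mem_nth ?szc.
have vv r x : r \in rs -> x \in cs -> vx r = vx x.
  by move=> /hr[-> _] /hc[-> _].
have [ur|/(uniqPn 0%N)[p [q [pq qs e]]]] := boolP (uniq (map sh rs)); last first.
  rewrite size_map szr in qs; rewrite !(nth_map x0) ?szr // in e; last exact: ltn_trans qs.
  rewrite (pminor_rows_eq0 (i := p) (j := q)) ?pq //; first exact: in_ideal0.
  move=> k lk; have rq := nr q qs; have rp := nr p (ltn_trans pq qs); have ck := nc k lk.
  congr (varX K _); have [e1 e2 e3] := mixP (vv _ _ rq ck).
  by apply: mix_eq => //; [exact: vv | rewrite e].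
have [uc|/(uniqPn 0%N)[p [q [pq qs e]]]] := boolP (uniq (map lg cs)); last first.
  rewrite size_map szc in qs; rewrite !(nth_map x0) ?szc // in e; last exact: ltn_trans qs.
  rewrite pminor_tr (pminor_rows_eq0 (i := p) (j := q)) ?pq //; first exact: in_ideal0.
  move=> k lk; have rq := nc q qs; have rp := nc p (ltn_trans pq qs); have ck := nr k lk.
  congr (varX K _); have [e1 e2 e3] := mixP (vv _ _ ck rq).
  by apply: mix_eq => //; [exact: vv | rewrite e1 -(vv _ _ ck rp) (vv _ _ ck rq) | rewrite e].
pose rs' := sort (relpre sh leq) rs; pose cs' := sort (relpre lg leq) cs.
have pr : perm_eq rs rs' by rewrite perm_sym perm_sort.
have pc : perm_eq cs cs' by rewrite perm_sym perm_sort.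
apply: (perm_rows_ideal szr pr); apply: (perm_cols_ideal szc pc).
have szr' : size rs' = n.+1 by rewrite size_sort.
have szc' : size cs' = n.+1 by rewrite size_sort.
have nr' k : (k < n.+1)%N -> nth x0 rs' k \in rs by move=> lk; rewrite (perm_mem pr) mem_nth ?szr'.
have nc' k : (k < n.+1)%N -> nth x0 cs' k \in cs by move=> lk; rewrite (perm_mem pc) mem_nth ?szc'.
have sr : sorted ltn (map sh rs').
  rewrite ltn_sorted_uniq_leq sorted_map sort_sorted ?andbT.
    by rewrite (perm_uniq (perm_map sh (t := rs) _)) // perm_sort.
  by move=> r x; apply: leq_total.
have sc : sorted ltn (map lg cs').
  rewrite ltn_sorted_uniq_leq sorted_map sort_sorted ?andbT.
    by rewrite (perm_uniq (perm_map lg (t := cs) _)) // perm_sort.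
  by move=> r x; apply: leq_total.
pose f k := mix (nth x0 rs' k) (nth x0 cs' k).
have fP k : (k < n.+1)%N ->
    [/\ vx (f k) = a, sh (f k) = sh (nth x0 rs' k) & lg (f k) = lg (nth x0 cs' k)].
  move=> lk; have [-> -> ->] := mixP (vv _ _ (nr' k lk) (nc' k lk)).
  by have [-> _] := hc _ (nc' k lk).
have -> : pminor x0 mvar n.+1 rs' cs' = chain_minor (mkseq f n.+1).
  rewrite /chain_minor size_mkseq; apply: eq_pminor => p q lp lq; rewrite !nth_mkseq //.
  have [e1 e2 e3] := fP p lp; have [g1 g2 g3] := fP q lq.
  congr (varX K _); apply/esym; have [i1 i2 i3] := mixP (vv _ _ (nr' p lp) (nc' q lq)).
  have [cq _] := hc _ (nc' q lq).
  by apply: mix_eq; rewrite ?e1 ?g1 ?i1 ?i2 ?i3 ?e2 ?g3.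
apply: hG; exists (f 0%N), (behead (mkseq f n.+1)); split=> //=.
- rewrite -[path _ _ _]/(sorted (clt c) (mkseq f n.+1)).
  apply/(sortedP x0) => k; rewrite size_mkseq => lk; rewrite !nth_mkseq //; last exact: ltnW.
  have [e1 e2 e3] := fP k (ltnW lk); have [g1 g2 g3] := fP k.+1 lk.
  have := (sortedP 0%N sr) k; have := (sortedP 0%N sc) k.
  rewrite !size_map szr' szc' !(nth_map x0) ?szr' ?szc' //; try exact: ltnW.
  by move=> h2 h3; rewrite /clt e1 g1 eqxx e2 g2 e3 g3 /=; apply/andP; split; [apply: h3 | apply: h2].
- by apply: hL; [exact: nr' | exact: nc'].
rewrite size_map size_iota; have [e1 e2 e3] := fP 0%N isT.
have [_ ir] := hr _ (nr' 0%N isT); have [_ lc] := hc _ (nc' 0%N isT).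
rewrite /pre e1 e2 e3; apply: leq_trans lt _; rewrite leq_add2r leq_lis //.
Qed.

Definition minor_rest v ds : P :=
  - (prow x0 mvar v ds (size ds) *m \adj (pmat x0 mvar ds ds (size ds) (size ds))
     *m pcol x0 mvar ds v (size ds)) 0 0.

Lemma yfree_sign w k : yfree w ((-1) ^+ k : P).
Proof.
by elim: k => [|k IH]; [apply: yfree1 | rewrite exprS mulN1r; apply: yfreeN].
Qed.

Lemma yfree_adj w n (A : 'M[P]_n) i j :
  (forall i j, yfree w (A i j)) -> yfree w (\adj A i j).
Proof.
move=> h; rewrite mxE; apply: yfreeM; first exact: yfree_sign.
by apply: yfree_det => k l; rewrite !mxE.
Qed.

Lemma yfree_pminor w n rs cs : size rs = n -> size cs = n ->
  (forall x z, x \in rs -> z \in cs -> w != mix x z) -> yfree w (pminor x0 mvar n rs cs).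
Proof.
move=> sr sc h; apply: yfree_det => i j; rewrite mxE; apply: yfreeX.
by apply: h; rewrite mem_nth ?sr ?sc.
Qed.

Lemma yfree_minor_rest w v ds :
  (forall x, x \in ds -> w != mix v x /\ w != mix x v) ->
  (forall x z, x \in ds -> z \in ds -> w != mix x z) ->
  yfree w (minor_rest v ds).
Proof.
move=> h1 h2; apply: yfreeN; rewrite mxE; apply: yfree_sum => k _.
apply: yfreeM; last first.
  by rewrite mxE; apply: yfreeX; have [] := h1 _ (mem_nth x0 (ltn_ord k)).
rewrite mxE; apply: yfree_sum => l _; apply: yfreeM.
  by rewrite mxE; apply: yfreeX; have [] := h1 _ (mem_nth x0 (ltn_ord l)).
by apply: yfree_adj => p q; rewrite mxE; apply/yfreeX/h2; apply: mem_nth.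
Qed.

Lemma chain_sh v ds : path (clt c) v ds -> forall x, x \in ds ->
  [/\ vx x = vx v, (sh v < sh x)%N & (lg v < lg x)%N].
Proof.
move=> /(order_path_min (@clt_trans _ _ c))/allP h x /h /and3P[/eqP-> h1 h2].
by split.
Qed.

Definition mdiag ds : 'X_{1..#|V|} := (\sum_(w <- ds) U_(enum_rank w))%MM.

Section Lead.
Variable (rk : V -> nat) (L : {set V}).
Hypothesis rk_inj : injective rk.
Hypothesis rk_mono : forall v w, v \in L -> vx v = vx w -> (sh v <= sh w)%N ->
  (lg v <= lg w)%N -> (w \in L) /\ (rk v <= rk w)%N.

(** All entries of the minor lie weakly below and to the right of the head [v], which is therefore
    the largest variable. *)
Lemma mix_after v ds x z : path (clt c) v ds -> v \in L ->
  x \in v :: ds -> z \in v :: ds -> (x, z) <> (v, v) ->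
  [/\ vx (mix x z) = vx v, mix x z \in L, mix x z <> v & (rk v < rk (mix x z))%N].
Proof.
move=> pa vL xd zd ne; have hd := chain_sh pa.
have le w : w \in v :: ds -> [/\ vx w = vx v, (sh v <= sh w)%N & (lg v <= lg w)%N].
  by rewrite inE => /predU1P[->//|/hd[-> e2 e3]]; split=> //; apply: ltnW.
have [ex sx lx] := le x xd; have [ez sz lz] := le z zd.
have [|e1 e2 e3] := @mixP x z; first by rewrite ex ez.
have nv : mix x z <> v.
  move=> e; apply: ne; rewrite e in e2 e3; move: xd zd; rewrite !inE.
  move=> /predU1P[->|/hd[_ + _]]; last by rewrite e2 ltnn.
  by move=> /predU1P[->//|/hd[_ _]]; rewrite e3 ltnn.
have [h1 h2] : (mix x z \in L) /\ (rk v <= rk (mix x z))%N.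
  by apply: rk_mono; rewrite ?e1 ?ez ?e2 ?e3.
split=> //; first by rewrite e1.
by rewrite ltn_neqAle h2 andbT; apply/eqP => /rk_inj /esym.
Qed.

Lemma chain_L v ds x : path (clt c) v ds -> v \in L -> x \in ds -> x \in L.
Proof.
move=> pa vL /(chain_sh pa)[e1 e2 e3].
by have [|||] := rk_mono (w := x) vL; rewrite ?e1 // ltnW.
Qed.

Lemma head_free v ds w : path (clt c) v ds -> v \in L -> (rk w <= rk v)%N ->
  yfree w (chain_minor ds) /\ yfree w (minor_rest v ds).
Proof.
move=> pa vL le; have hd := chain_sh pa.
have ne x z : x \in v :: ds -> z \in v :: ds -> (x, z) <> (v, v) -> w != mix x z.
  move=> h1 h2 h3; have [_ _ _ lt] := mix_after pa vL h1 h2 h3.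
  by apply: contraTneq lt => <-; rewrite -leqNgt.
have nv x : x \in ds -> x <> v by move=> /hd[_ + _] => + e; rewrite e ltnn.
split.
  apply: yfree_pminor => // x z hx hz; apply: ne; rewrite ?inE ?hx ?hz ?orbT //.
  by move=> -[/(nv _ hx)].
apply: yfree_minor_rest => [x hx|x z hx hz].
  by split; apply: ne; rewrite ?inE ?hx ?eqxx ?orbT // => -[] // /(nv _ hx).
by apply: ne; rewrite ?inE ?hx ?hz ?orbT // => -[/(nv _ hx)].
Qed.

Lemma chain_minor_nil : chain_minor [::] = 1.
Proof. by rewrite /chain_minor /pminor det_mx00. Qed.

(** Induction on the diagonal: [pminor_schur] splits off the head times the minor of [ds], and
    [lead_head] applies. The statement includes [ds] because the splitting needs its minor to be
    nonzero. *)
Lemma lead_chain_minor v ds : path (clt c) v ds -> v \in L ->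
  lead_mon rk (chain_minor (v :: ds)) (mdiag (v :: ds)) /\
  lead_mon rk (chain_minor ds) (mdiag ds).
Proof.
move=> pa vL.
have lds : lead_mon rk (chain_minor ds) (mdiag ds).
  elim: ds v pa vL => [|w ds IH] v pa vL.
    by rewrite chain_minor_nil /mdiag big_nil; apply: lead1.
  have [pw pwd] := andP pa; have wL := chain_L pa vL (mem_head _ _).
  have lds := IH w pwd wL.
  rewrite /mdiag big_cons -/(mdiag ds) {1}/chain_minor pminor_schur ?(lead_neq0 lds) //.
  by rewrite /mvar mix_id; apply: (lead_head rk_inj _ lds) => x lex; apply: head_free.
split=> //.
rewrite /mdiag big_cons -/(mdiag ds) {1}/chain_minor pminor_schur ?(lead_neq0 lds) //.
by rewrite /mvar mix_id; apply: (lead_head rk_inj _ lds) => x lex; apply: head_free.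
Qed.

Lemma chain_minor_head v ds : path (clt c) v ds -> v \in L ->
  chain_minor (v :: ds) = varX K v * chain_minor ds + minor_rest v ds.
Proof.
move=> pa vL; have [_ /lead_neq0 h] := lead_chain_minor pa vL.
by rewrite {1}/chain_minor pminor_schur // /mvar mix_id.
Qed.

End Lead.

End GridMinor.

(** * Elimination of one variable from the determinantal ideals *)

Section StateSide.
Variables (V : finType) (K : fieldType) (I A : eqType) (ar : V -> A) (x0 : V).
Local Notation P := {mpoly K[#|V|]}.
Variables (c c' : grid V I) (u : I -> nat).
Hypotheses (h : compat ar c c') (h' : compat ar c' c).
Variable rk : V -> nat.
Hypothesis rk_inj : injective rk.
Hypothesis mono : forall v w, vx c v = vx c w -> (sh c v <= sh c w)%N ->
  (lg c v <= lg c w)%N -> (rk v <= rk w)%N.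
Hypothesis mono' : forall v w, vx c' v = vx c' w -> (sh c' v <= sh c' w)%N ->
  (lg c' v <= lg c' w)%N -> (rk v <= rk w)%N.
Implicit Types (v w y z : V) (ds : seq V) (S L E : {set V}).

Local Notation inj := (half_inj h).
Local Notation inj' := (half_inj h').
Local Notation rect := (half_rect h).
Local Notation rect' := (half_rect h').
Local Notation mixP1 := (mixP rect).
Local Notation mixP2 := (mixP rect').

Definition face S := rank_ok c u S /\ rank_ok c' u S.

Lemma block_eq v w : ar v = ar w -> sh c v = sh c w -> sh c' v = sh c' w -> v = w.
Proof.
move=> e e1 e2; have [e3 e4] := half_blk h e.
by apply: inj => //; lia.
Qed.

Lemma mix_ar v w : vx c v = vx c w ->
  [/\ ar (mix c v w) = ar w, sh c (mix c v w) = sh c v & sh c' (mix c v w) = sh c' w].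
Proof. by move=> e; have [e1 e2 e3] := mixP1 e; have [] := half_col h e1 e3. Qed.

Variables (S L : {set V}) (y : V).
Hypothesis Lup : forall v w, v \in L -> (rk v <= rk w)%N -> w \in L.
Hypothesis yL : y \in L.
Hypothesis ymin : forall w, w \in L -> (rk y <= rk w)%N.
Hypothesis disj : forall v, v \in S -> v \notin L.

Local Notation L' := (L :\ y).
Local Notation S' := (y |: S).
Local Notation a := (vx c y).

Lemma ynS : y \notin S.
Proof. by apply: contraL yL => /disj. Qed.

Lemma rk_monoL v w : v \in L -> vx c v = vx c w -> (sh c v <= sh c w)%N ->
  (lg c v <= lg c w)%N -> (w \in L) /\ (rk v <= rk w)%N.
Proof. by move=> vL e1 e2 e3; have le := mono e1 e2 e3; split=> //; apply: Lup le. Qed.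

Lemma after_y w : vx c w = a -> (sh c y <= sh c w)%N -> (lg c y <= lg c w)%N -> w <> y ->
  w \in L'.
Proof.
move=> e1 e2 e3 /eqP ne; rewrite in_setD1 ne.
by have [|||] := rk_monoL (w := w) yL.
Qed.

Lemma L'_rk v : v \in L' -> (rk y < rk v)%N.
Proof.
rewrite in_setD1 => /andP[ne /ymin]; rewrite leq_eqVlt => /predU1P[/rk_inj e|//].
by rewrite e eqxx in ne.
Qed.

(** Entries of [L'] are smaller than [y], so none of them precedes [y] in its matrix. *)
Lemma before_y E w : {subset E <= L' :|: S} -> vx c w = a -> (sh c w <= sh c y)%N ->
  (lg c w <= lg c y)%N -> (w \in E) -> w \in S.
Proof.
move=> sub e1 e2 e3 /sub; rewrite in_setU => /orP[/L'_rk|//].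
by rewrite ltnNge mono.
Qed.

(** Every entry after [y] in its matrix is smaller, hence in [L] and not deleted. *)
Lemma sufS_eq0 : suf c S y = 0%N.
Proof.
rewrite /suf /tail.
have [ds [<- _ hd]] := chain_ex c S a (sh c y).+1 (lg c y).+1 (bnd c - (sh c y).+1) (bnd c - (lg c y).+1).
case: ds hd => // v ds /(_ v (mem_head _ _))[vS e1 /andP[e2 _] /andP[e3 _]].
have := disj vS; suff -> : v \in L by [].
by have [|||] := rk_monoL (w := v) yL => //; apply: ltnW.
Qed.

Local Notation state_gen1' := (state_gen1 c' x0 u).
Local Notation chain_minor' := (@chain_minor V K I c' x0).
Local Notation minor_rest' := (@minor_rest V K I c' x0).
Local Notation state_gen1 := (state_gen1 c x0 u).
Local Notation chain_minor := (@chain_minor V K I c x0).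
Local Notation minor_rest := (@minor_rest V K I c x0).

Definition head_pair1 (q r : P) : Prop := exists ds,
  [/\ path (clt c) y ds, (u a < pre c S y + size (y :: ds))%N, q = chain_minor ds & r = minor_rest y ds].

Lemma state_gen1_split g : state_gen1 S L g ->
  state_gen1 S L' g \/ exists q r, head_pair1 q r /\ g = varX K y * q + r.
Proof.
move=> [v [ds [pa vL lt ->]]]; have [e|ne] := eqVneq v y; last first.
  by left; exists v, ds; rewrite in_setD1 ne vL.
subst v; right; exists (chain_minor ds), (minor_rest y ds); split; first by exists ds.
exact: (chain_minor_head K x0 inj rect rk_inj rk_monoL pa vL).
Qed.

Lemma head_pair1_gen q r : head_pair1 q r -> state_gen1 S L (varX K y * q + r).
Proof.
move=> [ds [pa lt -> ->]]; exists y, ds; split=> //.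
by rewrite (chain_minor_head K x0 inj rect rk_inj rk_monoL pa yL).
Qed.

Lemma state_gen1_mono S1 S2 L1 L2 (g : P) : S1 \subset S2 -> L1 \subset L2 ->
  state_gen1 S1 L1 g -> state_gen1 S2 L2 g.
Proof.
move=> s1 s2 [v [ds [pa vL lt ->]]]; exists v, ds; split=> //; first exact: (subsetP s2).
by apply: leq_trans lt _; rewrite leq_add2r; apply: ext_sub.
Qed.

Lemma pre_S'_after v : vx c v = a -> (sh c y < sh c v)%N -> (lg c y < lg c v)%N ->
  (pre c S y < pre c S' v)%N.
Proof.
move=> e1 e2 e3; have := ext_cell inj S' y; rewrite setU11 => e.
apply: (@leq_trans (pre c S' y).+1).
  by rewrite ltnS; apply: ext_sub; apply: subsetUr.
by rewrite -e /pre e1 leq_lis.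
Qed.

(** Dropping [y] shortens the diagonal by one, but moving [y] to [S] lengthens the chain before it
    by one. If nothing remains of the diagonal, [q] is 1 and [S'] itself breaks the bound. *)
Lemma head_pair1_gen_next q r : head_pair1 q r -> (q = 1 /\ ~ rank_ok c u S') \/ state_gen1 S' L' q.
Proof.
move=> [[|w ds] [pa lt -> _]].
  left; split; first exact: chain_minor_nil.
  move=> /(_ a); apply/negP; rewrite -ltnNge; apply: leq_trans lt _.
  have := ext_cell inj S' y; rewrite setU11 => e.
  have := ext_le_full inj S' a (sh c y).+1 (lg c y).+1; rewrite e.
  have : (pre c S y <= pre c S' y)%N by apply: ext_sub; apply: subsetUr.
  by rewrite addn1; lia.
have [pw pd] := andP pa; have [/eqP e1 e2 e3] := and3P pw.
right; exists w, ds; split=> //.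
  by apply: after_y; rewrite ?(ltnW e2) ?(ltnW e3) // => e; rewrite e ltnn in e2.
rewrite -e1; apply: leq_trans lt _; have := pre_S'_after (esym e1) e2 e3.
by move=> /=; lia.
Qed.

(** If the bound is exceeded only thanks to [y], a longest chain of [S'] before [v] uses [y], and as
    its last entry since no entry of [S] follows [y]; so [y] can be put in front of the diagonal. *)
Lemma state_gen1_next_split g : state_gen1 S' L' g -> state_gen1 S L' g \/ exists r, head_pair1 g r.
Proof.
move=> [v [ds [pa vL lt ->]]].
have [lt1|ge1] := ltnP (u (vx c v)) (pre c S v + size (v :: ds)).
  by left; exists v, ds.
right; exists (minor_rest y (v :: ds)).
have [/and3P[/eqP e1 e2 e3]|nlt] := boolP (clt c y v); last first.
  exfalso; move: lt; rewrite ltnNge; apply/negP; rewrite negbK.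
  suff -> : pre c S' v = pre c S v by [].
  apply: eq_ext => w e1 e2 e3; rewrite in_setU1.
  by case: eqP => [e|//]; subst w; rewrite /clt e1 eqxx e2 e3 in nlt.
exists (v :: ds); split=> //=; first by rewrite /clt e1 eqxx e2 e3.
suff le : (pre c S' v <= maxn (pre c S v) (pre c S y + 1))%N.
  by move: lt ge1; rewrite -e1 /=; lia.
have le0 : (pre c S' v <= lis (wadd (occ c S a) (sh c y) (lg c y)) (sh c v) (lg c v))%N.
  by apply: leq_lis_sub => i l _ _; rewrite -e1 occ_add eqxx.
apply: leq_trans le0 _; apply: leq_trans (lis_wadd _ e2 e3) _.
have -> : pre c S v = lis (occ c S a) (sh c v) (lg c v) by rewrite /pre /ext -e1.
rewrite geq_max leq_maxl /=; apply: leq_trans (leq_maxr _ _).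
have z : (lis (wshift (occ c S a) (sh c y).+1 (lg c y).+1) (sh c v - (sh c y).+1)
   (lg c v - (lg c y).+1) <= suf c S y)%N.
  by apply: leq_lis; apply: leq_sub2r; apply: ltnW; [apply: sh_bnd | apply: lg_bnd].
by rewrite -[X in (_ <= X)%N]addn0 leq_add2l; rewrite sufS_eq0 in z.
Qed.

Lemma not_rank_ok_head_pair1 : rank_ok c u S -> ~ rank_ok c u S' -> exists r, head_pair1 1 r.
Proof.
move=> ok nok; have := not_rank_ok_add ok nok; rewrite sufS_eq0 addn0 => lt.
by exists (minor_rest y [::]), [::]; split=> //; rewrite chain_minor_nil.
Qed.

Lemma head_pair1_free q r : head_pair1 q r -> yfree y q /\ yfree y r.
Proof.
by move=> [ds [pa _ -> ->]]; apply: (head_free K x0 rect rk_inj rk_monoL pa yL (leqnn _)).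
Qed.

Lemma state_gen1_free (g : P) : state_gen1 S L' g -> yfree y g.
Proof.
move=> [v [ds [pa vL lt ->]]]; have [ne vL0] := setD1P vL.
rewrite (chain_minor_head K x0 inj rect rk_inj rk_monoL pa vL0).
have [|h1 h2] := head_free K x0 rect rk_inj rk_monoL pa vL0 (w := y).
  by apply: ymin.
apply: yfreeD => //; apply: yfreeM => //; apply: yfreeX.
by rewrite eq_sym.
Qed.

Section InIdeal.
Variable G : P -> Prop.
Hypothesis hG : forall g, state_gen1 S L' g -> in_ideal G g.
Hypothesis hG1 : ~ rank_ok c u S -> in_ideal G 1.
Hypothesis hG' : forall g, state_gen1' S L' g -> in_ideal G g.
Hypothesis hG1' : ~ rank_ok c' u S -> in_ideal G 1.

Local Notation mv := (@mvar V K I c).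
Local Notation mv' := (@mvar V K I c').

Lemma chain_y ds x : path (clt c) y ds -> x \in y :: ds ->
  [/\ vx c x = a, (sh c y <= sh c x)%N & (lg c y <= lg c x)%N].
Proof.
move=> pa; rewrite inE => /predU1P[->//|/(chain_sh pa)[-> h1 h2]].
by split=> //; apply: ltnW.
Qed.

Lemma mix_L' r x : vx c r = a -> vx c x = a -> (sh c y <= sh c r)%N -> (lg c y <= lg c x)%N ->
  (sh c y < sh c r)%N \/ (lg c y < lg c x)%N -> mix c r x \in L'.
Proof.
move=> er ex sr lx lt; have [|e1 e2 e3] := @mixP1 r x; first by rewrite er ex.
apply: after_y; rewrite ?e1 ?e2 ?e3 // => e; rewrite e in e2 e3.
by rewrite -e2 -e3 !ltnn in lt; case: lt.
Qed.

(** The bordered minors in [schur_cross] omit the row or the column of [y], so [y] does not occur in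
    them and they lie in the ideal of the smaller state. *)
Lemma cross_same q r q' r' : head_pair1 q r -> head_pair1 q' r' -> in_ideal G (q * r' - q' * r).
Proof.
move=> [ds [pa lt -> ->]] [ds' [pa' lt' -> ->]].
have [_ /lead_neq0 D0] := lead_chain_minor K x0 inj rect rk_inj rk_monoL pa yL.
have [_ /lead_neq0 D0'] := lead_chain_minor K x0 inj rect rk_inj rk_monoL pa' yL.
rewrite /minor_rest !mulrN opprK addrC.
set D := pmat x0 mv ds ds _ _; set D' := pmat x0 mv ds' ds' _ _.
have hd x : x \in ds -> [/\ vx c x = a, (sh c y < sh c x)%N & (lg c y < lg c x)%N].
  exact: chain_sh.
have hd' x : x \in ds' -> [/\ vx c x = a, (sh c y < sh c x)%N & (lg c y < lg c x)%N].
  exact: chain_sh.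
have := @schur_cross V K G _ _ (prow x0 mv y ds' _) (pcol x0 mv ds' y _) D'
  (prow x0 mv y ds _) (pcol x0 mv ds y _) D (pmat x0 mv ds' ds _ _).
apply.
- move=> j; set z := nth x0 ds j; have zd : z \in ds by apply: mem_nth.
  have [ez sz lz] := hd z zd.
  have -> : \det D' * prow x0 mv y ds (size ds) 0 j -
     (prow x0 mv y ds' (size ds') *m \adj D' *m pmat x0 mv ds' ds _ _) 0 j =
     pminor x0 mv (size ds').+1 (y :: ds') (z :: ds').
    rewrite pminor_schur // [\det _ * _]mulrC; congr (_ * _ - _); rewrite mxE //.
    by rewrite [RHS]mxE; apply: eq_bigr => k _; rewrite [in LHS]mxE [in RHS]mxE; congr (_ * _); rewrite !mxE.
  apply: (minor_in inj rect hG hG1 (a := a) (i := sh c y) (l := lg c y)) => //.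
  + by move=> x /(chain_y pa')[].
  + by move=> x; rewrite inE => /predU1P[->|/hd'[? ? ?]]; split=> //; apply: ltnW.
  move=> x w /(chain_y pa')[ex sx lx]; rewrite inE => /predU1P[->|/hd'[? ? ?]];
    apply: mix_L' => //; by [apply: ltnW | right].
- move=> i; set z := nth x0 ds' i; have zd : z \in ds' by apply: mem_nth.
  have [ez sz lz] := hd' z zd.
  have -> : \det D * pcol x0 mv ds' y (size ds') i 0 -
     (pmat x0 mv ds' ds _ _ *m \adj D *m pcol x0 mv ds y _) i 0 =
     pminor x0 mv (size ds).+1 (z :: ds) (y :: ds).
    rewrite pminor_schur // [\det _ * _]mulrC; congr (_ * _ - _); rewrite mxE //.
    rewrite [RHS]mxE; apply: eq_bigr => k _; congr (_ * _).
    by rewrite mxE [RHS]mxE; apply: eq_bigr => l _; rewrite !mxE.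
  apply: (minor_in inj rect hG hG1 (a := a) (i := sh c y) (l := lg c y)) => //.
  + by move=> x; rewrite inE => /predU1P[->|/hd[? ? ?]]; split=> //; apply: ltnW.
  + by move=> x /(chain_y pa)[].
  move=> x w; rewrite inE => /predU1P[->|/hd[? ? ?]] /(chain_y pa)[ew sw lw];
    apply: mix_L' => //; by [apply: ltnW | left].
Qed.

Lemma mix_L'' r x : vx c' r = vx c' y -> vx c' x = vx c' y ->
  (sh c' y <= sh c' r)%N -> (lg c' y <= lg c' x)%N ->
  (sh c' y < sh c' r)%N \/ (lg c' y < lg c' x)%N -> mix c' r x \in L'.
Proof.
move=> er ex sr lx lt; have [|e1 e2 e3] := @mixP2 r x; first by rewrite er ex.
rewrite in_setD1; apply/andP; split.
  apply/eqP => e; rewrite e in e2 e3.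
  by rewrite -e2 -e3 !ltnn in lt; case: lt.
by apply: Lup yL _; apply: mono'; rewrite ?e1 ?e2 ?e3.
Qed.

Lemma mix_ar' v w : vx c' v = vx c' w ->
  [/\ ar (mix c' v w) = ar w, sh c' (mix c' v w) = sh c' v & sh c (mix c' v w) = sh c w].
Proof. by move=> e; have [e1 e2 e3] := mixP2 e; have [] := half_col h' e1 e3. Qed.

(** The matrix [W] of [schur_cross] has the rows of [ds] and, read in the other family, the columns
    of [ds']. Its entries lie in the block of [y], which both matrices share. *)
Lemma cross_sides ds ds' : path (clt c) y ds -> path (clt c') y ds' ->
  (u a < pre c S y + size (y :: ds))%N ->
  (u (vx c' y) < pre c' S y + size (y :: ds'))%N ->
  in_ideal G (chain_minor ds * minor_rest' y ds' - chain_minor' ds' * minor_rest y ds).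
Proof.
move=> pa pa' lt lt'.
have [_ /lead_neq0 D0] := lead_chain_minor K x0 inj rect rk_inj rk_monoL pa yL.
have rk_monoL' v w : v \in L -> vx c' v = vx c' w -> (sh c' v <= sh c' w)%N ->
    (lg c' v <= lg c' w)%N -> (w \in L) /\ (rk v <= rk w)%N.
  by move=> vL e1 e2 e3; have le := mono' e1 e2 e3; split=> //; apply: Lup le.
have [_ /lead_neq0 D0'] := lead_chain_minor K x0 inj' rect' rk_inj rk_monoL' pa' yL.
rewrite /minor_rest !mulrN opprK addrC -opprB; apply: in_idealN.
set D := pmat x0 mv ds ds _ _; set D' := pmat x0 mv' ds' ds' _ _.
have hd x : x \in ds -> [/\ vx c x = a, (sh c y < sh c x)%N & (lg c y < lg c x)%N].
  exact: chain_sh.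
have hd' x : x \in ds' -> [/\ vx c' x = vx c' y, (sh c' y < sh c' x)%N & (lg c' y < lg c' x)%N].
  exact: chain_sh.
(* [wf x] is the entry in the row of [x] and the column of [y], hence in the block of [y]; [zf] is
   its analogue in the other family. *)
pose wf x := mix c x y; pose zf x := mix c' x y.
have wfP x : x \in ds -> [/\ ar (wf x) = ar y, sh c (wf x) = sh c x & sh c' (wf x) = sh c' y].
  by move=> /hd[e _ _]; apply: mix_ar.
have zfP x : x \in ds' -> [/\ ar (zf x) = ar y, sh c' (zf x) = sh c' x & sh c (zf x) = sh c y].
  by move=> /hd'[e _ _]; apply: mix_ar'.
have wf_c' x : x \in ds -> vx c' (wf x) = vx c' y /\ (lg c' y < lg c' (wf x))%N.
  move=> xd; have [e1 e2 e3] := wfP x xd; have [-> e4] := half_blk h' e1; split=> //.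
  by have [_ e5 _] := hd x xd; lia.
have zf_c x : x \in ds' -> vx c (zf x) = a /\ (lg c y < lg c (zf x))%N.
  move=> xd; have [e1 e2 e3] := zfP x xd; have [-> e4] := half_blk h e1; split=> //.
  by have [_ e5 _] := hd' x xd; lia.
have zf_id x : x \in ds' -> mix c y (zf x) = zf x.
  by move=> xd; have [e _] := zf_c x xd; have [_ _ e2] := zfP x xd; apply: (mix_eq inj rect).
have wf_id x : x \in ds -> mix c' y (wf x) = wf x.
  by move=> xd; have [e _] := wf_c' x xd; have [_ _ e2] := wfP x xd; apply: (mix_eq inj' rect').
have comm x z : x \in ds -> z \in ds' -> mix c x (zf z) = mix c' z (wf x).
  move=> xd zd; have [i1 i2 i3] := wfP x xd; have [j1 j2 j3] := zfP z zd.
  have [|k1 k2 k3] := @mix_ar x (zf z).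
    by have [-> _] := zf_c z zd; have [-> _ _] := hd x xd.
  have [|l1 l2 l3] := @mix_ar' z (wf x).
    by have [-> _] := wf_c' x xd; have [-> _ _] := hd' z zd.
  by apply: block_eq; congruence.
pose dz := map zf ds'.
have nz (j : 'I_(size ds')) : nth x0 dz j = zf (nth x0 ds' j) by rewrite (nth_map x0).
(* Rows of [c'] are columns of the block, so [c'] is read transposed. *)
pose mvT x z := mv' z x.
set X' := (_ *m _ *m pcol x0 mv' ds' y _) 0 0.
have eX' : X' = (prow x0 mvT y ds' (size ds') *m \adj (pmat x0 mvT ds' ds' _ _)
    *m pcol x0 mvT ds' y (size ds')) 0 0.
  have -> : prow x0 mvT y ds' (size ds') = (pcol x0 mv' ds' y (size ds'))^T.
    by apply/matrixP => i j; rewrite !mxE.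
  have -> : pcol x0 mvT ds' y (size ds') = (prow x0 mv' y ds' (size ds'))^T.
    by apply/matrixP => i j; rewrite !mxE.
  have -> : pmat x0 mvT ds' ds' (size ds') (size ds') = D'^T.
    by apply/matrixP => i j; rewrite !mxE.
  by rewrite -trmx_adj -mulmxA -!trmx_mul [RHS]mxE.
rewrite {}eX' {X'}.
have -> : chain_minor' ds' = \det (pmat x0 mvT ds' ds' (size ds') (size ds')).
  by rewrite [LHS]pminor_tr.
have D0T : pminor x0 mvT (size ds') ds' ds' != 0 by rewrite -pminor_tr.
have -> : chain_minor ds = \det D by [].
apply: (@schur_cross V K G _ _ _ _ _ _ _ _ (pmat x0 mv ds dz _ _)).
- move=> j; have jd : nth x0 ds' j \in ds' by apply: mem_nth.
  have [ez lz] := zf_c _ jd.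
  set z := zf (nth x0 ds' j) in ez lz.
  have -> : \det D * prow x0 mvT y ds' (size ds') 0 j -
     (prow x0 mv y ds (size ds) *m \adj D *m pmat x0 mv ds dz _ _) 0 j =
     pminor x0 mv (size ds).+1 (y :: ds) (z :: ds).
    rewrite pminor_schur // [\det _ * _]mulrC; congr (_ * _ - _).
      by rewrite !mxE /mvT /mvar zf_id.
    rewrite mxE [RHS]mxE; apply: eq_bigr => k _; rewrite [in LHS]mxE [in RHS]mxE; congr (_ * _).
    by rewrite !mxE nz.
  apply: (minor_in inj rect hG hG1 (a := a) (i := sh c y) (l := lg c y)) => //.
  + by move=> x /(chain_y pa)[].
  + by move=> x; rewrite inE => /predU1P[->|/hd[? ? ?]]; split=> //; apply: ltnW.
  move=> x w /(chain_y pa)[ex sx lx]; rewrite inE => /predU1P[->|/hd[? ? ?]];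
    apply: mix_L' => //; by [apply: ltnW | right].
- move=> i; have id : nth x0 ds i \in ds by apply: mem_nth.
  have [ez lz] := wf_c' _ id.
  set z := wf (nth x0 ds i) in ez lz.
  have -> : \det (pmat x0 mvT ds' ds' (size ds') (size ds')) * pcol x0 mv ds y (size ds) i 0 -
     (pmat x0 mv ds dz _ _ *m \adj (pmat x0 mvT ds' ds' (size ds') (size ds'))
       *m pcol x0 mvT ds' y (size ds')) i 0 =
     pminor x0 mv' (size ds').+1 (y :: ds') (z :: ds').
    rewrite pminor_tr pminor_schur // [\det _ * _]mulrC; congr (_ * _ - _).
      by rewrite !mxE /mvar wf_id.
    rewrite mxE [RHS]mxE; apply: eq_bigr => k _; congr (_ * _).
    rewrite mxE [RHS]mxE; apply: eq_bigr => l _; congr (_ * _).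
    by rewrite !mxE nz /mvar comm ?mem_nth.
  apply: (minor_in inj' rect' hG' hG1' (a := vx c' y) (i := sh c' y) (l := lg c' y)) => //.
  + by move=> x; rewrite inE => /predU1P[->|/hd'[? ? ?]] //; split=> //; apply: ltnW.
  + by move=> x; rewrite inE => /predU1P[->|/hd'[? ? ?]]; split=> //; apply: ltnW.
  move=> x w; rewrite inE => hx; rewrite inE => hw.
  have [ex sx lx] : [/\ vx c' x = vx c' y, (sh c' y <= sh c' x)%N & (lg c' y <= lg c' x)%N].
    by case/predU1P: hx => [->//|/hd'[? ? ?]]; split=> //; apply: ltnW.
  have [ew lw] : vx c' w = vx c' y /\ (lg c' y < lg c' w)%N.
    by case/predU1P: hw => [->//|/hd'[? ? ?]].
  by apply: mix_L'' => //; [apply: ltnW | right].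
Qed.

(** * The case of a facet that can be enlarged by the deleted variable *)

Section Facet.
Variable E : {set V}.
Hypothesis subE : {subset E <= L' :|: S}.
Hypothesis SE : S \subset E.
Hypothesis faceEy : face (y |: E).
Hypothesis facet : forall z, z \in L' -> z \notin E -> ~ face (z |: E).
Variable ds : seq V.
Hypothesis pa : path (clt c) y ds.
Hypothesis lt_ds : (u a < pre c S y + size (y :: ds))%N.

Lemma ynE : y \notin E.
Proof.
apply/negP => /subE; rewrite in_setU in_setD1 eqxx /= => yS.
by have := ynS; rewrite yS.
Qed.

Lemma ext_E i l : (i <= (sh c y).+1)%N -> (l <= (lg c y).+1)%N ->
  ext c E a i l = ext c S a i l.
Proof.
move=> hi hl; apply: eq_ext => v e1 e2 e3; apply/idP/idP => [vE|/(subsetP SE)//].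
apply: before_y subE e1 _ _ vE; rewrite -ltnS.
  exact: leq_trans e2 hi.
exact: leq_trans e3 hl.
Qed.

Lemma ext_E' i l : (i <= (sh c' y).+1)%N -> (l <= (lg c' y).+1)%N ->
  ext c' E (vx c' y) i l = ext c' S (vx c' y) i l.
Proof.
move=> hi hl; apply: eq_ext => v e1 e2 e3; apply/idP/idP => [|/(subsetP SE)//].
move=> /subE; rewrite in_setU => /orP[/L'_rk|//].
rewrite ltnNge mono' // -ltnS.
  exact: leq_trans e2 hi.
exact: leq_trans e3 hl.
Qed.

Lemma ds_after x : x \in ds -> [/\ vx c x = a, (sh c y < sh c x)%N & (lg c y < lg c x)%N].
Proof. exact: chain_sh. Qed.

Lemma uniq_lg : uniq (map (lg c) ds).
Proof.
have : sorted ltn (map (lg c) (y :: ds)).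
  rewrite sorted_map; apply: sub_sorted (pa : sorted (clt c) (y :: ds)).
  by move=> v w /and3P[].
by rewrite ltn_sorted_uniq_leq => /andP[/andP[]].
Qed.

(** Some chain of [S] ending in the row or the column of [y] is longer than all chains strictly
    before [y]. Expanding along that line leaves minors that start behind it and, together with this
    chain, still exceed the bound. *)
Lemma head_inactive : ext c S a (sh c y).+1 (lg c y).+1 <> pre c S y ->
  in_ideal G (chain_minor (y :: ds)).
Proof.
have := ext_cell inj S y; rewrite (negbTE ynS) => -> ne.
have [m1 m2] : (pre c S y <= ext c S a (sh c y) (lg c y).+1)%N /\
   (pre c S y <= ext c S a (sh c y).+1 (lg c y))%N by split; apply: leq_lis.
have [gt|le1] := ltnP (pre c S y) (ext c S a (sh c y) (lg c y).+1).
  rewrite /chain_minor -[X in pminor _ _ _ _ X]cat1s.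
  apply: laplace_ideal => // [|rs1 sub e1]; first by rewrite addn1.
  apply: (minor_in inj rect hG hG1 (a := a) (i := sh c y) (l := (lg c y).+1)) => //.
  - by move=> x /(mem_subseq sub)/(chain_y pa)[].
  - by move=> x /ds_after[].
  - move=> r x /(mem_subseq sub)/(chain_y pa)[? ? ?] /ds_after[? ? ?].
    by apply: mix_L' => //; [apply: ltnW | right].
  by move: lt_ds gt; rewrite /=; lia.
have {le1} gt : (pre c S y < ext c S a (sh c y).+1 (lg c y))%N.
  by rewrite ltnNge; apply/negP => le2; apply: ne; lia.
rewrite /chain_minor pminor_tr -[X in pminor _ _ _ _ X]cat1s.
apply: laplace_ideal => // [|rs1 sub e1]; first by rewrite addn1.
rewrite -pminor_tr.
apply: (minor_in inj rect hG hG1 (a := a) (i := (sh c y).+1) (l := (lg c y))) => //.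
- by move=> x /ds_after[].
- by move=> x /(mem_subseq sub)/(chain_y pa)[].
- move=> r x /ds_after[? ? ?] /(mem_subseq sub)/(chain_y pa)[? ? ?].
  by apply: mix_L' => //; [apply: ltnW | left].
by move: lt_ds gt; rewrite /=; lia.
Qed.

(** Laplace expansion leaves minors on the columns of the overflowing block. Such a minor lies
    inside one block, so it is also a minor of the other family, where it is too large. *)
Lemma head_overflow : ext c S a (sh c y).+1 (lg c y).+1 = pre c S y ->
  overflow ar c c' u E y ds -> in_ideal G (chain_minor (y :: ds)).
Proof.
move=> act [v0 [v0a blk0 lt]].
set cs1 := [seq w <- ds | ar w == ar v0].
have sz1 : size cs1 = count (fun w => ar w == ar v0) ds by rewrite size_filter.
have [c0 c0d] : exists c0, c0 \in cs1.
  by case: cs1 sz1 blk0 => [<-//|x s _ _]; exists x; rewrite mem_head.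
have cs1P x : x \in cs1 -> ar x = ar v0 /\ x \in ds.
  by rewrite mem_filter => /andP[/eqP].
have [ac0 c0ds] := cs1P _ c0d; have [c0a sc0 lc0] := ds_after c0ds.
pose cs2 := y :: [seq w <- ds | ~~ (ar w == ar v0)].
have pe : perm_eq (y :: ds) (cs2 ++ cs1).
  by rewrite /cs2 cat_cons perm_cons perm_sym perm_catC perm_filterC.
rewrite /chain_minor; apply: (perm_cols_ideal (erefl _) pe).
apply: laplace_ideal => //; first by rewrite addnC -size_cat (perm_size pe).
move=> rs1 sub szr.
pose rf r := mix c r c0.
have rfP r : r \in rs1 -> [/\ ar (rf r) = ar v0, sh c (rf r) = sh c r & sh c' (rf r) = sh c' c0].
  move=> /(mem_subseq sub)/(chain_y pa)[e _ _].
  have [|e1 e2 e3] := @mix_ar r c0; first by rewrite e c0a.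
  by rewrite /rf e1 e2 e3.
have vx' x : ar x = ar v0 -> vx c' x = vx c' v0 by move=> e; have [] := half_blk h' e.
have mixE r x : r \in rs1 -> x \in cs1 -> mix c r x = mix c' x (rf r).
  move=> hr /cs1P[ax xd]; have [e1 e2 e3] := rfP r hr.
  have [ea _ _] := chain_y pa (mem_subseq sub hr).
  have [xa _ _] := ds_after xd.
  have [|i1 i2 i3] := @mix_ar r x; first by rewrite ea xa.
  have [|j1 j2 j3] := @mix_ar' x (rf r); first by rewrite !vx'.
  by apply: block_eq; congruence.
have -> : pminor x0 mv (size cs1) rs1 cs1 =
          pminor x0 mv' (size cs1) cs1 (map rf rs1).
  rewrite pminor_tr; apply: eq_pminor => i j hi hj.
  rewrite (nth_map x0) ?szr // /mvar mixE ?mem_nth ?szr //.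
pose iny := ar v0 == ar y.
(* In the block of [y] the chosen columns come after that of [y], so the chains of [S] up to there
   count too; for another block the corner is empty. *)
apply: (minor_in inj' rect' hG' hG1' (a := vx c' v0)
   (i := if iny then (sh c' y).+1 else 0%N) (l := if iny then lg c' y else 0%N)) => //.
- by rewrite size_map.
- move=> x /cs1P[ax xd]; split; first exact: vx'.
  rewrite /iny; case: eqP => // e.
  have [_ _ lx] := ds_after xd; have [_] := half_blk h (etrans ax e); lia.
- move=> x /mapP[r hr ->]; have [e1 e2 e3] := rfP r hr; split; first exact: vx'.
  rewrite /iny; case: eqP => // e.
  have [_ sr _] := chain_y pa (mem_subseq sub hr).
  have [_] := half_blk h' (etrans e1 e); lia.
- move=> x z hx /mapP[r hr ->]; rewrite -mixE //.
  have [_ xd] := cs1P _ hx; have [? ? ?] := ds_after xd.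
  have [? ? ?] := chain_y pa (mem_subseq sub hr).
  by apply: mix_L' => //; [apply: ltnW | right].
rewrite sz1; apply: leq_trans lt _; rewrite leq_add2r /iny; case: eqP => // e.
have ev : vx c' v0 = vx c' y by have [] := half_blk h' e.
rewrite ext_E' // ev.
have := ext_cell inj' S y; rewrite (negbTE ynS) => ->.
rewrite geq_max leqnn andbT.
(* By [act], [ext c] gains nothing from the row of [y]; hence neither does [ext c'], and the corner
   may stop before that row. *)
have sl := block_slopes h' h S y.
have m1 : (ext c S a (sh c y).+1 (lg c y) <= ext c S a (sh c y).+1 (lg c y).+1)%N.
  by rewrite leq_lis.
have m2 : (ext c' S (vx c' y) (sh c' y) (lg c' y) <= ext c' S (vx c' y) (sh c' y).+1 (lg c' y))%N.
  by rewrite leq_lis.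
rewrite act /pre in m1; lia.
Qed.

Lemma head_in : in_ideal G (chain_minor (y :: ds)).
Proof.
have [act|/eqP ne] := eqVneq (ext c S a (sh c y).+1 (lg c y).+1) (pre c S y); last first.
  exact: head_inactive.
apply: head_overflow => //; have [ok ok'] := faceEy.
have preE : pre c E y = pre c S y by apply: ext_E.
apply: (scan h h' ynE ok (rank_ok_sub (subsetUr _ _) ok') _ _ (p := size ds)) => //.
- by rewrite preE ext_E.
- move=> z ez sz lz zE [f1 f2]; apply: (facet _ zE) => //.
  by apply: after_y => //; [apply: ltnW | apply: ltnW | move=> e; rewrite e ltnn in sz].
- by rewrite preE.
- move=> i lti.
  have le : (sh c y + size ds <= sh c (last y ds))%N.
    elim: (ds) y pa => [|w s IH] v /=; first by rewrite addn0.
    by move=> /andP[/and3P[_ h1 _] /IH]; lia.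
  have [|w [ew sw _]] := half_down h (v := last y ds) (i := (sh c y + i.+1)%N).
    by apply: leq_trans le; rewrite leq_add2l.
  exists w => //; have [-> _] := half_blk h ew.
  by have [-> _ _] := chain_y pa (mem_last y ds).
- by move=> w /ds_after[].
exact: uniq_lg.
Qed.

End Facet.

End InIdeal.

End StateSide.

Lemma maximal_extension (V : finType) (Q : {set V} -> Prop) (T F : {set V}) :
  F \subset T -> Q F -> exists F' : {set V}, [/\ F \subset F', F' \subset T, Q F' &
    forall z, z \in T -> z \notin F' -> ~ Q (z |: F')].
Proof.
have [k] := ubnP #|T :\: F|; elim: k F => // k IH F lt sub QF.
have [[z [zT zF Qz]]|no] := classic (exists z, [/\ z \in T, z \notin F & Q (z |: F)]).
  have [||F' [h1 h2 h3 h4]] := IH (z |: F) _ _ Qz.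
  - rewrite -ltnS; apply: leq_trans lt; rewrite ltnS; apply: proper_card.
    apply/properP; split; first by apply: setDS; apply: subsetUr.
    by exists z; rewrite !inE ?zT ?zF ?eqxx.
  - by rewrite subUset sub1set zT.
  by exists F'; split=> //; apply: subset_trans h1; apply: subsetUr.
by exists F; split=> // z zT zF Qz; apply: no; exists z.
Qed.

(** * Irreducible monomials and faces *)

Section Reduce.
Variables (V : finType) (K : fieldType) (I : eqType) (x0 : V).
Variables (c : grid V I) (u : I -> nat).
Hypothesis inj : forall v w, vx c v = vx c w -> sh c v = sh c w -> lg c v = lg c w -> v = w.
Hypothesis rect : forall v w, vx c v = vx c w ->
  exists z, [/\ vx c z = vx c w, sh c z = sh c v & lg c z = lg c w].
Variables (rk : V -> nat) (L S : {set V}).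
Hypothesis rk_inj : injective rk.
Hypothesis rk_mono : forall v w, v \in L -> vx c v = vx c w -> (sh c v <= sh c w)%N ->
  (lg c v <= lg c w)%N -> (w \in L) /\ (rk v <= rk w)%N.
Local Notation P := {mpoly K[#|V|]}.
Local Notation "m ` v" := (fun_of_multinom m (enum_rank v)) (at level 1, v at level 0, format "m ` v").
Implicit Types (m : 'X_{1..#|V|}) (F : {set V}).

Lemma mdiagE (ds : seq V) w : (mdiag ds)`w = count_mem w ds.
Proof.
rewrite /mdiag mnm_sumE -sum1_count [RHS]big_mkcond /=; apply: eq_bigr => x _.
by rewrite mnm1E (inj_eq enum_rank_inj) eq_sym; case: eqP.
Qed.

Lemma mdiag_divides (ds : seq V) m : uniq ds -> {in ds, forall w, 0 < m`w}%N -> mon_divides (mdiag ds) m.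
Proof.
move=> un pos i; rewrite -(enum_valK i) mdiagE count_uniq_mem //.
by case: (boolP (_ \in ds)) => // /pos.
Qed.

Lemma divides_mdiag (ds : seq V) m w : mon_divides (mdiag ds) m -> w \in ds -> (0 < m`w)%N.
Proof.
move=> dv wd; apply: leq_trans (dv _); rewrite mdiagE.
by rewrite -has_count has_pred1.
Qed.

Lemma chain_uniq v ds : path (clt c) v ds -> uniq (v :: ds).
Proof.
move=> pa; apply: (@sorted_uniq _ (clt c)) => //; first exact: clt_trans.
by move=> w; rewrite /clt ltnn andbF.
Qed.

Lemma lead_chain_minor_any v ds : path (clt c) v ds -> v \in L ->
  lead_mon rk (chain_minor K c x0 (v :: ds)) (mdiag (v :: ds)).
Proof. by move=> pa vL; have [] := lead_chain_minor K x0 inj rect rk_inj rk_mono pa vL. Qed.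

(** In a too long chain of [F :|: S], leading entries of [S] are dropped one by one, [pre]
    accounting for them. From the first entry outside [S] on, all entries are in [L], hence in [F],
    and form the diagonal of a generator dividing [m]. If no such entry exists, [S] alone breaks the
    bound. *)
Lemma chain_reducible (G : P -> Prop) m F :
  (forall g, state_gen1 c x0 u S L g -> G g) -> (~ rank_ok c u S -> G 1) ->
  {in F, forall v, v \in L /\ (0 < m`v)%N} -> ~ rank_ok c u (F :|: S) ->
  (forall v, v \in S -> v \notin L) ->
  reducible_by rk G m.
Proof.
move=> hG h1 hF nok disj.
have red1 : ~ rank_ok c u S -> reducible_by rk G m.
  by move=> /h1 G1; exists 1, 0%MM; split=> //; [apply: lead1 | move=> i; rewrite mnm0E].
have [a lta] : exists a, (u a < full c (F :|: S) a)%N.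
  by apply: NNPP => no; apply: nok => a; rewrite leqNgt; apply/negP => lt; apply: no; exists a.
have [ds [sz so hd]] := chain_ex c (F :|: S) a 0 0 (bnd c) (bnd c).
have {}sz : size ds = full c (F :|: S) a by [].
case: ds sz so hd => [|v ds] sz so hd; first by rewrite -sz in lta.
have [_ va _ _] := hd v (mem_head _ _).
have {}hd : {subset v :: ds <= F :|: S} by move=> w /hd[].
have {}lta : (u (vx c v) < pre c S v + size (v :: ds))%N.
  by rewrite va sz; apply: leq_trans lta (leq_addl _ _).
move=> {sz va a nok}; elim: ds v so hd lta => [|w ds IH] v so hd lta.
  have [vS|vS] := boolP (v \in S).
    apply: red1 => /(_ (vx c v)); apply/negP; rewrite -ltnNge.
    by apply: leq_trans lta _; apply: (chain_full inj) => // x; rewrite inE => /eqP->.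
  have := hd v (mem_head _ _); rewrite in_setU (negbTE vS) orbF => vF.
  have [vL mv] := hF v vF.
  exists (chain_minor K c x0 [:: v]), (mdiag [:: v]); split.
  - by apply: hG; exists v, [::].
  - exact: lead_chain_minor_any.
  by apply: mdiag_divides => // x; rewrite inE => /eqP->.
have [vS|vS] := boolP (v \in S); last first.
  have := hd v (mem_head _ _); rewrite in_setU (negbTE vS) orbF => vF.
  have [vL mv] := hF v vF.
  exists (chain_minor K c x0 [:: v, w & ds]), (mdiag [:: v, w & ds]); split.
  - by apply: hG; exists v, (w :: ds).
  - exact: lead_chain_minor_any.
  apply: mdiag_divides; first exact: chain_uniq so.
  move=> x xd; have := hd x xd; rewrite in_setU => /orP[/hF[]//|xS].
  move: xd; rewrite inE => /predU1P[->//|xd].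
  by have := disj _ xS; rewrite (chain_L rk_mono so vL xd).
have [/and3P[/eqP e1 e2 e3] so'] := andP (so : clt c v w && path (clt c) w ds).
apply: (IH w so') => [x xd|]; first by apply: hd; rewrite inE xd orbT.
rewrite -e1; apply: leq_trans lta _; rewrite /= addnS -addSn leq_add2r.
have := ext_cell inj S v; rewrite vS => <-.
by rewrite /pre -e1 leq_lis.
Qed.

End Reduce.

(** * Induction on the set of remaining variables *)

Section State.
Variables (V : finType) (K : fieldType) (I A : eqType) (ar : V -> A) (x0 : V).
Local Notation P := {mpoly K[#|V|]}.
Local Notation "m ` v" := (fun_of_multinom m (enum_rank v)) (at level 1, v at level 0, format "m ` v").
Variables (c1 c2 : grid V I) (u : I -> nat).
Hypotheses (h12 : compat ar c1 c2) (h21 : compat ar c2 c1).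
Variable rk0 : V -> nat.
Hypothesis rk0_inj : injective rk0.
Hypothesis mono1 : forall v w, vx c1 v = vx c1 w -> (sh c1 v <= sh c1 w)%N ->
  (lg c1 v <= lg c1 w)%N -> (rk0 v <= rk0 w)%N.
Hypothesis mono2 : forall v w, vx c2 v = vx c2 w -> (sh c2 v <= sh c2 w)%N ->
  (lg c2 v <= lg c2 w)%N -> (rk0 v <= rk0 w)%N.
Implicit Types (S L : {set V}).

(** The generator 1 is the minor of size 0: it occurs when a chain of [S] alone breaks a bound. *)
Definition state_gen S L (g : P) : Prop :=
  [\/ g = 1 /\ ~ face c1 c2 u S, state_gen1 c1 x0 u S L g | state_gen1 c2 x0 u S L g].

Section Step.
Variables (S L : {set V}) (y : V) (rk2 : V -> nat).
Hypothesis Lup : forall v w, v \in L -> (rk0 v <= rk0 w)%N -> w \in L.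
Hypothesis yL : y \in L.
Hypothesis ymin : forall w, w \in L -> (rk0 y <= rk0 w)%N.
Hypothesis disj : forall v, v \in S -> v \notin L.
Hypothesis rk2_inj : injective rk2.
Local Notation L' := (L :\ y).
Local Notation S' := (y |: S).
Hypothesis agree : forall v w, v \in L' -> w \in L' -> (rk2 v < rk2 w)%N = (rk0 v < rk0 w)%N.

Definition head_pair (q r : P) := head_pair1 x0 c1 u S y q r \/ head_pair1 x0 c2 u S y q r.

Lemma L'up v w : v \in L' -> (rk0 v <= rk0 w)%N -> w \in L'.
Proof.
rewrite !in_setD1 => /andP[ne vL] le; rewrite (Lup vL le) andbT.
apply: contraNneq ne => e; subst w.
by apply/eqP/rk0_inj/eqP; rewrite eqn_leq le ymin.
Qed.

Lemma rk2_mono (c : grid V I) :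
  (forall v w, vx c v = vx c w -> (sh c v <= sh c w)%N -> (lg c v <= lg c w)%N ->
     (rk0 v <= rk0 w)%N) ->
  forall v w, v \in L' -> vx c v = vx c w -> (sh c v <= sh c w)%N ->
  (lg c v <= lg c w)%N -> (w \in L') /\ (rk2 v <= rk2 w)%N.
Proof.
move=> mono v w vL e1 e2 e3; have le := mono v w e1 e2 e3.
have wL := L'up vL le; split=> //.
by rewrite leqNgt agree // -leqNgt.
Qed.

Local Notation GN := (state_gen S L').

Lemma genN1 (g : P) : state_gen1 c1 x0 u S L' g -> in_ideal GN g.
Proof. by move=> h; apply: in_ideal_gen; constructor 2. Qed.
Lemma genN2 (g : P) : state_gen1 c2 x0 u S L' g -> in_ideal GN g.
Proof. by move=> h; apply: in_ideal_gen; constructor 3. Qed.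
Lemma genN01 : ~ rank_ok c1 u S -> in_ideal GN 1.
Proof. by move=> h; apply: in_ideal_gen; constructor 1; split=> // -[]. Qed.
Lemma genN02 : ~ rank_ok c2 u S -> in_ideal GN 1.
Proof. by move=> h; apply: in_ideal_gen; constructor 1; split=> // -[]. Qed.

Lemma head_pair_cross q r q' r' : head_pair q r -> head_pair q' r' -> in_ideal GN (q * r' - q' * r).
Proof.
case=> h; case=> h'.
- exact: (cross_same h12 rk0_inj mono1 Lup yL genN1 genN01 h h').
- case: h h' => [ds [pa lt -> ->]] [ds' [pa' lt' -> ->]].
  exact: (cross_sides h12 h21 rk0_inj mono1 mono2 Lup yL genN1 genN01 genN2 genN02 pa pa' lt lt').
- case: h h' => [ds [pa lt -> ->]] [ds' [pa' lt' -> ->]].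
  exact: (cross_sides h21 h12 rk0_inj mono2 mono1 Lup yL genN2 genN02 genN1 genN01 pa pa' lt lt').
- exact: (cross_same h21 rk0_inj mono2 Lup yL genN2 genN02 h h').
Qed.

Section SideColon.
Variables (c c' : grid V I).
Hypotheses (h : compat ar c c') (h' : compat ar c' c).
Hypothesis mono : forall v w, vx c v = vx c w -> (sh c v <= sh c w)%N ->
  (lg c v <= lg c w)%N -> (rk0 v <= rk0 w)%N.
Variable F' : {set V}.
Hypothesis F'sub : F' \subset L'.
Local Notation E := (F' :|: S).

Lemma subE : {subset E <= L' :|: S}.
Proof. by apply/subsetP; apply: setSU. Qed.

(** The too long chain passes through [y]. Its part before [y] lies in [S], and its part after [y]
    lies in [F'] and is the diagonal of some [q]. *)
Lemma extend_chain : rank_ok c u E -> ~ rank_ok c u (y |: E) -> exists ds,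
  [/\ path (clt c) y ds, {subset ds <= F'} & (u (vx c y) < pre c S y + size (y :: ds))%N].
Proof.
move=> ok nok; have lt := not_rank_ok_add ok nok.
have [ds [sz so hd]] := chain_ex c E (vx c y) (sh c y).+1 (lg c y).+1
  (bnd c - (sh c y).+1) (bnd c - (lg c y).+1).
have pE : pre c E y = pre c S y.
  apply: eq_ext => v e1 e2 e3; apply/idP/idP => [vE|vS]; last by rewrite in_setU vS orbT.
  exact: (before_y rk0_inj mono ymin subE e1 (ltnW e2) (ltnW e3) vE).
exists ds; split.
- case: ds so hd {sz} => //= v ds -> /(_ v (mem_head _ _))[_ e1 /andP[e2 _] /andP[e3 _]].
  by rewrite /clt e1 eqxx e2 e3.
- move=> x /hd[xE e1 /andP[e2 _] /andP[e3 _]].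
  have xL : x \in L'.
    by apply: (after_y mono Lup yL e1 (ltnW e2) (ltnW e3)) => e; rewrite e ltnn in e2.
  move: xE; rewrite in_setU => /orP[//|/disj].
  by have [_ ->] := setD1P xL.
have {}sz : size ds = suf c E y by [].
by rewrite -pE /= sz addnS -addSn -[X in (_ < X + _)%N]addn1.
Qed.

Lemma no_reduction v ds : path (clt c) v ds -> {subset v :: ds <= E} -> rank_ok c u E ->
  (u (vx c v) < pre c S v + size (v :: ds))%N -> False.
Proof.
move=> pa sub ok; apply/negP; rewrite -leqNgt.
apply: leq_trans (ok (vx c v)); apply: leq_trans (chain_full (half_inj h) pa sub).
by rewrite leq_add2r; apply: ext_sub; apply: subsetUr.
Qed.

Lemma lead_head_pair1 ds : path (clt c) y ds -> lead_mon rk2 (chain_minor K c x0 ds) (mdiag ds).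
Proof.
case: ds => [|w ds] pa.
  by rewrite chain_minor_nil /mdiag big_nil; apply: lead1.
have [/and3P[/eqP e1 e2 e3] pw] := andP (pa : clt c y w && path (clt c) w ds).
apply: (lead_chain_minor_any _ _ (half_inj h) (half_rect h) rk2_inj (rk2_mono mono) pw).
by apply: (after_y mono Lup yL (esym e1) (ltnW e2) (ltnW e3)) => e; rewrite e ltnn in e2.
Qed.

Lemma head_pair1_head q r : head_pair1 x0 c u S y q r -> exists ds, [/\ path (clt c) y ds,
  (u (vx c y) < pre c S y + size (y :: ds))%N, q = chain_minor K c x0 ds &
  varX K y * q + r = chain_minor K c x0 (y :: ds)].
Proof.
move=> [ds [pa lt -> ->]]; exists ds; split=> //.
by rewrite -(chain_minor_head K x0 (half_inj h) (half_rect h) rk0_inj (rk_monoL mono Lup) pa yL).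
Qed.

Lemma divides_in_E v ds ds1 m : path (clt c) v ds1 -> v \in L' ->
  {subset ds <= F'} -> {subset [set w in L' | 0 < m`w]%N <= F'} ->
  mon_divides (mdiag (v :: ds1)) (m + mdiag ds)%MM -> {subset v :: ds1 <= E}.
Proof.
move=> pa vL sub subm dv w wd; have := divides_mdiag dv wd.
have wL : w \in L'.
  move: wd; rewrite inE => /predU1P[->//|wd].
  exact: (chain_L (rk2_mono mono) pa vL wd).
rewrite mnmDE addn_gt0 in_setU => /orP[mw|].
  by rewrite subm // inE wL.
by rewrite mdiagE -has_count has_pred1 => /sub ->.
Qed.

End SideColon.

Lemma faceC T : face c1 c2 u T -> face c2 c1 u T.
Proof. by case. Qed.

(** The support of [m] in [L'] is enlarged to a facet [F']. Since some [y q + r] is outside the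
    ideal, [head_in] shows that [y] cannot be added to [F']. Then [extend_chain] gives a [q] whose
    leading monomial is supported on [F'], and multiplying by it does not lead out of this face. *)
Lemma head_pair_colon : (exists q r, head_pair q r /\ ~ in_ideal GN (varX K y * q + r)) ->
  forall m, m`y = 0%N -> ~ reducible_by rk2 GN m ->
  exists q r mq, [/\ head_pair q r, lead_mon rk2 q mq & ~ reducible_by rk2 GN (m + mq)%MM].
Proof.
move=> [q0 [r0 [F0 nin]]] m my nred.
have disj' v : v \in S -> v \notin L' by move=> /disj; rewrite in_setD1 negb_and orbC => ->.
pose Fm := [set w in L' | 0 < m`w]%N.
have Fm_sub : Fm \subset L' by apply/subsetP => w; rewrite inE => /andP[].
have FmP : {in Fm, forall v, v \in L' /\ (0 < m`v)%N}.
  by move=> v; rewrite inE => /andP[].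
have face_m : face c1 c2 u (Fm :|: S).
  split; apply: NNPP => nok; apply: nred.
    apply: (chain_reducible (x0 := x0) (half_inj h12) (half_rect h12) rk2_inj (rk2_mono mono1) _ _ FmP nok disj').
      by move=> g hg; constructor 2.
    by move=> nS; constructor 1; split=> // -[].
  apply: (chain_reducible (x0 := x0) (half_inj h21) (half_rect h21) rk2_inj (rk2_mono mono2) _ _ FmP nok disj').
    by move=> g hg; constructor 3.
  by move=> nS; constructor 1; split=> // -[].
have [F' [sub1 sub2 fE facet]] := maximal_extension (Q := fun T => face c1 c2 u (T :|: S)) Fm_sub face_m.
have facet' z : z \in L' -> z \notin F' :|: S -> ~ face c1 c2 u (z |: (F' :|: S)).
  rewrite in_setU negb_or => zL /andP[zF _]; rewrite setUA; exact: facet.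
have SE : S \subset F' :|: S by apply: subsetUr.
have nfy : ~ face c1 c2 u (y |: (F' :|: S)).
  move=> fy; apply: nin; case: F0 => [/(head_pair1_head h12 mono1)|/(head_pair1_head h21 mono2)] [ds [pa lt _ ->]].
    exact: (head_in h12 h21 rk0_inj mono1 mono2 Lup yL ymin disj genN1 genN01 genN2 genN02
      (subE sub2) SE fy facet' pa lt).
  apply: (head_in h21 h12 rk0_inj mono2 mono1 Lup yL ymin disj genN2 genN02 genN1 genN01
      (subE sub2) SE (faceC fy) _ pa lt).
  by move=> z zL zE [ok1 ok2]; apply: (facet' z).
have nred2 ds : {subset ds <= F'} -> ~ reducible_by rk2 GN (m + mdiag ds)%MM.
  move=> sub [g [mg [Gg lg dv]]]; case: Gg => [[_ nS]|[v [ds1 [pa vL lt eg]]]|[v [ds1 [pa vL lt eg]]]].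
  - by apply: nS; split; [apply: rank_ok_sub SE fE.1 | apply: rank_ok_sub SE fE.2].
  - have l2 := lead_chain_minor_any K x0 (half_inj h12) (half_rect h12) rk2_inj (rk2_mono mono1) pa vL.
    rewrite eg in lg; rewrite (lead_uniq rk2_inj lg l2) in dv.
    apply: (no_reduction h12 pa _ fE.1 lt).
    exact: (divides_in_E mono1 pa vL sub (subsetP sub1) dv).
  have l2 := lead_chain_minor_any K x0 (half_inj h21) (half_rect h21) rk2_inj (rk2_mono mono2) pa vL.
  rewrite eg in lg; rewrite (lead_uniq rk2_inj lg l2) in dv.
  apply: (no_reduction h21 pa _ fE.2 lt).
  exact: (divides_in_E mono2 pa vL sub (subsetP sub1) dv).
have [ok1|nok1] := classic (rank_ok c1 u (y |: (F' :|: S))).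
  have nok2 : ~ rank_ok c2 u (y |: (F' :|: S)) by move=> ok2; apply: nfy.
  have [ds [pa sub lt]] := extend_chain mono2 sub2 fE.2 nok2.
  exists (chain_minor K c2 x0 ds), (minor_rest K c2 x0 y ds), (mdiag ds); split; last exact: nred2.
    by right; exists ds.
  exact: (lead_head_pair1 h21 mono2 pa).
have [ds [pa sub lt]] := extend_chain mono1 sub2 fE.1 nok1.
exists (chain_minor K c1 x0 ds), (minor_rest K c1 x0 y ds), (mdiag ds); split; last exact: nred2.
  by left; exists ds.
exact: (lead_head_pair1 h12 mono1 pa).
Qed.

Variable rk1 : V -> nat.
Hypothesis rk1_inj : injective rk1.
Hypothesis rk1_min : forall w, w != y -> (rk1 y < rk1 w)%N.
Hypothesis rk1_agree : forall v w, v != y -> w != y -> (rk1 v < rk1 w)%N = (rk2 v < rk2 w)%N.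

Lemma state_step : groebner_basis rk2 (state_gen S' L') -> groebner_basis rk2 GN ->
  groebner_basis rk1 (state_gen S L).
Proof.
move=> gbC gbN.
have GNL g : GN g -> state_gen S L g.
  case=> [?|hg|hg]; first by constructor 1.
    by constructor 2; apply: state_gen1_mono hg; rewrite ?subD1set.
  by constructor 3; apply: state_gen1_mono hg; rewrite ?subD1set.
apply: (@gvd_groebner V K rk1 rk2 y rk1_inj rk2_inj rk1_min rk1_agree (state_gen S L) GN (state_gen S' L') head_pair) => //.
- move=> g [[-> _]||]; first exact: yfree1.
    by move=> hg; apply: (state_gen1_free h12 rk0_inj mono1 Lup ymin hg).
  by move=> hg; apply: (state_gen1_free h21 rk0_inj mono2 Lup ymin hg).
- move=> q r [].
    by move=> hg; apply: (head_pair1_free h12 rk0_inj mono1 Lup yL hg).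
  by move=> hg; apply: (head_pair1_free h21 rk0_inj mono2 Lup yL hg).
- move=> g [?||]; first by left; constructor 1.
    move=> /(state_gen1_split h12 rk0_inj mono1 y Lup)[?|[q [r [? ?]]]]; first by left; constructor 2.
    by right; exists q, r; split=> //; left.
  move=> /(state_gen1_split h21 rk0_inj mono2 y Lup)[?|[q [r [? ?]]]]; first by left; constructor 3.
  by right; exists q, r; split=> //; right.
- move=> q r [/(head_pair1_gen h12 rk0_inj mono1 Lup yL)|/(head_pair1_gen h21 rk0_inj mono2 Lup yL)].
    by constructor 2.
  by constructor 3.
- move=> g [[-> nf]||].
  + have [f|?] := classic (face c1 c2 u S); last by left; constructor 1.
    right; have [ok1|nok1] := classic (rank_ok c1 u S').
      have nok2 : ~ rank_ok c2 u S' by move=> ok2; apply: nf.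
      by have [r ?] := not_rank_ok_head_pair1 K x0 mono2 Lup yL disj f.2 nok2; exists r; right.
    by have [r ?] := not_rank_ok_head_pair1 K x0 mono1 Lup yL disj f.1 nok1; exists r; left.
  + move=> /(state_gen1_next_split mono1 Lup yL disj)[?|[r ?]]; first by left; constructor 2.
    by right; exists r; left.
  move=> /(state_gen1_next_split mono2 Lup yL disj)[?|[r ?]]; first by left; constructor 3.
  by right; exists r; right.
- move=> g [[-> nf]|hg|hg]; first constructor 1.
  + split=> // f; apply: nf; split; [apply: rank_ok_sub f.1 | apply: rank_ok_sub f.2]; exact: subsetUr.
  + by constructor 2; apply: state_gen1_mono hg; rewrite ?subsetUr.
  by constructor 3; apply: state_gen1_mono hg; rewrite ?subsetUr.
- move=> q r [/(head_pair1_gen_next h12 mono1 Lup yL)|/(head_pair1_gen_next h21 mono2 Lup yL)] [[-> nok]|?].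
  + by constructor 1; split=> // -[].
  + by constructor 2.
  + by constructor 1; split=> // -[].
  by constructor 3.
- exact: head_pair_cross.
have [ex|no] := classic (exists q r, head_pair q r /\ ~ in_ideal GN (varX K y * q + r)).
  by right; apply: head_pair_colon.
by left=> q r Fqr; apply: NNPP => nin; apply: no; exists q, r.
Qed.

End Step.

Lemma ideal_neq0_gen (G : P -> Prop) f : in_ideal G f -> f != 0 -> exists g, G g.
Proof.
move=> [[|x s] [hs ->]]; first by rewrite big_nil eqxx.
by exists x.2; apply: hs; rewrite mem_head.
Qed.

(* [rk1] reorders the variables outside [L], which come last: after the deletion
   of [y] the order has to be changed so that the next [y] is the largest of all
   the variables. *)
Theorem state_groebner S L rk1 :
  (forall v w, v \in L -> (rk0 v <= rk0 w)%N -> w \in L) ->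
  (forall v, v \in S -> v \notin L) -> injective rk1 ->
  (forall v w, v \in L -> w \in L -> (rk1 v < rk1 w)%N = (rk0 v < rk0 w)%N) ->
  (forall v w, v \in L -> w \notin L -> (rk1 v < rk1 w)%N) ->
  groebner_basis rk1 (state_gen S L).
Proof.
have [n] := ubnP #|L|; elim: n S L rk1 => // n IH S L rk1 ltn Lup disj rk1_inj agree dead.
(* With no variable left, the only possible generator is 1. *)
have [eL|[v0 v0L]] := set_0Vmem L.
  move=> f hf f0 mf lf; have [g Gg] := ideal_neq0_gen hf f0; subst L.
  exists 1, 0%MM; split; last by split; [apply: lead1 | move=> i; rewrite mnm0E].
  by case: Gg => [[_ nf]|[v [ds []]]|[v [ds []]]]; rewrite ?inE //; constructor 1.
case: (@arg_minnP _ v0 (fun v => v \in L) rk0 v0L) => y yL ymin.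
pose B := (\max_v rk1 v)%N.+1.
have ltB v : (rk1 v < B)%N by rewrite ltnS; apply: (leq_bigmax v).
pose rk2 v := if v == y then B else rk1 v.
have rk2_inj : injective rk2.
  move=> v w; rewrite /rk2; case: eqP => [->|_]; case: eqP => [->|_] // e.
  - by have := ltB w; rewrite -e ltnn.
  - by have := ltB v; rewrite e ltnn.
  exact: rk1_inj.
have Lup' v w : v \in L :\ y -> (rk0 v <= rk0 w)%N -> w \in L :\ y.
  exact: (L'up Lup ymin).
have cardL : (#|L :\ y| < n)%N.
  by move: ltn; rewrite (cardsD1 y) yL.
have agree2 v w : v \in L :\ y -> w \in L :\ y -> (rk2 v < rk2 w)%N = (rk0 v < rk0 w)%N.
  by move=> /setD1P[/negbTE nv vL] /setD1P[/negbTE nw wL]; rewrite /rk2 nv nw agree.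
have dead2 v w : v \in L :\ y -> w \notin L :\ y -> (rk2 v < rk2 w)%N.
  move=> /setD1P[/negbTE nv vL]; rewrite in_setD1 negb_and negbK /rk2 nv.
  by case: eqP => //= _; apply: dead.
apply: (state_step (rk2 := rk2) Lup yL ymin disj rk2_inj agree2 rk1_inj).
- move=> w ne; have [wL|wL] := boolP (w \in L); last exact: dead.
  rewrite agree // ltn_neqAle ymin // andbT; apply: contraNneq ne => /rk0_inj ->.
  by rewrite eqxx.
- by move=> v w /negbTE nv /negbTE nw; rewrite /rk2 nv nw.
- apply: IH => // v; rewrite in_setU1 in_setD1 => /predU1P[->|/disj/negbTE->].
    by rewrite eqxx.
  by rewrite andbF.
apply: IH => // v /disj; rewrite in_setD1 => /negbTE->.
by rewrite andbF.
Qed.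

End State.

(** * Quivers *)

Section Offsets.
Variables (r : nat) (n : 'I_r -> nat).
Implicit Types (k : 'I_r) (ks : seq 'I_r).

Definition block_list ks : seq (nat * nat) :=
  flatten [seq [seq (val k, j) | j <- iota 0 (n k)] | k <- ks].

(** The position in the concatenation at which the block of [k] starts. *)
Definition offset ks k : nat := sumn [seq n k' | k' <- take (index k ks) ks].

Lemma block_list_cons k0 ks :
  block_list (k0 :: ks) = [seq (val k0, j) | j <- iota 0 (n k0)] ++ block_list ks.
Proof. by []. Qed.

Lemma offset_cons k0 ks k :
  offset (k0 :: ks) k = if k0 == k then 0%N else (n k0 + offset ks k)%N.
Proof. by rewrite /offset /=; case: eqP. Qed.

Lemma nth_block_list ks k j : k \in ks -> (j < n k)%N ->
  nth (0, 0)%N (block_list ks) (offset ks k + j) = (val k, j) /\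
  (offset ks k + j < size (block_list ks))%N.
Proof.
move=> + lt; elim: ks => // k0 ks IH; rewrite inE block_list_cons offset_cons.
rewrite size_cat nth_cat size_map size_iota eq_sym.
have [->|ne] /= := eqVneq k0 k.
  move=> _; rewrite add0n lt (nth_map 0%N) ?size_iota // nth_iota // add0n.
  by split=> //; rewrite ltn_addr.
move=> /IH[e1 e2]; rewrite -addnA ltnNge leq_addr /= addKn e1.
by rewrite ltn_add2l.
Qed.

Lemma block_list_inv ks c : uniq ks -> (c < size (block_list ks))%N ->
  exists k j, [/\ k \in ks, (j < n k)%N & c = (offset ks k + j)%N].
Proof.
elim: ks c => // k0 ks IH c /= /andP[nk0 un].
rewrite block_list_cons size_cat size_map size_iota => lt.
have [lt0|ge0] := ltnP c (n k0).
  by exists k0, c; rewrite mem_head offset_cons eqxx.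
have [|k [j [kin ltj e]]] := IH (c - n k0)%N un; first by rewrite ltn_subLR.
exists k, j; rewrite inE kin orbT ltj offset_cons; split=> //.
have -> : (k0 == k) = false by apply: contraNF nk0 => /eqP ->.
by rewrite -addnA -e subnKC.
Qed.

End Offsets.

Section BlockGrid.
Variables (V : finType) (r : nat) (I : eqType) (T S : 'I_r -> I) (M : I -> nat).
Variables (ar : V -> 'I_r) (i j : V -> nat).
Hypothesis full : forall k x y, (x < M (T k))%N -> (y < M (S k))%N ->
  exists v, [/\ ar v = k, i v = x & j v = y].
Hypothesis ltM : forall v, (i v < M (T (ar v)))%N /\ (j v < M (S (ar v)))%N.
Hypothesis inj : forall v w, ar v = ar w -> i v = i w -> j v = j w -> v = w.

Definition blocks_at (a : I) : seq 'I_r := [seq k <- enum 'I_r | T k == a].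

(** [T] gives the matrix containing a block and [i] the index along the common side; exchanging [T]
    with [S] and [i] with [j] yields the other family. *)
Definition block_grid : grid V I :=
  Grid (fun v => T (ar v)) i
    (fun v => offset (fun k => M (S k)) (blocks_at (T (ar v))) (ar v) + j v)%N.

Local Notation bl a := (block_list (fun k => M (S k)) (blocks_at a)).

Lemma nth_block_grid v :
  nth (0, 0)%N (bl (T (ar v))) (lg block_grid v) = (val (ar v), j v) /\
  (lg block_grid v < size (bl (T (ar v))))%N.
Proof.
apply: nth_block_list; last by have [] := ltM v.
by rewrite mem_filter eqxx mem_enum.
Qed.

Lemma block_grid_col v w : vx block_grid v = vx block_grid w ->
  lg block_grid v = lg block_grid w -> ar v = ar w /\ j v = j w.
Proof.
move=> e1 e2; have [n1 _] := nth_block_grid v; have [n2 _] := nth_block_grid w.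
rewrite -e2 -[T (ar w)]e1 n1 in n2.
by case: n2 => /val_inj ? ?.
Qed.

Lemma block_grid_inv a l : (l < size (bl a))%N -> forall x, (x < M a)%N ->
  exists v, [/\ vx block_grid v = a, lg block_grid v = l & i v = x].
Proof.
move=> lt x ltx; have un : uniq (blocks_at a) by rewrite filter_uniq ?enum_uniq.
have [k [y [kin lty e]]] := block_list_inv un lt.
have ek : T k = a by move: kin; rewrite mem_filter => /andP[/eqP].
have [|v [e1 e2 e3]] := @full k x y _ lty; first by rewrite ek.
by exists v; rewrite /= e1 ek e3.
Qed.

Lemma block_grid_compat (c' : grid V I) : sh c' = j -> compat ar block_grid c'.
Proof.
move=> ec'; split; rewrite ?ec'.
- by move=> v w e1 e2 e3; have [e4 e5] := block_grid_col e1 e3; apply: inj.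
- move=> v w e; have [||z [e1 e2 e3]] := @full (ar w) (i v) (j w).
  + by have [+ _] := ltM v; rewrite -[T (ar w)]e.
  + by have [] := ltM w.
  by exists z; rewrite /= e1 e2 e3.
- exact: block_grid_col.
- by move=> v w e /=; rewrite e; split=> //; lia.
- move=> v w e el.
  case ej : (j w) => [|y]; first by right.
  (* A column with index [y.+1] in its block is preceded by the column with index [y] of the same
     block. *)
  left; have [n1 _] := nth_block_grid v.
  have kin : ar w \in blocks_at (T (ar w)) by rewrite mem_filter eqxx mem_enum.
  have [|n2 _] := @nth_block_list _ (fun k => M (S k)) (blocks_at (T (ar w))) (ar w) y kin.
    by have [_] := ltM w; rewrite ej => /ltnW.
  move: el; rewrite {1}/lg /= ej addnS => -[el].
  by rewrite el -[T (ar w)]e n1 in n2; case: n2 => /val_inj.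
- move=> v x le; have [lt1 lt2] := ltM v.
  by apply: full => //; apply: leq_ltn_trans lt1.
move=> v l le; have [n1 lt] := nth_block_grid v; have [lt1 _] := ltM v.
have [w [e1 e2 _]] := block_grid_inv (leq_ltn_trans le lt) lt1.
by exists w.
Qed.

End BlockGrid.

(** * Minors of matrices of variables as minors of a grid *)

Section Represents.
Variables (V : finType) (K : fieldType) (I : eqType) (c : grid V I) (x0 : V).
Local Notation P := {mpoly K[#|V|]}.
Hypothesis inj : forall v w, vx c v = vx c w -> sh c v = sh c w -> lg c v = lg c w -> v = w.
Hypothesis rect : forall v w, vx c v = vx c w ->
  exists z, [/\ vx c z = vx c w, sh c z = sh c v & lg c z = lg c w].

(** In particular every entry of [X] is a variable, so the default in [polymx] is never reached. *)
Definition represents (a : I) p q (X : 'M[option V]_(p, q)) : Prop :=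
  (forall v, vx c v = a -> (sh c v < p)%N /\ (lg c v < q)%N) /\
  (forall x y, exists v, [/\ X x y = Some v, vx c v = a, sh c v = x & lg c v = y]).

(** Increasing choices of rows and columns make the diagonal a chain, and the diagonal determines
    the minor. *)
Lemma minors_chain_minor a p q (X : 'M[option V]_(p, q)) n g : represents a X ->
  minors n.+1 (polymx K X) g -> exists v ds,
  [/\ path (clt c) v ds, vx c v = a, size ds = n & g = chain_minor K c x0 (v :: ds)].
Proof.
move=> [_ ex] [f [h [incf [inch ->]]]].
pose w k := odflt x0 (X (f k) (h k)).
have wP k : [/\ vx c (w k) = a, sh c (w k) = f k & lg c (w k) = h k].
  by have [v [e ? ? ?]] := ex (f k) (h k); rewrite /w e.
pose ds := [seq w k | k <- enum 'I_n.+1].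
have sz : size ds = n.+1 by rewrite size_map size_enum_ord.
have nw (k : 'I_n.+1) : nth x0 ds k = w k.
  by rewrite (nth_map ord0) ?size_enum_ord // nth_ord_enum.
have eg : \det (\matrix_(x, y) polymx K X (f x) (h y)) = chain_minor K c x0 ds.
  rewrite /chain_minor sz; congr (\det _); apply/matrixP => x y; rewrite !mxE !nw /mvar.
  have [v [e e1 e2 e3]] := ex (f x) (h y); rewrite e /=; congr (varX K _).
  have [i1 i2 i3] := wP x; have [j1 j2 j3] := wP y.
  by apply/esym/(mix_eq inj rect); congruence.
rewrite eg; case: ds sz nw {eg} => // v ds sz nw; exists v, ds; split=> //.
- apply/(sortedP x0 (s := v :: ds)) => k; rewrite sz => lk.
  have := nw (Ordinal lk); have := nw (Ordinal (ltnW lk)); rewrite /= => -> ->.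
  have [i1 i2 i3] := wP (Ordinal (ltnW lk)); have [j1 j2 j3] := wP (Ordinal lk).
  rewrite /clt i1 j1 eqxx i2 j2 i3 j3 /=.
  by apply/andP; split; [apply: incf | apply: inch].
- by have := nw ord0; rewrite /= => ->; have [] := wP ord0.
by case: sz.
Qed.

Lemma chain_minor_minors a p q (X : 'M[option V]_(p, q)) n v ds : represents a X ->
  path (clt c) v ds -> vx c v = a -> size ds = n ->
  minors n.+1 (polymx K X) (chain_minor K c x0 (v :: ds)).
Proof.
move=> [lt ex] pa va sz.
have sz1 : size (v :: ds) = n.+1 by rewrite /= sz.
have nd (k : 'I_n.+1) : vx c (nth x0 (v :: ds) k) = a.
  have : nth x0 (v :: ds) k \in v :: ds by rewrite mem_nth ?sz1.
  by rewrite inE => /predU1P[->//|/(chain_sh pa)[->]].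
exists (fun k => Ordinal (proj1 (lt _ (nd k)))), (fun k => Ordinal (proj2 (lt _ (nd k)))).
have mon (k l : 'I_n.+1) : (k < l)%N -> clt c (nth x0 (v :: ds) k) (nth x0 (v :: ds) l).
  move=> kl; apply: (sorted_ltn_nth (@clt_trans _ _ c) x0 (pa : sorted (clt c) (v :: ds))) => //;
    by rewrite inE sz1.
split; first by move=> k l /mon/and3P[].
split; first by move=> k l /mon/and3P[].
rewrite /chain_minor sz1; congr (\det _); apply/matrixP => x y; rewrite !mxE.
set x1 := Ordinal _; set y1 := Ordinal _; have [w [-> e1 e2 e3]] := ex x1 y1.
by congr (varX K _); apply: (mix_eq inj rect); rewrite ?nd.
Qed.

End Represents.

Section Quiver.
Variables (d r : nat) (s t : 'I_r -> 'I_d) (m : 'I_d -> nat).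
Local Notation V := (qvar s t m).

Definition qarrow (v : V) : 'I_r := tag v.
Definition qrow (v : V) : nat := (tagged v).1.
Definition qcol (v : V) : nat := (tagged v).2.

Lemma qvar_ofE k i j v : qvar_of s t m k i j = Some v <->
  [/\ k = qarrow v, i = qrow v & j = qcol v].
Proof.
rewrite /qvar_of; split.
  case: insubP => // k' _ ek; case: insubP => // i' _ ei; case: insubP => // j' _ ej [<-].
  by rewrite /qarrow /qrow /qcol /= ek ei ej.
case: v => k' [i' j'] [-> -> ->].
by rewrite /qarrow /qrow /qcol /= valK !valK.
Qed.

Lemma qvar_of_ex k (i j : nat) : (i < m (t k))%N -> (j < m (s k))%N ->
  exists v : V, [/\ qarrow v = k, qrow v = i & qcol v = j].
Proof.
move=> lti ltj.
exists (Tagged (fun k0 : 'I_r => ('I_(m (t k0)) * 'I_(m (s k0)))%type)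
  (Ordinal lti, Ordinal ltj)).
by [].
Qed.

Lemma qvar_lt (v : V) : (qrow v < m (t (qarrow v)))%N /\ (qcol v < m (s (qarrow v)))%N.
Proof. by split; apply: ltn_ord. Qed.

Lemma qvar_inj (v w : V) : qarrow v = qarrow w -> qrow v = qrow w -> qcol v = qcol w -> v = w.
Proof.
move=> e1 e2 e3; have h : qvar_of s t m (qarrow v) (qrow v) (qcol v) = Some v by apply/qvar_ofE.
have h' : qvar_of s t m (qarrow v) (qrow v) (qcol v) = Some w.
  by apply/qvar_ofE; rewrite e1 e2 e3.
by rewrite h in h'; case: h'.
Qed.

Definition sink_grid := block_grid t s m qarrow qrow qcol.
Definition source_grid := block_grid s t m qarrow qcol qrow.

Lemma sink_compat : compat qarrow sink_grid source_grid.
Proof.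
apply: block_grid_compat => //.
- exact: qvar_of_ex.
- exact: qvar_lt.
- exact: qvar_inj.
Qed.

Lemma source_compat : compat qarrow source_grid sink_grid.
Proof.
apply: block_grid_compat => //.
- by move=> k x y hx hy; have [v [? ? ?]] := qvar_of_ex hy hx; exists v.
- by move=> v; have [] := qvar_lt v.
- by move=> v w e1 e2 e3; apply: qvar_inj.
Qed.

Lemma sink_represents a : represents sink_grid a (A_sink s t m a).
Proof.
split=> [v <-|x y].
  split; first by have [] := qvar_lt v.
  exact: (nth_block_grid qvar_lt v).2.
have [v [e1 e2 e3]] := block_grid_inv (S := s) qvar_of_ex (ltn_ord y) (ltn_ord x).
exists v; split=> //; rewrite mxE /=; apply/qvar_ofE.
have [+ _] := nth_block_grid (T := t) (S := s) (M := m) qvar_lt v.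
rewrite e2 (_ : t (qarrow v) = a) // => n1.
by rewrite [nth _ _ _]n1 e3.
Qed.

Lemma source_represents b : represents source_grid b (A_source s t m b)^T.
Proof.
have lt v : (qcol v < m (s (qarrow v)))%N /\ (qrow v < m (t (qarrow v)))%N.
  by have [] := qvar_lt v.
have full k x y : (x < m (s k))%N -> (y < m (t k))%N ->
    exists v : V, [/\ qarrow v = k, qcol v = x & qrow v = y].
  by move=> hx hy; have [v [? ? ?]] := qvar_of_ex hy hx; exists v.
split=> [v <-|x y].
  split; first by have [] := qvar_lt v.
  exact: (nth_block_grid lt v).2.
have [v [e1 e2 e3]] := block_grid_inv (S := t) full (ltn_ord y) (ltn_ord x).
exists v; split=> //; rewrite !mxE /=; apply/qvar_ofE.
have [+ _] := nth_block_grid (T := s) (S := t) (M := m) lt v.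
rewrite e2 (_ : s (qarrow v) = b) // => n1.
by rewrite [nth _ _ _]n1 e3.
Qed.

End Quiver.

Lemma minors_tr (V : finType) (K : fieldType) n p q (X : 'M[option V]_(p, q)) g :
  minors n (polymx K X) g <-> minors n (polymx K X^T) g.
Proof.
split=> -[f [h [incf [inch ->]]]]; exists h, f; split=> //; split=> //;
  rewrite -det_tr; congr (\det _); apply/matrixP => x y; by rewrite !mxE.
Qed.

(** The comparison goes through the entry [z] in the row of [v] and the column of [w], once along a
    row and once along a column. *)
Lemma consistent_mono (V : finType) (I : eqType) (c : grid V I) (rk : V -> nat) a p q
    (X : 'M[option V]_(p, q)) : injective rk ->
  (forall v w, vx c v = vx c w -> sh c v = sh c w -> lg c v = lg c w -> v = w) ->
  represents c a X -> consistent rk X ->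
  forall v w, vx c v = a -> vx c w = a -> (sh c v <= sh c w)%N -> (lg c v <= lg c w)%N ->
  (rk v <= rk w)%N.
Proof.
move=> rki inj [lt ex] [con1 con2] v w va wa les lel.
have gtrk x y : lex_gt rk U_(enum_rank x) U_(enum_rank y) -> (rk x <= rk y)%N.
  move=> [z [h1 h2]]; rewrite !mnm1v in h1.
  have ez : z = x by move: h1; case: (x =P z) => [//|_]; case: (y == z).
  subst z; rewrite leqNgt; apply/negP => /h2; rewrite !mnm1v eqxx.
  by move: h1; rewrite eqxx eq_sym; case: (x == y).
have [lv1 lv2] := lt v va; have [lw1 lw2] := lt w wa.
have Xv : forall u (h1 : (sh c u < p)%N) (h2 : (lg c u < q)%N), vx c u = a ->
    X (Ordinal h1) (Ordinal h2) = Some u.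
  move=> u h1 h2 ua; have [u' [-> e1 e2 e3]] := ex (Ordinal h1) (Ordinal h2).
  by congr Some; apply: inj; rewrite ?e1 ?ua.
have [z [ez za sz lz]] := ex (Ordinal lv1) (Ordinal lw2).
apply: (@leq_trans (rk z)).
  move: lel; rewrite leq_eqVlt => /predU1P[e|ltl].
    by suff -> : v = z by []; apply: inj; rewrite ?sz ?lz ?za ?va.
  by apply: gtrk; apply: (con1 (Ordinal lv1) (Ordinal lv2) (Ordinal lw2)) => //; apply: Xv.
move: les; rewrite leq_eqVlt => /predU1P[e|lts].
  by suff -> : z = w by []; apply: inj; rewrite ?sz ?lz ?za ?wa.
by apply: gtrk; apply: (con2 (Ordinal lv1) (Ordinal lw1) (Ordinal lw2)) => //; apply: Xv.
Qed.

Lemma consistent_tr (V : finType) (rk : V -> nat) p q (X : 'M[option V]_(p, q)) :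
  consistent rk X -> consistent rk X^T.
Proof.
move=> [h1 h2]; split.
  by move=> i j j' v v' lt; rewrite !mxE; apply: h2.
by move=> i i' j v v' lt; rewrite !mxE; apply: h1.
Qed.

(** The state with nothing deleted is generated by all minors larger than the bounds. The natural
    generators are among them, and the leading monomial of each is divisible by that of a natural
    generator, whose diagonal is an initial piece of its own. *)
Theorem theorem1p2 (K : fieldType) (d r : nat) (srcV : pred 'I_d)
  (s t : 'I_r -> 'I_d) (m u : 'I_d -> nat)
  (Hbip : bipartite_quiver srcV s t)
  (rk : qvar s t m -> nat) (Hlex : is_lex_order rk)
  (Hcons : forall g : 'I_d,
      if srcV g then consistent rk (A_source s t m g)
      else consistent rk (A_sink s t m g)) :
  groebner_basis (K := K) rk
    (fun f => exists g : 'I_d,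
       if srcV g then minors (u g).+1 (polymx K (A_source s t m g)) f
       else minors (u g).+1 (polymx K (A_sink s t m g)) f).
Proof.
have h12 := sink_compat s t m; have h21 := source_compat s t m.
set c1 := sink_grid s t m in h12 h21; set c2 := source_grid s t m in h12 h21.
have sink v : srcV (vx c1 v) = false by apply/negbTE; have [] := Hbip (qarrow v).
have source v : srcV (vx c2 v) by have [] := Hbip (qarrow v).
have mono1 v w : vx c1 v = vx c1 w -> (sh c1 v <= sh c1 w)%N ->
    (lg c1 v <= lg c1 w)%N -> (rk v <= rk w)%N.
  move=> e; have := Hcons (vx c1 v); rewrite sink => con.
  exact: (consistent_mono Hlex (half_inj h12) (sink_represents s t _ _) con).
have mono2 v w : vx c2 v = vx c2 w -> (sh c2 v <= sh c2 w)%N ->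
    (lg c2 v <= lg c2 w)%N -> (rk v <= rk w)%N.
  move=> e; have := Hcons (vx c2 v); rewrite source => /consistent_tr con.
  exact: (consistent_mono Hlex (half_inj h21) (source_represents s t _ _) con).
set G := (fun f => _).
have G1 v ds : path (clt c1) v ds -> size ds = u (vx c1 v) -> forall x0,
    G (chain_minor K c1 x0 (v :: ds)).
  move=> pa sz x0; exists (vx c1 v); rewrite sink.
  exact: (chain_minor_minors K x0 (half_inj h12) (half_rect h12) (sink_represents s t _ _) pa).
have G2 v ds : path (clt c2) v ds -> size ds = u (vx c2 v) -> forall x0,
    G (chain_minor K c2 x0 (v :: ds)).
  move=> pa sz x0; exists (vx c2 v); rewrite source; apply/minors_tr.
  exact: (chain_minor_minors K x0 (half_inj h21) (half_rect h21) (source_represents s t _ _) pa).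
have Ginv x0 g : G g -> state_gen x0 c1 c2 u set0 setT g.
  move=> [a]; case: ifP => [srca /minors_tr|srca].
    move=> /(minors_chain_minor x0 (half_inj h21) (half_rect h21) (source_represents s t _ _)).
    move=> [v [ds [pa va sz ->]]]; constructor 3; exists v, ds; split=> //.
    by rewrite va /= sz addnS ltnS leq_addl.
  move=> /(minors_chain_minor x0 (half_inj h12) (half_rect h12) (sink_represents s t _ _)).
  move=> [v [ds [pa va sz ->]]]; constructor 2; exists v, ds; split=> //.
  by rewrite va /= sz addnS ltnS leq_addl.
move=> f If f0 mf lf.
(* A nonzero element of the ideal requires a generator, and a minor of positive size contains a
   variable, which serves as default. *)
have [x0 _] : exists x0 : qvar s t m, true.
  have [g [a]] := ideal_neq0_gen If f0; case: ifP => _.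
    move=> /minors_tr[f1 [h1 _]].
    by have [_ /(_ (f1 ord0) (h1 ord0))[v _]] := source_represents s t m a; exists v.
  move=> [f1 [h1 _]].
  by have [_ /(_ (f1 ord0) (h1 ord0))[v _]] := sink_represents s t m a; exists v.
have If' : in_ideal (state_gen (K := K) x0 c1 c2 u set0 setT) f.
  by apply: in_ideal_sub If => g /(Ginv x0)/in_ideal_gen.
have gb : groebner_basis rk (state_gen (K := K) x0 c1 c2 u set0 setT).
  refine (state_groebner (K := K) (x0 := x0) (u := u) (S := set0) (L := setT) (rk1 := rk)
    h12 h21 Hlex mono1 mono2 _ _ Hlex _ _) => //.
  - by move=> v; rewrite inE.
  by move=> v w _; rewrite inE.
have [g [mg [Gg [lgm dv]]]] := gb f If' f0 mf lf.
(* With [S] empty, the condition on a diagonal concerns only its length. *)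
have ext0 (c : grid (qvar s t m) 'I_d) a i l : ext c set0 a i l = 0%N.
  apply/eqP; rewrite -leqn0; apply: lis_le_nonempty_rows => i' j' _.
  by apply/existsP => -[v]; rewrite inE.
have sub v ds n : mon_divides (mdiag (v :: take n ds)) (mdiag (v :: ds)).
  move=> i; rewrite -{2}(cat_take_drop n ds) /mdiag -cat_cons big_cat mnmDE.
  exact: leq_addr.
have divT (m1 m2 m3 : 'X_{1..#|qvar s t m|}) :
    mon_divides m1 m2 -> mon_divides m2 m3 -> mon_divides m1 m3.
  by move=> h1 h2 i; apply: leq_trans (h1 i) (h2 i).
have up (c : grid (qvar s t m) 'I_d) : (forall v w, vx c v = vx c w -> (sh c v <= sh c w)%N ->
    (lg c v <= lg c w)%N -> (rk v <= rk w)%N) -> forall v w, v \in setT -> vx c v = vx c w ->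
    (sh c v <= sh c w)%N -> (lg c v <= lg c w)%N -> (w \in setT) /\ (rk v <= rk w)%N.
  by move=> mono v w _ e1 e2 e3; split=> //; apply: mono.
have tk v (ds : seq (qvar s t m)) (n : nat) : (n < 0 + size (v :: ds))%N -> size (take n ds) = n.
  by rewrite add0n /= ltnS => le; rewrite size_takel.
case: Gg => [[_ nf]|[v [ds [pa _ lt eg]]]|[v [ds [pa _ lt eg]]]].
- by case: nf; split=> a; rewrite /full ext0.
- rewrite /pre ext0 in lt; rewrite eg in lgm.
  have [ld _] := lead_chain_minor K x0 (half_inj h12) (half_rect h12) Hlex (up _ mono1) pa (in_setT v).
  rewrite (lead_uniq Hlex lgm ld) in dv.
  have pt : path (clt c1) v (take (u (vx c1 v)) ds) by apply: take_path.
  have [lt0 _] := lead_chain_minor K x0 (half_inj h12) (half_rect h12) Hlex (up _ mono1) pt (in_setT v).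
  exists (chain_minor K c1 x0 (v :: take (u (vx c1 v)) ds)), (mdiag (v :: take (u (vx c1 v)) ds)).
  split; first by apply: G1 => //; apply: tk lt.
  by split=> //; apply: divT dv; apply: sub.
rewrite /pre ext0 in lt; rewrite eg in lgm.
have [ld _] := lead_chain_minor K x0 (half_inj h21) (half_rect h21) Hlex (up _ mono2) pa (in_setT v).
rewrite (lead_uniq Hlex lgm ld) in dv.
have pt : path (clt c2) v (take (u (vx c2 v)) ds) by apply: take_path.
have [lt0 _] := lead_chain_minor K x0 (half_inj h21) (half_rect h21) Hlex (up _ mono2) pt (in_setT v).
exists (chain_minor K c2 x0 (v :: take (u (vx c2 v)) ds)), (mdiag (v :: take (u (vx c2 v)) ds)).
split; first by apply: G2 => //; apply: tk lt.
by split=> //; apply: divT dv; apply: sub.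
Qed.
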